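(* Consider the weighted recursive graph with out-degree $m\in\mathbb{N}$ and $\mathbb{E}[W]=1$. Let $\Pi$ be a Poisson point process on $(0,\infty)\times\mathbb{R}$ with intensity measure $\nu(\mathrm{d}t,\mathrm{d}x):=\mathrm{d}t\times\mathrm{e}^{-x}\mathrm{d}x$, let $0<s<t<\infty$ and let $U\sim\mathrm{Unif}(\log s,\log t)$ be independent of $\Pi$. (RV) Suppose the vertex-weights satisfy sub-case (RV) with $\tau\in(0,1)$. Let $\gamma:=1/(\tau+1)$ and let $\ell$ be a strictly positive function such that $\lim_{n\to\infty}(\log\ell(n))^2/\log n=\zeta_0$ for some $\zeta_0\in[0,\infty)$. Then, as $n\to\infty$, $$\Big(\max_{i\in C_n(\gamma,s,t,\ell)}\frac{\mathcal{Z}_n(i)-m(1-\gamma)b_{n^\gamma}\log n}{m(1-\gamma)a_{n^\gamma}\log n},\frac{I_n(\gamma,s,t,\ell)}{\ell(n)n^\gamma}\Big)\overset{d}{\longrightarrow}\Big(\max_{\substack{(v,w)\in\Pi\\ v\in[s,t]}}(w-\log v)-\frac{\zeta_0(\tau+1)^2}{2\tau},\ \mathrm{e}^U\Big),$$ and the first coordinate of the limit follows a Gumbel distribution with location parameter $\log\log(t/s)-\zeta_0(\tau+1)^2/(2\tau)$. (RaV) Suppose the vertex-weights satisfy sub-case (RaV) and let $t_n:=\exp(-\tau\log n/\log(b_n))$. Then, as $n\to\infty$, $$\Big(\max_{i\in C_n(1,s,t,t_n)}\frac{\mathcal{Z}_n(i)-mb_{t_nn}\log(1/t_n)}{ma_{t_nn}\log(1/t_n)},\frac{I_n(1,s,t,t_n)}{t_nn}\Big)\overset{d}{\longrightarrow}\Big(\max_{\substack{(v,w)\in\Pi\\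 v\in[s,t]}}(w-\log v),\ \mathrm{e}^U\Big),$$ and the first coordinate of the limit follows a Gumbel distribution with location parameter $\log\log(t/s)$.
   Context: Weighted recursive graph (WRG): Let $m\in\mathbb{N}=\{1,2,\dots\}$ and let $W_1,W_2,\dots$ (the vertex-weights) be i.i.d. copies of a non-negative random variable $W$ with $\mathbb{P}(W>0)=1$; set $S_n=\sum_{i=1}^nW_i$. $\mathcal{G}_1$ consists of a single vertex $1$ with weight $W_1$. For $n\ge1$, $\mathcal{G}_{n+1}$ is obtained from $\mathcal{G}_n$ by introducing a new vertex $n+1$ with weight $W_{n+1}$ and $m$ half-edges; conditionally on $\mathcal{G}_n$ (including its vertex-weights), each half-edge is connected independently to some $i\in[n]=\{1,\dots,n\}$ with probability $W_i/S_n$. Edges are directed from new to old vertices. $\mathcal{Z}_n(i)$ denotes the in-degree of vertex $i$ in $\mathcal{G}_n$. (RV): there exist $a,c_1,\tau>0$ and $b\in\mathbb{R}$ such that $\mathbb{P}(W\ge x)\sim ax^b\mathrm{e}^{-(x/c_1)^\tau}$ as $x\to\infty$. In this case, with $c_2:=c_1/\tau$, for real index $r$, $a_r=c_2(\log r)^{1/\tau-1}$ and $b_r=c_1(\log r)^{1/\tau}+a_r((b/\tau)\log\log r+b\log c_1+\log a)$. (RaV): there exist $a,c_1>0$, $b\in\mathbb{R}$ and $\tau>1$ such that $\mathbb{P}(W\ge x)\sim a(\log x)^b\mathrm{e}^{-(\log(x)/c_1)^\tau}$ as $x\to\infty$. In this case, with $c_2:=c_1/\tau$, for real index $r$, $b_r=\exp\big(c_1(\log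 r)^{1/\tau}+c_2(\log r)^{1/\tau-1}((b/\tau)\log\log r+b\log c_1+\log a)\big)$ and $a_r=c_2(\log r)^{1/\tau-1}b_r$. For $0<s<t<\infty$, $\gamma\in(0,1)$ and a strictly positive function $f$, $$C_n(\gamma,s,t,f):=\{i\in[n]:sf(n)n^\gamma\le i\le tf(n)n^\gamma\},$$ $$I_n(\gamma,s,t,f):=\inf\{i\in C_n(\gamma,s,t,f):\mathcal{Z}_n(i)\ge\mathcal{Z}_n(j)\text{ for all }j\in C_n(\gamma,s,t,f)\}.$$ Likewise $C_n(1,s,t,t_n):=\{i\in[n]:st_nn\le i\le tt_nn\}$ and $I_n(1,s,t,t_n)$ is the smallest index in $C_n(1,s,t,t_n)$ maximising $\mathcal{Z}_n$ over $C_n(1,s,t,t_n)$. Maxima over $(v,w)\in\Pi$ are over the points of $\Pi$. A Gumbel distribution with location parameter $\mu$ has distribution function $\exp(-\mathrm{e}^{-(x-\mu)})$. *)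

(* Defs.v *)
From HB Require Import structures.
From mathcomp Require Import all_boot all_order all_algebra.
From mathcomp Require Import all_classical all_reals all_analysis.
From mathcomp Require Import measurable_realfun.

Set Implicit Arguments.
Unset Strict Implicit.
Unset Printing Implicit Defensive.

Import Order.TTheory GRing.Theory Num.Theory.
Import numFieldNormedType.Exports.

Local Open Scope classical_set_scope.
Local Open Scope ring_scope.

Definition mutually_independent (R : realType) (d d' : measure_display)
    (T : measurableType d) (E : measurableType d') (P : probability T R)
    (I : choiceType) (D : set I) (X : I -> T -> E) : Prop :=
  forall (r : seq I) (B : I -> set E), uniq r -> [set` r] `<=` D ->
    (forall i, measurable (B i)) ->
    P (\bigcap_(i in [set` r]) (X i @^-1` B i)) =
    (\prod_(i <- r) P (X i @^-1` B i))%E.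

Definition cvg_in_distribution (R : realType) (d d' : measure_display)
    (T : measurableType d) (T' : measurableType d')
    (P : probability T R) (P' : probability T' R)
    (X : nat -> T -> R * R) (Y : T' -> R * R) : Prop :=
  [/\ forall n, measurable_fun [set: T] (X n),
      measurable_fun [set: T'] Y
    & forall g : R * R -> R, continuous g -> (exists M : R, forall z, `|g z| <= M) ->
        ('E_P[fun w => g (X n w)])%E @[n --> \oo] -->
        ('E_P'[fun w => g (Y w)])%E].

Definition gumbel_distributed (R : realType) (d : measure_display)
    (T : measurableType d) (P : probability T R) (X : T -> R) (mu : R) : Prop :=
  forall x, P [set w | X w <= x] = (expR (- expR (- (x - mu))))%:E.

Definition uniform_distributed (R : realType) (d : measure_display)
    (T : measurableType d) (P : probability T R) (X : {RV P >-> R})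
    (a b : R) : Prop :=
  exists ab : a < b,
    forall A, measurable A -> distribution P X A = uniform_prob ab A.

Definition is_max (R : realType) (A : set R) (x : R) : Prop :=
  A x /\ ubound A x.

(* A simple point process is given by its random set of points; this loses
   nothing for Poisson processes with a diffuse intensity measure. *)
Definition count_points (R : realType) (T : Type) (E : choiceType) (Pi : T -> set E)
    (B : set E) (w : T) : \bar R := counting (Pi w `&` B).

(* The second argument of [poisson_prob] is a dummy. *)
Record poisson_point_process (R : realType) (d d' : measure_display)
    (T : measurableType d) (E : measurableType d') (P : probability T R)
    (S : set E) (nu : set E -> \bar R) (Pi : T -> set E) : Prop := {
  ppp_space : forall w, Pi w `<=` S ;
  ppp_measurable : forall B, measurable B ->
    measurable_fun [set: T] (count_points R Pi B) ;
  ppp_finite : forall B (k : nat), measurable B -> (nu B < +oo)%E ->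
    P [set w | count_points R Pi B w = k%:R%:E] =
    poisson_prob (fine (nu B)) 0 [set k] ;
  ppp_infinite : forall B, measurable B -> nu B = +oo%E ->
    P [set w | count_points R Pi B w = +oo%E] = 1%E ;
  ppp_independent : forall B : nat -> set E,
    (forall i, measurable (B i)) -> trivIset [set: nat] B ->
    mutually_independent P [set: nat] (fun i => count_points R Pi (B i))
}.

Definition sigma_points (R : realType) (d d' : measure_display)
    (T : measurableType d) (E : measurableType d') (Pi : T -> set E) :
    set (set T) :=
  <<s [set A | exists (B : set E) (C : set (\bar R)),
        [/\ measurable B, measurable C & A = count_points R Pi B @^-1` C] ]>>.

Definition independent_of_points (R : realType) (d d' : measure_display)
    (T : measurableType d) (E : measurableType d') (P : probability T R)
    (Pi : T -> set E) (X : {RV P >-> R}) : Prop :=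
  forall (A : set T) (B : set R), sigma_points R Pi A -> measurable B ->
    P (A `&` (X @^-1` B)) = (P A * P (X @^-1` B))%E.

Definition half_plane (R : realType) : set (R * R) := [set p | 0 < p.1].
Arguments half_plane : clear implicits.

(* nu(dt, dx) = dt * e^{-x} dx on (0, oo) * R *)
Definition nu_intensity (R : realType) (B : set (R * R)) : \bar R :=
  (\int[lebesgue_measure \x lebesgue_measure]_(p in B `&` half_plane R)
      (expR (- p.2))%:E)%E.

Definition strip_values (R : realType) (T : Type) (Pi : T -> set (R * R))
    (s t : R) (w : T) : set R :=
  [set p.2 - ln p.1 | p in Pi w `&` [set p | s <= p.1 <= t]].

(* Vertices are numbered from 1: [weight i] is the weight of vertex i and
   [target v k] the vertex that the k-th half-edge of vertex v is connected to.
   The values [weight 0], [target 0] and [target 1] are never used. *)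

Definition total_weight (R : realType) (T : Type) (weight : nat -> T -> R)
    (n : nat) (w : T) : R := \sum_(1 <= i < n.+1) weight i w.

Definition in_degree (T : Type) (m : nat) (target : nat -> 'I_m -> T -> nat)
    (n i : nat) (w : T) : nat :=
  (\sum_(2 <= v < n.+1) \sum_(k < m) (target v k w == i))%N.

(* The sigma-algebra of G_n and all vertex-weights. Conditioning on the weights
   of later vertices as well expresses that these weights are drawn
   independently of the edges; conditioning on G_n alone would leave their
   joint law with the edges unspecified. *)
Definition graph_history (R : realType) (d : measure_display)
    (T : measurableType d) (m : nat) (weight : nat -> T -> R)
    (target : nat -> 'I_m -> T -> nat) (n : nat) : set (set T) :=
  <<s [set A | (exists i (B : set R),
                  [/\ (0 < i)%N, measurable B & A = weight i @^-1` B])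
            \/ (exists v k j,
                  (2 <= v <= n)%N /\ A = target v k @^-1` [set j]) ]>>.

Record weighted_recursive_graph (R : realType) (d : measure_display)
    (T : measurableType d) (P : probability T R) (m : nat)
    (W : {RV P >-> R}) (weight : nat -> {RV P >-> R})
    (target : nat -> 'I_m -> {RV P >-> nat}) : Prop := {
  wrg_weight_copy : forall i, (0 < i)%N -> forall A, measurable A ->
    distribution P (weight i) A = distribution P W A ;
  wrg_weight_independent :
    mutually_independent P [set i | (0 < i)%N] weight ;
  wrg_target_range : forall v k w, (2 <= v)%N -> (0 < target v k w < v)%N ;
  (* conditional law of the half-edges of vertex n+1: for every choice f of
     their end-points, the conditional probability is the product of the
     W_{f k} / S_n *)
  wrg_target_law : forall n (A : set T) (f : 'I_m -> nat), (0 < n)%N ->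
    graph_history weight target n A -> (forall k, (0 < f k <= n)%N) ->
    P (A `&` [set w | forall k, target n.+1 k w = f k]) =
    (\int[P]_(w in A)
       (\prod_(k < m) (weight (f k) w / total_weight weight n w))%:E)%E
}.

Definition tail_RV (R : realType) (d : measure_display) (T : measurableType d)
    (P : probability T R) (W : {RV P >-> R}) (a b c1 tau : R) : Prop :=
  fine (P [set w | x <= W w]) / (a * x `^ b * expR (- (x / c1) `^ tau))
    @[x --> +oo] --> (1 : R).

Definition a_RV (R : realType) (c1 tau r : R) : R :=
  c1 / tau * ln r `^ (tau^-1 - 1).

Definition b_RV (R : realType) (a b c1 tau r : R) : R :=
  c1 * ln r `^ tau^-1 +
  a_RV c1 tau r * (b / tau * ln (ln r) + b * ln c1 + ln a).

Definition tail_RaV (R : realType) (d : measure_display) (T : measurableType d)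
    (P : probability T R) (W : {RV P >-> R}) (a b c1 tau : R) : Prop :=
  fine (P [set w | x <= W w]) / (a * ln x `^ b * expR (- (ln x / c1) `^ tau))
    @[x --> +oo] --> (1 : R).

Definition b_RaV (R : realType) (a b c1 tau r : R) : R :=
  expR (c1 * ln r `^ tau^-1 +
        c1 / tau * ln r `^ (tau^-1 - 1) *
          (b / tau * ln (ln r) + b * ln c1 + ln a)).

Definition a_RaV (R : realType) (a b c1 tau r : R) : R :=
  c1 / tau * ln r `^ (tau^-1 - 1) * b_RaV a b c1 tau r.

Definition C_ (R : realType) (n : nat) (gamma s t : R) (f : nat -> R) :
    set nat :=
  [set i | (0 < i <= n)%N /\
           s * f n * n%:R `^ gamma <= i%:R <= t * f n * n%:R `^ gamma].

Definition I_ (R : realType) (T : Type) (m : nat)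
    (target : nat -> 'I_m -> T -> nat) (n : nat) (gamma s t : R)
    (f : nat -> R) (w : T) : R :=
  inf [set i%:R | i in [set i | C_ n gamma s t f i /\
         forall j, C_ n gamma s t f j ->
           (in_degree target n j w <= in_degree target n i w)%N]].

(* The maximum over i in C_n of (Z_n(i) - x) / y: for a finite nonempty set
   [sup] is the maximum. If C_n is empty, which may only happen for finitely
   many n in the regimes considered, it is 0, and so is [I_]. *)
Definition max_degree (R : realType) (T : Type) (m : nat)
    (target : nat -> 'I_m -> T -> nat) (n : nat) (gamma s t : R)
    (f : nat -> R) (x y : R) (w : T) : R :=
  sup [set ((in_degree target n i w)%:R - x) / y | i in C_ n gamma s t f].

(* Main.v *)
Require Import Defs.
From HB Require Import structures.
From mathcomp Require Import all_boot all_order all_algebra.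
From mathcomp Require Import all_classical all_reals all_analysis.
From mathcomp Require Import measurable_realfun.
From mathcomp Require Import ring lra zify.

Set Implicit Arguments.
Unset Strict Implicit.
Unset Printing Implicit Defensive.

Import Order.TTheory GRing.Theory Num.Theory.
Import numFieldNormedType.Exports.

Local Open Scope classical_set_scope.
Local Open Scope ring_scope.

(** The argument rests on the conditional mean of a degree. Given all the weights, the
    in-degree of vertex [i] at time [n] is a sum of independent indicators with mean
    [m W_i] times the sum of [1 / S_j] over [i <= j < n]. Since [S_j] is close to [j], this
    mean is close to [m W_i ln (n / i)]. On the scale [m a L] by which the maximum is
    normalised the degrees stay close to their conditional means, so the vertex of age
    [i = v r] exceeds the level [m (b + y a) L] exactly when, up to negligible events, its
    weight exceeds [(b + y a) L / ln (n / i)] (this is [weight_level]). The weights are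
    independent, the probability that the vertex [v r] exceeds its weight level is
    equivalent to [kappa e^(-y) / (v r)], and the sum of [1 / i] over a block of ages
    [u r < i <= u' r] tends to [ln (u' / u)]. Hence the exceedances of the level [y] in that
    block are asymptotically Poisson with mean [kappa e^(-y) ln (u' / u)]: the maximum over
    the window is Gumbel and the age of the maximiser is uniform on the logarithmic scale.

    The joint law of the degrees is never used. The event that all degrees of the window
    lie below a level is compared with the same event for the weights, and the two differ
    only if some vertex has a weight above its level and a small degree, or the converse.
    Both are bounded vertex by vertex ([vertex_low_degree], [vertex_high_degree]) by an
    exponential inequality given the weights ([conditional_chernoff]), on the event that
    the sums of the [1 / S_j] are close to logarithms ([good_weights]). The exponents can be
    made arbitrarily large while the expected number of vertices with an exceptional weight
    stays bounded. The event for the weights has a product probability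
    ([weights_below_cvg]). The result is [degrees_below_cvg], where the level may take one
    value on a block of ages and another value elsewhere.

    The two cases of the theorem only enter through the asymptotic hypotheses gathered in
    [regime], verified in [regime_RV] and [regime_RaV]. Both reduce to a second-order
    expansion of a stretched exponential tail at its quantile ([stretched_cvg]). If the
    level is displaced by [y] units of spacing, the expansion has a quadratic term of order
    [y^2 / ell], where [ell] is the logarithm of the age. It vanishes in the limit except
    in the first case, where the displacement contains [ln (l n)]; it then contributes to
    the shift [zeta0 (tau + 1)^2 / (2 tau)].

    On the side of the limit, the void probabilities of the Poisson process give the law of
    the maximum ([sup_strip_law]) and the independence of [U] gives its joint law with the
    age on rectangles ([limit_cell]). Convergence in distribution is deduced from
    asymptotic lower bounds on the probabilities of small cells
    ([cvg_in_distribution_cells]): lower bounds on the expectations of [g] and of [M - g]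
    are enough for a bounded continuous [g]. The maximum and its age lie in the cell
    [x, x'] times [u, u'] as soon as all degrees are below level [x'] on the block [u, u']
    and below level [x] elsewhere, but not all below level [x] ([cell_event]), and the
    limiting probability of this event is almost that of the cell ([cell_gap]). *)

(** * Probabilities as real numbers *)

Section RealProbability.
Context (R : realType) (d : measure_display) (T : measurableType d)
  (P : probability T R).
Implicit Types A B : set T.

Definition Pr A : R := fine (P A).

Lemma PrE A : measurable A -> P A = (Pr A)%:E.
Proof. by move=> mA; rewrite /Pr fineK// fin_num_measure. Qed.

Lemma Pr_ge0 A : 0 <= Pr A.
Proof. by rewrite /Pr fine_ge0. Qed.

Lemma Pr_le1 A : measurable A -> Pr A <= 1.
Proof. by move=> mA; rewrite -lee_fin -PrE// probability_le1. Qed.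

Lemma Pr_mono A B : measurable A -> measurable B -> A `<=` B -> Pr A <= Pr B.
Proof. by move=> mA mB AB; rewrite -lee_fin -!PrE// le_measure// inE. Qed.

Lemma Pr_setT : Pr setT = 1.
Proof. by rewrite /Pr probability_setT. Qed.

Lemma Pr_setC A : measurable A -> Pr (~` A) = 1 - Pr A.
Proof.
move=> mA; apply/EFin_inj; rewrite -PrE; last exact: measurableC.
by rewrite probability_setC// EFinB PrE.
Qed.

Lemma Pr_setU A B : measurable A -> measurable B -> Pr (A `|` B) <= Pr A + Pr B.
Proof.
move=> mA mB; rewrite -lee_fin EFinD -!PrE//; last exact: measurableU.
exact: measureU2.
Qed.

Lemma Pr_bigcup (I : choiceType) (s : seq I) (F : I -> set T) A :
  measurable A -> (forall i, i \in s -> measurable (F i)) ->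
  A `<=` [set w | exists2 i, i \in s & F i w] ->
  Pr A <= \sum_(i <- s) Pr (F i).
Proof.
elim: s A => [|i s IH] A mA mF AF.
  have -> : A = set0 by apply/seteqP; split => // x /AF[].
  by rewrite big_nil /Pr measure0.
rewrite big_cons.
have mi : measurable (F i) by apply: mF; rewrite inE eqxx.
have mD : measurable (A `\` F i) by exact: measurableD.
apply: (@le_trans _ _ (Pr (F i) + Pr (A `\` F i))).
  apply: le_trans (Pr_setU mi mD); apply: Pr_mono => //; first exact: measurableU.
  by move=> x Ax; have [Fx|Fx] := pselect (F i x); [left|right].
rewrite lerD2l; apply: IH => //.
  by move=> j js; apply: mF; rewrite inE js orbT.
move=> x [/AF[j]]; rewrite inE => /orP[/eqP->//|js Fj _]; by exists j.
Qed.

Lemma Pr_setD A B : measurable A -> measurable B -> B `<=` A ->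
  Pr (A `\` B) = Pr A - Pr B.
Proof.
move=> mA mB BA; rewrite /Pr measureD//; last by rewrite ltey_eq fin_num_measure.
by rewrite setIidr// fineB// fin_num_measure.
Qed.

Lemma Pr_setI_as1 A B : measurable A -> measurable B -> Pr B = 1 ->
  Pr (A `&` B) = Pr A.
Proof.
move=> mA mB B1; apply/eqP; rewrite eq_le; apply/andP; split.
  by apply: Pr_mono => //; exact: measurableI.
have : Pr A <= Pr (A `&` B) + Pr (~` B).
  apply: le_trans (Pr_setU _ _); [|exact: measurableI|exact: measurableC].
  apply: Pr_mono => //; first by apply: measurableU; [exact: measurableI|exact: measurableC].
  by move=> x Ax; have [?|?] := pselect (B x); [left|right].
by rewrite Pr_setC// B1 subrr addr0.
Qed.

Lemma integral_cst_indic A (c : R) : measurable A ->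
  (\int[P]_(w in A) c%:E = (c * Pr A)%:E)%E.
Proof. by move=> mA; rewrite integral_cst// EFinM -PrE. Qed.

End RealProbability.

(** Writing [1 / x] as [x (x^2)^(-1)] reduces the claim to powers of nonnegative numbers. *)
Lemma measurable_funV (R : realType) (d : measure_display) (T : measurableType d)
    (D : set T) (f : T -> R) :
  measurable_fun D f -> measurable_fun D (fun x => (f x)^-1).
Proof.
move=> mf; have -> : (fun x => (f x)^-1) = (fun x => f x * ((f x) ^+ 2) `^ (-1)).
  apply/funext => x; rewrite powR_inv1 ?sqr_ge0//.
  have [->|f0] := eqVneq (f x) 0; first by rewrite mul0r invr0.
  by rewrite expr2 invfM mulrA divff// mul1r.
apply: measurable_funM => //.
have /(measurableT_comp) := @measurable_powR R (-1); apply.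
exact: measurable_funX.
Qed.

(** * Conditional laws tested on functions *)

Import HBNNSimple.

(** An identity between integrals over the sets of a sigma-algebra extends to integrals
    against functions measurable for it, by approximation with simple functions. This is how
    a conditional law given as a family of identities between integrals is used. *)
Lemma integral_sub_sigma_algebra (R : realType) (d : measure_display)
    (T : measurableType d) (P : {measure set T -> \bar R}) (G : set (set T))
    (g1 g2 Phi : T -> R) :
  G `<=` measurable ->
  measurable_fun [set: T] g1 -> (forall x, 0 <= g1 x) ->
  measurable_fun [set: T] g2 -> (forall x, 0 <= g2 x) ->
  (forall A, <<s G >> A ->
     \int[P]_(x in A) (g1 x)%:E = \int[P]_(x in A) (g2 x)%:E)%E ->
  measurable_fun [set: g_sigma_algebraType G] Phi -> (forall x, 0 <= Phi x) ->
  (\int[P]_x (Phi x * g1 x)%:E = \int[P]_x (Phi x * g2 x)%:E)%E.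
Proof.
move=> GT mg1 g10 mg2 g20 g12 mPhi Phi0.
have sub A : <<s G >> A -> measurable A.
  by apply: smallest_sub => //; exact: sigma_algebra_measurable.
have mEPhi : measurable_fun [set: g_sigma_algebraType G] (EFin \o Phi).
  exact/measurable_EFinP.
pose f_ := nnsfun_approx (@measurableT _ (g_sigma_algebraType G)) mEPhi.
have level n y : <<s G >> (f_ n @^-1` [set y]).
  exact: (measurable_funPTI (f_ n) (measurable_set1 y)).
have mf n : measurable_fun [set: T] (f_ n : T -> R).
  move=> _ Y mY; rewrite setTI; apply: sub.
  exact: (measurable_funPTI (f_ n) mY).
have f_0 n x : 0 <= f_ n x by [].
have approx (g : T -> R) : measurable_fun [set: T] g -> (forall x, 0 <= g x) ->
    (\int[P]_x (Phi x * g x)%:E = limn (fun n => \int[P]_x (f_ n x * g x)%:E))%E.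
  move=> mg g0; rewrite -monotone_convergence//; first last.
  - move=> x _ a b ab; rewrite lee_fin ler_wpM2r//.
    by have /lefP := nd_nnsfun_approx (@measurableT _ (g_sigma_algebraType G)) mEPhi ab; exact.
  - by move=> n x _; rewrite lee_fin mulr_ge0.
  - by move=> n; apply/measurable_EFinP; exact: measurable_funM.
  apply: eq_integral => x _; apply/esym/cvg_lim => //.
  have h := @cvg_nnsfun_approx _ _ _ _ (@measurableT _ (g_sigma_algebraType G)) _ mEPhi
    (fun x _ => Phi0 x) x I.
  under eq_fun do rewrite EFinM; rewrite EFinM.
  by apply: cvgeZr => //; exact: h.
have simple (g : T -> R) n : measurable_fun [set: T] g -> (forall x, 0 <= g x) ->
    (\int[P]_x (f_ n x * g x)%:E =
     \sum_(y \in range (f_ n)) y%:E * \int[P]_(x in f_ n @^-1` [set y]) (g x)%:E)%E.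
  move=> mg g0.
  have -> : (fun x => (f_ n x * g x)%:E) =
    (fun x => \sum_(y \in range (f_ n)) (y * \1_(f_ n @^-1` [set y]) x * g x)%:E)%E.
    apply/funext => x; rewrite fimfunE mulr_fsuml fsumEFin//.
  have mI y : measurable_fun [set: T] (fun x => y * \1_(f_ n @^-1` [set y]) x * g x).
    apply: measurable_funM => //; apply: measurable_funM => //.
    by apply: measurable_indic; exact: sub.
  have I0 y x : 0 <= y * \1_(f_ n @^-1` [set y]) x * g x.
    rewrite indicE; have [->|y0] := eqVneq y (f_ n x); first by rewrite !mulr_ge0.
    by rewrite memNset ?mulr0 ?mul0r//= => yE; rewrite yE eqxx in y0.
  rewrite ge0_integral_fsum//; last 2 first.
  - by move=> y; exact/measurable_EFinP.
  - by move=> y x _; rewrite lee_fin.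
  apply: eq_fsbigr => y /set_mem[x _ <-].
  rewrite [in RHS]integral_mkcond -ge0_integralZl_EFin//; last 2 first.
  - by move=> z _; apply: erestrict_ge0 => t _; rewrite lee_fin.
  - apply/(measurable_restrictT _ _).1; first exact: sub.
    by apply: measurable_funTS; exact/measurable_EFinP.
  apply: eq_integral => z _.
  rewrite patchE indicE; case: ifPn => _; rewrite ?mulr1 ?mulr0 ?mul0r ?mule0 ?EFinM//.
rewrite (approx _ mg1 g10) (approx _ mg2 g20); congr (limn _).
apply/funext => n; rewrite (simple _ _ mg1 g10) (simple _ _ mg2 g20).
by apply: eq_fsbigr => y _; rewrite g12.
Qed.

(** * History of the graph *)

Section ConditionalChernoff.
Context (R : realType) (d : measure_display) (T : measurableType d)
  (P : probability T R) (m : nat) (W : {RV P >-> R})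
  (weight : nat -> {RV P >-> R}) (target : nat -> 'I_m -> {RV P >-> nat})
  (wrg : weighted_recursive_graph W weight target).

(** The generators of [graph_history], named in order to use the sigma-algebra as a
    measurable type. *)
Definition history_gen (n : nat) : set (set T) :=
  [set A | (exists i (B : set R),
              [/\ (0 < i)%N, measurable B & A = weight i @^-1` B])
        \/ (exists v k j,
              (2 <= v <= n)%N /\ A = target v k @^-1` [set j]) ].

Definition adapted (n : nat) (f : T -> R) : Prop :=
  measurable_fun [set: g_sigma_algebraType (history_gen n)] f.

Lemma history_gen_measurable n : history_gen n `<=` measurable.
Proof.
move=> A [[i [B [_ mB ->]]]|[v [k [j [_ ->]]]]]; exact: measurable_funPTI.
Qed.

Lemma history_measurable n A : graph_history weight target n A -> measurable A.
Proof.
apply: smallest_sub; first exact: sigma_algebra_measurable.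
exact: history_gen_measurable.
Qed.

Lemma history_gen_mono n n' : (n <= n')%N -> history_gen n `<=` history_gen n'.
Proof.
move=> nn' A [[i [B iB]]|[v [k [j [/andP[v2 vn] ->]]]]]; first by left; exists i, B.
by right; exists v, k, j; split=> //; rewrite v2 (leq_trans vn).
Qed.

Lemma graph_history_mono n n' : (n <= n')%N ->
  graph_history weight target n `<=` graph_history weight target n'.
Proof.
move=> nn'; apply: sub_smallest2r; last exact: history_gen_mono.
exact: smallest_sigma_algebra.
Qed.

Lemma history_setI n A B : graph_history weight target n A ->
  graph_history weight target n B -> graph_history weight target n (A `&` B).
Proof. exact: (@measurableI _ (g_sigma_algebraType (history_gen n))). Qed.

Lemma adapted_measurable n f : adapted n f -> measurable_fun [set: T] f.
Proof.
move=> mf _ Y mY; rewrite setTI; apply: (@history_measurable n).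
by have := mf measurableT Y mY; rewrite setTI.
Qed.

Lemma adapted_mono n n' f : (n <= n')%N -> adapted n f -> adapted n' f.
Proof.
move=> nn' mf _ Y mY; rewrite setTI; apply: (graph_history_mono nn').
by have := mf measurableT Y mY; rewrite setTI.
Qed.

Lemma adapted_preimage n f B : adapted n f -> measurable B ->
  graph_history weight target n (f @^-1` B).
Proof. by move=> mf mB; have := mf measurableT B mB; rewrite setTI. Qed.

Lemma adapted_weight n i : (0 < i)%N -> adapted n (weight i).
Proof.
move=> i0 _ Y mY; rewrite setTI; apply: sub_sigma_algebra.
by left; exists i, Y.
Qed.

Lemma adapted_indic n A : graph_history weight target n A -> adapted n \1_A.
Proof. by move=> hA; apply: measurable_indic. Qed.

Lemma adapted_total_weight n j : adapted n (total_weight weight j).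
Proof.
have -> : total_weight weight j = fun w => \sum_(0 <= i < j) weight i.+1 w.
  by apply/funext => w; rewrite /total_weight big_add1.
by apply: measurable_sum => i; exact: adapted_weight.
Qed.

Lemma in_degree_small n i w : (n <= 1)%N -> in_degree target n i w = 0%N.
Proof. by move=> n1; rewrite /in_degree big_geq. Qed.

Lemma in_degreeS n i w : (0 < n)%N ->
  in_degree target n.+1 i w =
  (in_degree target n i w + \sum_(k < m) (target n.+1 k w == i))%N.
Proof. by move=> n0; rewrite /in_degree big_nat_recr. Qed.

(** A half-edge of vertex [v] can only reach a vertex older than [v]. *)
Lemma in_degree_old n i w : (n <= i)%N -> in_degree target n i w = 0%N.
Proof.
elim: n => [|[|n] IH] ni; try exact: in_degree_small.
rewrite in_degreeS// IH ?(ltnW ni)// add0n big1// => k _.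
have /andP[_ h] := wrg_target_range wrg k w (ltn0Sn n : (2 <= n.+2)%N).
by rewrite ltn_eqF// (leq_trans h).
Qed.

Lemma adapted_degree n i : adapted n (fun w => (in_degree target n i w)%:R).
Proof.
elim: n => [|[|n] IH].
- by rewrite (_ : (fun _ => _) = cst 0); [exact: measurable_cst|apply/funext => w; rewrite in_degree_small].
- by rewrite (_ : (fun _ => _) = cst 0); [exact: measurable_cst|apply/funext => w; rewrite in_degree_small].
have -> : (fun w => (in_degree target n.+2 i w)%:R) =
    (fun w => (in_degree target n.+1 i w)%:R +
       \sum_(k < m) \1_(target n.+2 k @^-1` [set i]) w) :> (T -> R).
  apply/funext => w; rewrite in_degreeS// natrD; congr (_ + _).
  rewrite natr_sum; apply: eq_bigr => k _; rewrite indicE; congr (nat_of_bool _)%:R.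
  by apply/eqP/idP => [h|/set_mem//]; apply/mem_set.
apply: measurable_funD; first exact: (adapted_mono _ IH).
apply: measurable_sum => k; apply: adapted_indic; apply: sub_sigma_algebra.
by right; exists n.+2, k, i; rewrite ltnSn.
Qed.

Lemma measurable_degree n i : measurable_fun [set: T] (in_degree target n i).
Proof.
move=> _ Y mY; rewrite setTI.
pose B : set R := [set k%:R | k in Y].
have mB : measurable B.
  apply: countable_measurable; first by move=> t; exact: measurable_set1.
  by apply: (sub_countable (card_image_le _ _)); exact: countableP.
have -> : in_degree target n i @^-1` Y = (fun w => (in_degree target n i w)%:R) @^-1` B.
  apply/seteqP; split => w /=; first by exists (in_degree target n i w).
  by move=> [k Yk /eqP]; rewrite eqr_nat => /eqP <-.
by have := adapted_measurable (@adapted_degree n i) measurableT mB; rewrite setTI.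
Qed.

(** An almost sure event of the initial history, on which all quotients by total weights are
    meaningful. *)
Definition positive_weights : set T :=
  \bigcap_(i in [set i | (0 < i)%N]) (weight i @^-1` `]0, +oo[).

Lemma positive_weights_history n : graph_history weight target n positive_weights.
Proof.
apply: (@bigcap_measurableType _ (g_sigma_algebraType (history_gen n))) => i /= i0.
by apply: adapted_preimage => //; exact: adapted_weight.
Qed.

Lemma measurable_positive_weights : measurable positive_weights.
Proof. exact: (@history_measurable 0%N _ (@positive_weights_history 0%N)). Qed.

Lemma positive_weightsP w i : positive_weights w -> (0 < i)%N -> 0 < weight i w.
Proof. by move=> /(_ i) h /h/=; rewrite in_itv/= andbT. Qed.

Lemma positive_weights_as : P [set w | 0 < W w] = 1%E -> Pr P positive_weights = 1.
Proof.
move=> W0; rewrite -[positive_weights]setCK Pr_setC; last first.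
  by apply: measurableC; exact: measurable_positive_weights.
rewrite /positive_weights setC_bigcap.
suff : P.-negligible (\bigcup_(i in [set i | (0 < i)%N]) ~` (weight i @^-1` `]0, +oo[)).
  move=> /negligibleP h; rewrite /Pr h ?subr0//.
  by apply: bigcup_measurable => i _; apply: measurableC; exact: measurable_funPTI.
rewrite bigcup_mkcond; apply: negligible_bigcup => i.
case: ifPn => [/set_mem/= i0|_]; last exact: negligible_set0.
suff h : P (~` (weight i @^-1` `]0, +oo[)) = 0%E.
  by apply/negligibleP => //; apply: measurableC; exact: measurable_funPTI.
rewrite probability_setC; last exact: measurable_funPTI.
have -> : P (weight i @^-1` `]0, +oo[) = distribution P W `]0, +oo[%classic.
  by rewrite -(wrg_weight_copy wrg i0).
rewrite /distribution /pushforward.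
have -> : W @^-1` `]0, +oo[ = [set w | 0 < W w].
  by apply/seteqP; split => w /=; rewrite in_itv/= andbT.
by rewrite W0 subee.
Qed.

Lemma total_weight_gt0 w n : (0 < n)%N -> positive_weights w ->
  0 < total_weight weight n w.
Proof.
move=> n0 hw; rewrite /total_weight big_nat_recr//= addrC ltr_wpDr//.
  by rewrite big_nat sumr_ge0// => i /andP[i0 _]; rewrite ltW// positive_weightsP.
exact: positive_weightsP.
Qed.

(** * Exponential bounds given the weights *)

Definition half_edges_at (n : nat) (f : {ffun 'I_m -> 'I_n}) : set T :=
  [set w | forall k, target n.+1 k w = (f k).+1].

Lemma measurable_half_edges_at n (f : {ffun 'I_m -> 'I_n}) :
  measurable (half_edges_at f).
Proof.
have -> : half_edges_at f =
    \bigcap_(k in [set: 'I_m]) (target n.+1 k @^-1` [set (f k).+1]).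
  by apply/seteqP; split => [w h k _|w h k]; [exact: h|exact: h].
by apply: fin_bigcap_measurable => // k _; exact: measurable_funPTI.
Qed.

(** Restricting to [positive_weights] makes the product of ratios a bounded function. *)
Lemma half_edges_law n (f : {ffun 'I_m -> 'I_n}) (A : set T) : (0 < n)%N ->
  graph_history weight target n A ->
  (\int[P]_(w in A) (\1_(positive_weights `&` half_edges_at f) w)%:E =
   \int[P]_(w in A) (\1_positive_weights w *
      \prod_(k < m) (weight (f k).+1 w / total_weight weight n w))%:E)%E.
Proof.
move=> n0 hA; have mA := history_measurable hA.
rewrite integral_indic//; last first.
  by apply: measurableI; [exact: measurable_positive_weights|exact: measurable_half_edges_at].
have -> : positive_weights `&` half_edges_at f `&` A =
    A `&` positive_weights `&` [set w | forall k, target n.+1 k w = (f k).+1].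
  by rewrite setIC setIA.
have := @wrg_target_law _ _ _ _ _ _ _ _ wrg n (A `&` positive_weights)
  (fun k => (f k).+1) n0 (history_setI hA (@positive_weights_history n)).
move=> law; etransitivity; first by apply: law => k /=.
rewrite integral_mkcond [RHS]integral_mkcond; apply: eq_integral => w _.
rewrite !patchE in_setI indicE; case: (w \in A) => //=.
by case: (w \in positive_weights); rewrite ?mul1r ?mul0r.
Qed.

Lemma measurable_edge_weights n (f : 'I_m -> 'I_n) :
  adapted n (fun w => \prod_(k < m) (weight (f k).+1 w / total_weight weight n w)).
Proof.
apply: measurable_prod => k _; apply: measurable_funM.
  exact: adapted_weight.
by apply: measurable_funV; exact: adapted_total_weight.
Qed.

(** Summing the conditional law over all choices of end-points factorises, each half-edge
    contributing a factor [1 + c W_i / S_n], at most the exponential of [c W_i / S_n]. *)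
Lemma one_step_mgf n i (c : R) (Phi : T -> R) : (0 < i <= n)%N -> -1 <= c ->
  adapted n Phi -> (forall w, 0 <= Phi w) ->
  (forall w, ~ positive_weights w -> Phi w = 0) ->
  (\int[P]_w (Phi w * (1 + c) ^+ (\sum_(k < m) (target n.+1 k w == i))%N)%:E <=
   \int[P]_w (Phi w *
     expR (m%:R * c * (weight i w / total_weight weight n w)))%:E)%E.
Proof.
move=> /andP[i0 ni] c1 mPhi Phi0 Phi_pos.
have n0 : (0 < n)%N by exact: leq_trans ni.
have c0 : 0 <= 1 + c by lra.
have mPhiT := adapted_measurable mPhi.
pose Nf (f : {ffun 'I_m -> 'I_n}) := (\sum_(k < m) ((f k).+1 == i))%N.
pose psi (f : {ffun 'I_m -> 'I_n}) w := \1_positive_weights w *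
      \prod_(k < m) (weight (f k).+1 w / total_weight weight n w).
pose E (f : {ffun 'I_m -> 'I_n}) := positive_weights `&` half_edges_at f.
have ratio w : positive_weights w ->
    0 <= weight i w / total_weight weight n w <= 1.
  move=> hw; have S0 := total_weight_gt0 n0 hw.
  rewrite divr_ge0 ?(ltW S0)//=; last by rewrite ltW// positive_weightsP.
  rewrite ler_pdivrMr// mul1r /total_weight (bigD1_seq i)/= ?iota_uniq//; last first.
    by rewrite mem_index_iota i0 ltnS.
  rewrite lerDl big_seq_cond sumr_ge0// => j /andP[].
  by rewrite mem_index_iota => /andP[j0 _] _; rewrite ltW// positive_weightsP.
have factor0 w : positive_weights w ->
    0 <= 1 + c * (weight i w / total_weight weight n w).
  by move=> /ratio; set x := _ / _; move=> /andP[x0 x1]; nra.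
have mE f : measurable (E f).
  by apply: measurableI; [exact: measurable_positive_weights|exact: measurable_half_edges_at].
have psi0 f w : 0 <= psi f w.
  rewrite /psi indicE; case: (boolP (w \in positive_weights)) => [/set_mem hw|]; last by rewrite mul0r.
  rewrite mul1r prodr_ge0// => k _; rewrite divr_ge0// ltW//.
    exact: positive_weightsP.
  exact: total_weight_gt0.
have mpsi f : measurable_fun [set: T] (psi f).
  apply: measurable_funM; first exact/measurable_indic/measurable_positive_weights.
  exact: (adapted_measurable (@measurable_edge_weights n f)).
have E1 : forall w, Phi w * (1 + c) ^+ (\sum_(k < m) (target n.+1 k w == i))%N =
    \sum_f (1 + c) ^+ Nf f * (Phi w * \1_(E f) w).
  move=> w; have [hw|hw] := pselect (positive_weights w); last first.
    by rewrite Phi_pos// mul0r big1// => f _; rewrite mul0r mulr0.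
  have rng k : (0 < target n.+1 k w < n.+1)%N by exact: (wrg_target_range wrg).
  have lt k : ((target n.+1 k w).-1 < n)%N by have := rng k; lia.
  pose fw := [ffun k => Ordinal (lt k)].
  have fwE k : (fw k).+1 = target n.+1 k w.
    by rewrite ffunE/= prednK//; have /andP[] := rng k.
  rewrite (bigD1 fw)//= [X in _ = _ + X]big1 => [|f ffw].
    rewrite addr0 indicE mem_set ?mulr1; last by split=> // k; rewrite fwE.
    rewrite mulrC; congr (_ ^+ _ * _); apply: eq_bigr => k _; by rewrite fwE.
  rewrite indicE memNset ?mulr0// => -[_ h].
  move/eqP: ffw; apply; apply/ffunP => k; apply/val_inj/succn_inj.
  by rewrite fwE h.
have E2 : forall w, Phi w * \1_positive_weights w *
      (1 + c * (weight i w / total_weight weight n w)) ^+ m =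
    \sum_f (1 + c) ^+ Nf f * (Phi w * psi f w).
  move=> w; have [hw|hw] := pselect (positive_weights w); last first.
    by rewrite Phi_pos// !mul0r big1// => f _; rewrite mul0r mulr0.
  have S0 := total_weight_gt0 n0 hw.
  rewrite /psi indicE mem_set// mulr1.
  under eq_bigr do rewrite mul1r mulrCA.
  rewrite -mulr_sumr; congr (_ * _).
  have -> : 1 + c * (weight i w / total_weight weight n w) =
      \sum_(j < n) (1 + c) ^+ (j.+1 == i) * (weight j.+1 w / total_weight weight n w).
    pose i' := Ordinal (ltac:(lia) : (i.-1 < n)%N).
    have i'E : i'.+1 = i by rewrite /= prednK.
    rewrite (bigD1 i')//= i'E eqxx expr1 mulrDl mul1r addrAC; congr (_ + _).
    apply: (mulIf (lt0r_neq0 S0)); rewrite mul1r mulrDl divfK ?lt0r_neq0//.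
    rewrite mulr_suml {1}/total_weight big_add1/= big_mkord (bigD1 i')//= i'E.
    congr (_ + _); apply: eq_bigr => j ji.
    rewrite (_ : (j.+1 == i) = false) ?expr0 ?mul1r ?divfK ?lt0r_neq0//.
    by apply/negbTE; rewrite -i'E eqSS; exact: ji.
  rewrite -[m in LHS]card_ord -prodr_const bigA_distr_bigA/=; apply: eq_bigr => f _.
  rewrite big_split/= /Nf; congr (_ * _).
  by rewrite (big_morph (fun k => (1 + c) ^+ k) (exprD (1 + c)) (expr0 _)).
have F0 f (g : T -> R) : (forall w, 0 <= g w) -> forall w, 0 <= (1 + c) ^+ Nf f * (Phi w * g w).
  by move=> g0 w; rewrite mulr_ge0 ?exprn_ge0// mulr_ge0.
have mF f (g : T -> R) : measurable_fun [set: T] g ->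
    measurable_fun [set: T] (fun w => (1 + c) ^+ Nf f * (Phi w * g w)).
  by move=> mg; apply: measurable_funM => //; exact: measurable_funM.
have -> : (\int[P]_w (Phi w * (1 + c) ^+ (\sum_(k < m) (target n.+1 k w == i))%N)%:E =
   \int[P]_w (Phi w * \1_positive_weights w *
      (1 + c * (weight i w / total_weight weight n w)) ^+ m)%:E)%E.
  under eq_integral do rewrite E1 -sumEFin.
  under [RHS]eq_integral do rewrite E2 -sumEFin.
  rewrite ge0_integral_sum//; last 2 first.
  - by move=> f; apply/measurable_EFinP/mF/measurable_indic.
  - by move=> f w _; rewrite lee_fin; apply: F0 => ?; rewrite indicE.
  rewrite ge0_integral_sum//; last 2 first.
  - by move=> f; apply/measurable_EFinP/mF.
  - by move=> f w _; rewrite lee_fin; apply: F0 => ?; exact: psi0.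
  apply: eq_bigr => f _.
  have cf (g : T -> R) : (forall w, 0 <= g w) -> measurable_fun [set: T] g ->
     (\int[P]_w ((1 + c) ^+ Nf f * (Phi w * g w))%:E =
      ((1 + c) ^+ Nf f)%:E * \int[P]_w (Phi w * g w)%:E)%E.
    move=> g0 mg; rewrite -ge0_integralZl_EFin ?exprn_ge0//.
    - by move=> w _; rewrite lee_fin mulr_ge0.
    - by apply/measurable_EFinP; exact: measurable_funM.
  rewrite !cf//; congr (_ * _)%E.
  apply: (@integral_sub_sigma_algebra _ _ _ P (history_gen n)) => //.
  - exact: history_gen_measurable.
  - by move=> A; exact: half_edges_law.
apply: ge0_le_integral => //.
- move=> w _; rewrite lee_fin; have [hw|hw] := pselect (positive_weights w); last first.
    by rewrite Phi_pos// !mul0r.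
  by rewrite mulr_ge0 ?exprn_ge0 ?mulr_ge0// factor0.
- apply/measurable_EFinP; apply: measurable_funM.
    by apply: measurable_funM => //; exact/measurable_indic/measurable_positive_weights.
  apply: measurable_funX; apply: measurable_funD => //; apply: measurable_funM => //.
  apply: measurable_funM; first exact: (adapted_measurable (@adapted_weight n i i0)).
  by apply: measurable_funV; exact: (adapted_measurable (@adapted_total_weight n n)).
- apply/measurable_EFinP; apply: measurable_funM => //.
  apply: measurableT_comp; first exact: measurable_expR.
  apply: measurable_funM => //.
  apply: measurable_funM; first exact: (adapted_measurable (@adapted_weight n i i0)).
  by apply: measurable_funV; exact: (adapted_measurable (@adapted_total_weight n n)).
move=> w _; rewrite lee_fin; have [hw|hw] := pselect (positive_weights w); last first.
  by rewrite Phi_pos// !mul0r.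
rewrite indicE mem_set// mulr1 ler_wpM2l//.
rewrite -mulrA expRM_natl lerXn2r// ?nnegrE ?expR_ge0// ?factor0//.
exact: expR_ge1Dx.
Qed.

Definition inv_weight_sum (i n : nat) (w : T) : R :=
  \sum_(i <= j < n) (total_weight weight j w)^-1.

Lemma adapted_inv_weight_sum k i n : adapted k (inv_weight_sum i n).
Proof.
rewrite /inv_weight_sum; apply: measurable_sum => j.
by apply: measurable_funV; exact: adapted_total_weight.
Qed.

(** Induction on [n] with [Phi] varying: the new half-edges produce a factor that depends on
    the weights only, which is absorbed in [Phi]. This is why the history contains all the
    weights from the start. *)
Lemma degree_mgf n i (theta : R) (Phi : T -> R) : (0 < i <= n)%N ->
  adapted 0 Phi -> (forall w, 0 <= Phi w) ->
  (forall w, ~ positive_weights w -> Phi w = 0) ->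
  (\int[P]_w (Phi w * expR (theta * (in_degree target n i w)%:R))%:E <=
   \int[P]_w (Phi w *
     expR (m%:R * (expR theta - 1) * (weight i w * inv_weight_sum i n w)))%:E)%E.
Proof.
move=> /andP[i0]; elim: n Phi => [|n IH] Phi ni mPhi Phi0 Phi_pos; first by lia.
have [ni'|ni'] := leqP i n; last first.
  have <- : i = n.+1 by lia.
  rewrite le_eqVlt; apply/orP; left; apply/eqP; apply: eq_integral => w _.
  by rewrite in_degree_old// /inv_weight_sum big_geq// !mulr0.
have n0 : (0 < n)%N by exact: leq_trans ni'.
pose Phi1 w := Phi w * expR (theta * (in_degree target n i w)%:R).
have c1 : -1 <= expR theta - 1 by rewrite lerBrDl subrr expR_ge0.
have step w : Phi w * expR (theta * (in_degree target n.+1 i w)%:R) =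
    Phi1 w * (1 + (expR theta - 1)) ^+ (\sum_(k < m) (target n.+1 k w == i))%N.
  by rewrite /Phi1 subrKC -expRM_natr in_degreeS// natrD mulrDr expRD mulrA.
under eq_integral do rewrite step.
apply: le_trans (@one_step_mgf n i (expR theta - 1) Phi1 _ c1 _ _ _) _.
- by rewrite i0.
- apply: measurable_funM; first exact: (adapted_mono (leq0n n) mPhi).
  apply: measurableT_comp; first exact: measurable_expR.
  by apply: measurable_funM => //; exact: adapted_degree.
- by move=> w; rewrite mulr_ge0 ?expR_ge0.
- by move=> w /Phi_pos h; rewrite /Phi1 h mul0r.
pose Phi2 w := Phi w * expR (m%:R * (expR theta - 1) *
  (weight i w / total_weight weight n w)).
under eq_integral => w _ do rewrite /Phi1 mulrAC -/(Phi2 w).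
apply: le_trans (IH Phi2 ni' _ _ _) _.
- apply: measurable_funM => //.
  apply: measurableT_comp; first exact: measurable_expR.
  apply: measurable_funM => //; apply: measurable_funM; first exact: adapted_weight.
  by apply: measurable_funV; exact: adapted_total_weight.
- by move=> w; rewrite mulr_ge0 ?expR_ge0.
- by move=> w /Phi_pos h; rewrite /Phi2 h mul0r.
rewrite le_eqVlt; apply/orP; left; apply/eqP; apply: eq_integral => w _.
rewrite /Phi2 -mulrA -expRD -mulrDr -mulrDr /inv_weight_sum big_nat_recr//=.
by rewrite (addrC (_^-1)).
Qed.

(** The exponential Markov inequality given the weights; taking [theta] of either
    sign gives both tails. *)
Lemma conditional_chernoff n i (theta h thr : R) (B E : set T) : (0 < i <= n)%N ->
  graph_history weight target 0 B -> B `<=` positive_weights -> measurable E ->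
  (forall w, E w -> theta * thr <= theta * (in_degree target n i w)%:R) ->
  (forall w, B w -> (expR theta - 1) * (weight i w * inv_weight_sum i n w) <= h) ->
  Pr P (B `&` E) <= expR (m%:R * h - theta * thr) * Pr P B.
Proof.
move=> i_n hB Bpos mE hE hh.
have mB := history_measurable hB.
pose Phi w := \1_B w * expR (- (theta * thr)).
have Phi0 w : 0 <= Phi w by rewrite mulr_ge0 ?expR_ge0// indicE.
have mPhi : adapted 0 Phi by apply: measurable_funM => //; exact: adapted_indic.
have mPhiT := adapted_measurable mPhi.
have /andP[i0 _] := i_n.
rewrite -lee_fin -PrE; last exact: measurableI.
apply: (@le_trans _ _
  (\int[P]_w (Phi w * expR (theta * (in_degree target n i w)%:R))%:E)%E).
  rewrite -[B `&` E]setIT -integral_indic//; last exact: measurableI.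
  apply: ge0_le_integral => //.
  - by apply/measurable_EFinP/measurable_indic; exact: measurableI.
  - apply/measurable_EFinP; apply: measurable_funM => //.
    apply: measurableT_comp; first exact: measurable_expR.
    apply: measurable_funM => //; exact: (adapted_measurable (@adapted_degree n i)).
  move=> w _; rewrite lee_fin /Phi !indicE in_setI.
  case: (boolP (w \in B)) => wB /=; last by rewrite !mul0r.
  case: (boolP (w \in E)) => wE; last by rewrite mul1r mulr_ge0 ?expR_ge0.
  have h1 := hE _ (set_mem wE).
  rewrite /= mul1r -expRD; apply: le_trans (expR_ge1Dx _); lra.
apply: le_trans (degree_mgf theta i_n mPhi Phi0 _) _.
  by move=> w wpos; rewrite /Phi indicE memNset ?mul0r// => /Bpos.
have -> : (expR (m%:R * h - theta * thr) * Pr P B)%:E =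
  (\int[P]_w (expR (m%:R * h - theta * thr) * \1_B w)%:E)%E.
  rewrite EFinM -PrE// -[X in P X]setIT -integral_indic// -ge0_integralZl_EFin ?expR_ge0//.
  exact/measurable_EFinP/measurable_indic.
apply: ge0_le_integral => //.
- by move=> w _; rewrite lee_fin mulr_ge0 ?expR_ge0.
- apply/measurable_EFinP; apply: measurable_funM => //.
  apply: measurableT_comp; first exact: measurable_expR.
  apply: measurable_funM => //; apply: measurable_funM.
    exact: (adapted_measurable (@adapted_weight 0 i i0)).
  exact: (adapted_measurable (@adapted_inv_weight_sum 0 i n)).
- by apply/measurable_EFinP; apply: measurable_funM => //; exact: measurable_indic.
move=> w _; rewrite lee_fin /Phi indicE.
case: (boolP (w \in B)) => [/set_mem wB /=|]; last by rewrite !mul0r mulr0.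
rewrite mul1r mulr1 -expRD ler_expR addrC lerD2r -mulrA ler_wpM2l//.
exact: hh.
Qed.

End ConditionalChernoff.

(** * Independence, harmonic sums *)

(** Two applications of [integral_sub_sigma_algebra], first to the sigma-algebra of [Y] and
    then to that of [X]. *)
Lemma integralM_independent (R : realType) (d : measure_display)
    (T : measurableType d) (P : probability T R) (X Y : T -> R) (y : R) :
  measurable_fun [set: T] X -> (forall w, 0 <= X w) ->
  measurable_fun [set: T] Y -> (forall w, 0 <= Y w) ->
  (forall A B, measurable A -> measurable B ->
     P (X @^-1` A `&` Y @^-1` B) = (P (X @^-1` A) * P (Y @^-1` B))%E) ->
  (\int[P]_w (Y w)%:E = y%:E)%E ->
  (\int[P]_w (X w * Y w)%:E = \int[P]_w (X w)%:E * y%:E)%E.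
Proof.
move=> mX X0 mY Y0 XY EY.
have y0 : 0 <= y by rewrite -lee_fin -EY integral_ge0// => w _; rewrite lee_fin.
pose G (Z : T -> R) := preimage_set_system [set: T] Z measurable.
have sG (Z : T -> R) : <<s G Z >> `<=` G Z.
  by apply: smallest_sub => //; exact/sigma_algebra_preimage/sigma_algebra_measurable.
have GT (Z : T -> R) : measurable_fun [set: T] Z -> G Z `<=` measurable.
  by move=> mZ _ [B mB <-]; exact: mZ.
have mG (Z : T -> R) : measurable_fun [set: g_sigma_algebraType (G Z)] Z.
  by move=> _ B mB; apply: sub_sigma_algebra; exists B.
have Ysub A : measurable A ->
    (\int[P]_(w in X @^-1` A) (Y w)%:E = \int[P]_(w in X @^-1` A) y%:E)%E.
  move=> mA; have mXA : measurable (X @^-1` A) by rewrite -[_ @^-1` _]setTI; exact: mX.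
  transitivity (\int[P]_w (Y w * \1_(X @^-1` A) w)%:E)%E.
    rewrite integral_mkcond; apply: eq_integral => w _; rewrite patchE indicE.
    by case: ifPn => _; rewrite ?mulr1 ?mulr0.
  transitivity (\int[P]_w (Y w * Pr P (X @^-1` A))%:E)%E.
    apply: (@integral_sub_sigma_algebra _ _ _ P (G Y)) => //.
    - exact: GT.
    - by move=> w; rewrite Pr_ge0.
    move=> C /sG[B mB <-]; rewrite setTI.
    have mYB : measurable (Y @^-1` B) by rewrite -[_ @^-1` _]setTI; exact: mY.
    have XYr : Pr P (X @^-1` A `&` Y @^-1` B) = Pr P (X @^-1` A) * Pr P (Y @^-1` B).
      by rewrite /Pr XY// fineM// fin_num_measure.
    by rewrite integral_indic// integral_cst_indic// -XYr -PrE//; exact: measurableI.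
  under eq_integral do rewrite mulrC EFinM.
  rewrite ge0_integralZl_EFin ?Pr_ge0//; last 2 first.
  - by move=> w _; rewrite lee_fin.
  - exact/measurable_EFinP.
  by rewrite EY integral_cst_indic// mulrC.
transitivity (\int[P]_w (X w * y)%:E)%E.
  apply: (@integral_sub_sigma_algebra _ _ _ P (G X)) => //; first exact: GT.
  by move=> C /sG[A mA <-]; rewrite setTI; exact: Ysub.
under eq_integral do rewrite mulrC EFinM.
rewrite ge0_integralZl_EFin; first exact: muleC.
- exact: measurableT.
- by move=> w _; rewrite lee_fin.
- exact/measurable_EFinP.
- exact: y0.
Qed.

Section Harmonic.
Context (R : realType).

(** Both bounds are [ln (1 + x) <= x], the lower one at [x = - 1 / (j + 1)]. *)
Lemma ln_succ_bounds (j : nat) : (0 < j)%N ->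
  (j.+1%:R)^-1 <= ln (j.+1%:R / j%:R : R) <= (j%:R)^-1.
Proof.
move=> j0; have j0' : 0 < j%:R :> R by rewrite ltr0n.
apply/andP; split.
  have -> : j.+1%:R / j%:R = (1 + - (j.+1%:R)^-1)^-1 :> R.
    have -> : 1 + - (j.+1%:R)^-1 = j%:R / j.+1%:R :> R.
      by apply: (mulIf (_ : j.+1%:R != 0)); rewrite ?pnatr_eq0// mulrDl mulNr mulVf
        ?pnatr_eq0// divfK ?pnatr_eq0// mul1r mulrSr addrK.
    by rewrite invf_div.
  rewrite lnV ?posrE; last by rewrite subr_gt0 invf_lt1 ?ltr1n ?ltr0n.
  rewrite -[leLHS]opprK lerN2 le_ln1Dx// ltrN2 invf_lt1 ?ltr1n ?ltr0n//.
have -> : j.+1%:R / j%:R = 1 + (j%:R)^-1 :> R.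
  by rewrite mulrSr mulrDl divff ?lt0r_neq0// mul1r.
by rewrite le_ln1Dx// (lt_trans _ (_ : 0 < _)) ?invr_gt0// ltrN10.
Qed.

(** Telescoping [ln_succ_bounds]. *)
Lemma harmonic_ln_bounds (i n : nat) : (0 < i <= n)%N ->
  ln (n%:R / i%:R) <= \sum_(i <= j < n) (j%:R : R)^-1 <= ln (n%:R / i%:R) + (i%:R)^-1.
Proof.
move=> /andP[i0 ni].
suff : ln (n%:R / i%:R) <= \sum_(i <= j < n) (j%:R : R)^-1
     <= ln (n%:R / i%:R) + (i%:R)^-1 - (n%:R)^-1.
  move=> /andP[-> h]/=; apply: le_trans h _; rewrite gerBl invr_ge0//.
have i0' : 0 < i%:R :> R by rewrite ltr0n.
rewrite -(subnKC ni); elim: (n - i)%N => [|k IH].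
  by rewrite addn0 big_geq// divff ?lt0r_neq0// ln1 add0r subrr lexx.
rewrite addnS big_nat_recr/=; last by lia.
have ik0 : (0 < i + k)%N by lia.
have ik0' : 0 < (i + k)%:R :> R by rewrite ltr0n.
have -> : ln ((i + k).+1%:R / i%:R) =
   ln ((i + k)%:R / i%:R) + ln ((i + k).+1%:R / (i + k)%:R) :> R.
  by rewrite -lnM ?posrE ?divr_gt0//; congr ln; rewrite [RHS]mulrC mulrA divfK// lt0r_neq0.
have /andP[] := ln_succ_bounds ik0; move/andP: IH => [].
move: (_.+1%:R^-1) (i%:R^-1) ((i + k)%:R^-1) (ln ((i + k).+1%:R / _)) (ln _) => a b c e f.
by move: (\sum_(i <= _ < _) _) => g *; apply/andP; split; lra.
Qed.

(** Comparison with the telescoping sum of [4 / sqrt j - 4 / sqrt (j + 1)]. *)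
Lemma sum_rsqrt3_le (N n : nat) : (0 < N <= n)%N ->
  \sum_(N <= j < n) (j%:R * Num.sqrt j%:R)^-1 <= 4 * (Num.sqrt N%:R)^-1 :> R.
Proof.
move=> /andP[N0 Nn].
suff : \sum_(N <= j < n) (j%:R * Num.sqrt j%:R)^-1 <=
    4 * (Num.sqrt N%:R)^-1 - 4 * (Num.sqrt n%:R)^-1 :> R.
  move=> h; apply: le_trans h _; rewrite gerBl mulr_ge0// invr_ge0 sqrtr_ge0//.
rewrite -(subnKC Nn); elim: (n - N)%N => [|k IH].
  by rewrite addn0 big_geq// subrr.
rewrite addnS big_nat_recr/=; last by lia.
apply: le_trans (lerD IH (lexx _)) _; rewrite -!addrA lerD2l.
have : (0 < N + k)%N by lia.
move: (N + k)%N => j j0.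
have j0' : 1 <= j%:R :> R by rewrite ler1n.
have q0 : 0 < Num.sqrt j%:R :> R by rewrite sqrtr_gt0; lra.
have p0 : 0 < Num.sqrt j.+1%:R :> R by rewrite sqrtr_gt0 ltr0n.
have qE : Num.sqrt j%:R ^+ 2 = j%:R :> R by rewrite sqr_sqrtr//; lra.
have pE : Num.sqrt j.+1%:R ^+ 2 = j%:R + 1 :> R by rewrite sqr_sqrtr// natr1.
move: (Num.sqrt j%:R) (Num.sqrt j.+1%:R) q0 p0 qE pE => q p q0 p0 qE pE.
rewrite -qE.
rewrite -subr_ge0; set D := (X in 0 <= X).
have -> : D = (4 * q ^+ 2 * (p - q) - p) / (q ^+ 3 * p).
  by rewrite /D; field; rewrite !lt0r_neq0.
apply: divr_ge0; last by rewrite mulr_ge0 ?exprn_ge0// ltW.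
have pq : p <= 3 / 2 * q.
  rewrite -(@ler_pXn2r _ 2)// ?nnegrE; [|lra|lra].
  by rewrite pE exprMn qE; lra.
have dE : (p - q) * (p + q) = 1 by rewrite -subr_sqr pE qE; lra.
have pq0 : 0 < p + q by lra.
rewrite -(pmulr_lge0 _ pq0).
have -> : (4 * q ^+ 2 * (p - q) - p) * (p + q) =
  4 * q ^+ 2 * ((p - q) * (p + q)) - p * (p + q) by ring.
rewrite dE; nra.
Qed.
End Harmonic.

(** * Sums of inverse total weights *)

Section GoodWeights.
Context (R : realType) (d : measure_display) (T : measurableType d)
  (P : probability T R) (m : nat) (W : {RV P >-> R})
  (weight : nat -> {RV P >-> R}) (target : nat -> 'I_m -> {RV P >-> nat})
  (wrg : weighted_recursive_graph W weight target)
  (W_ge0 : forall w, 0 <= W w) (W_gt0 : P [set w | 0 < W w] = 1%E)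
  (EW : ('E_P[W] = 1)%E) (sigma2 : R)
  (EW2 : (\int[P]_w (W w ^+ 2)%:E = sigma2%:E)%E).

Let V i w : R := `|weight i w|.

Let mV i : measurable_fun [set: T] (V i).
Proof. exact: measurableT_comp. Qed.

Let V0 i w : 0 <= V i w. Proof. exact: normr_ge0. Qed.

Lemma integral_weight (f : R -> R) i : (0 < i)%N -> measurable_fun [set: R] f ->
  (forall x, 0 <= f x) ->
  (\int[P]_w (f (weight i w))%:E = \int[P]_w (f (W w))%:E)%E.
Proof.
move=> i0 mf f0.
have mEf : measurable_fun [set: R] (EFin \o f) by exact/measurable_EFinP.
transitivity (\int[distribution P (weight i)]_x (f x)%:E)%E.
  by rewrite ge0_integral_distribution// => x; rewrite lee_fin.
transitivity (\int[distribution P W]_x (f x)%:E)%E; last first.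
  by rewrite ge0_integral_distribution// => x; rewrite lee_fin.
by apply: eq_measure_integral => A mA _; exact: (wrg_weight_copy wrg).
Qed.

Lemma integral_abs_weight i : (0 < i)%N -> (\int[P]_w (V i w)%:E = 1)%E.
Proof.
move=> i0; rewrite /V.
have -> := @integral_weight (fun x => `|x|) i i0 (@normr_measurable R setT) (@normr_ge0 _ _).
rewrite -EW expectation_def; apply: eq_integral => w _.
by rewrite ger0_norm.
Qed.

Lemma integral_sqr_weight i : (0 < i)%N -> (\int[P]_w (V i w * V i w)%:E = sigma2%:E)%E.
Proof.
move=> i0; rewrite /V (@integral_weight (fun x => `|x| * `|x|))//.
- by rewrite -EW2; apply: eq_integral => w _; rewrite ger0_norm// expr2.
- by apply: measurable_funM; exact: normr_measurable.
Qed.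

Lemma sigma2_ge0 : 0 <= sigma2.
Proof. by rewrite -lee_fin -EW2 integral_ge0// => w _; rewrite lee_fin sqr_ge0. Qed.

Lemma integral_weightM i j : (0 < i)%N -> (0 < j)%N -> i != j ->
  (\int[P]_w (V i w * V j w)%:E = 1)%E.
Proof.
move=> i0 j0 ij.
rewrite (@integralM_independent _ _ _ P (V i) (V j) 1)//.
- by rewrite integral_abs_weight// mule1.
- move=> A B mA mB.
  have mabs C : measurable C -> measurable ((fun x : R => `|x|) @^-1` C).
    by move=> mC; rewrite -[_ @^-1` _]setTI; exact: normr_measurable.
  have := @wrg_weight_independent _ _ _ _ _ _ _ _ wrg [:: i; j]
    (fun k => if k == i then (fun x : R => `|x|) @^-1` A else (fun x : R => `|x|) @^-1` B).
  rewrite /= inE ij => /(_ isT); rewrite !big_cons big_nil mule1 eqxx eq_sym (negbTE ij).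
  move=> <-.
  + congr (P _); apply/seteqP; split => [w [h1 h2] k|w h].
      by rewrite /= !inE => /orP[]/eqP -> /=; rewrite ?eqxx// eq_sym (negbTE ij).
    split; first by have := h i; rewrite /= !inE eqxx/=; exact.
    by have := h j; rewrite /= !inE eqxx orbT eq_sym (negbTE ij); exact.
  + by move=> k; rewrite /= !inE => /orP[]/eqP ->.
  + by move=> k; case: ifPn => _; exact: mabs.
- exact: integral_abs_weight.
Qed.

Let S j w : R := \sum_(1 <= i < j.+1) V i w.

Let mS j : measurable_fun [set: T] (S j).
Proof. exact: measurable_sum. Qed.

Let S0 j w : 0 <= S j w. Proof. exact: sumr_ge0. Qed.

(** Absolute values keep the integrands nonnegative outside of the almost sure event where
    the weights are positive. *)
Lemma variance_total_weight j :
  (\int[P]_w ((S j w - j%:R) ^+ 2)%:E = (j%:R * (sigma2 - 1))%:E)%E.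
Proof.
have I1 : (\int[P]_w (S j w)%:E = j%:R%:E)%E.
  rewrite /S; under eq_integral do rewrite -sumEFin.
  rewrite ge0_integral_sum//; last 2 first.
  - by move=> i; exact/measurable_EFinP.
  - by move=> i w _; rewrite lee_fin.
  rewrite big_seq (eq_bigr (fun=> 1%E)) => [|i]; last first.
    by rewrite mem_index_iota => /andP[i0 _]; rewrite integral_abs_weight.
  rewrite -big_seq sumEFin big_const_nat subn1/= iter_addr addr0//.
have I2 : (\int[P]_w (S j w ^+ 2)%:E = (j%:R * sigma2 + (j%:R ^+ 2 - j%:R))%:E)%E.
  have -> : (fun w => (S j w ^+ 2)%:E) =
     (fun w => \sum_(1 <= i < j.+1) \sum_(1 <= k < j.+1) (V i w * V k w)%:E)%E.
    apply/funext => w; rewrite expr2 /S mulr_suml -sumEFin; apply: eq_bigr => i _.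
    by rewrite mulr_sumr -sumEFin.
  rewrite ge0_integral_sum//; last 2 first.
  - move=> i; apply: emeasurable_sum => k; apply/measurable_EFinP; exact: measurable_funM.
  - by move=> i w _; apply: sume_ge0 => k _; rewrite lee_fin mulr_ge0.
  rewrite big_seq (eq_bigr (fun=> (sigma2 + (j%:R - 1))%:E)) => [|i]; last first.
    rewrite mem_index_iota => /andP[i0 ij].
    rewrite ge0_integral_sum//; last 2 first.
    - by move=> k; apply/measurable_EFinP; exact: measurable_funM.
    - by move=> k w _; rewrite lee_fin mulr_ge0.
    rewrite (bigD1_seq i)/= ?iota_uniq// ?mem_index_iota ?i0//.
    rewrite integral_sqr_weight// EFinD; congr (_ + _)%E.
    rewrite big_seq_cond (eq_bigr (fun=> 1%E)) => [|k]; last first.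
      by rewrite mem_index_iota => /andP[/andP[k0 _] ki]; rewrite integral_weightM// eq_sym.
    rewrite -big_seq_cond sumEFin; congr (_%:E).
    have : \sum_(1 <= k < j.+1) (1 : R) = j%:R by rewrite big_const_nat subn1/= iter_addr addr0.
    rewrite (bigD1_seq i)/= ?iota_uniq// ?mem_index_iota ?i0// => <-.
    by rewrite [RHS]addrAC subrr add0r.
  rewrite -big_seq sumEFin big_const_nat subn1/= iter_addr addr0 -mulr_natl; congr (_%:E).
  ring.
have I3 : (\int[P]_w ((S j w - j%:R) ^+ 2)%:E + (2 * j%:R * j%:R)%:E =
    (j%:R * sigma2 + (j%:R ^+ 2 - j%:R) + j%:R ^+ 2)%:E)%E.
  have -> : (2 * j%:R * j%:R)%:E = (\int[P]_w (2 * j%:R * S j w)%:E)%E.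
    under eq_integral do rewrite EFinM.
    rewrite ge0_integralZl_EFin ?mulr_ge0//; last exact/measurable_EFinP.
      by rewrite I1 EFinM.
    by move=> w _; rewrite lee_fin.
  have mD : measurable_fun [set: T] (fun w => (S j w - j%:R) ^+ 2).
    by apply: measurable_funX; apply: measurable_funB.
  rewrite -ge0_integralD//; last 4 first.
  - by move=> w _; rewrite lee_fin sqr_ge0.
  - exact/measurable_EFinP.
  - by move=> w _; rewrite lee_fin !mulr_ge0.
  - by apply/measurable_EFinP; apply: measurable_funM.
  transitivity (\int[P]_w ((S j w ^+ 2)%:E + (j%:R ^+ 2)%:E))%E.
    by apply: eq_integral => w _; rewrite -!EFinD; congr (_%:E); ring.
  rewrite ge0_integralD//; last 2 first.
  - by move=> w _; rewrite lee_fin sqr_ge0.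
  - by apply/measurable_EFinP; apply: measurable_funX.
  by rewrite I2 integral_cst_indic// Pr_setT mulr1.
have shift (x : \bar R) (a b : R) : (x + a%:E = b%:E)%E -> x = (b - a)%:E.
  by move: x => [r| |]// h; congr (_%:E); case: h => <-; rewrite addrK.
by rewrite (shift _ _ _ I3); congr (_%:E); ring.
Qed.

Lemma Pr_markov (f : T -> R) (c v : R) : measurable_fun [set: T] f ->
  (forall w, 0 <= f w) -> 0 < c -> (\int[P]_w (f w)%:E <= v%:E)%E ->
  Pr P [set w | c <= f w] <= v / c.
Proof.
move=> mf f0 c0 fv.
have mA : measurable [set w | c <= f w].
  rewrite (_ : [set w | _] = f @^-1` `[c, +oo[); last first.
    by apply/seteqP; split => w /=; rewrite in_itv/= andbT.
  by rewrite -[X in measurable X]setTI; exact: mf.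
rewrite ler_pdivlMr// -lee_fin; apply: le_trans fv.
rewrite mulrC EFinM -PrE// -[X in P X]setIT -integral_indic//.
rewrite -ge0_integralZl_EFin ?(ltW c0)//; last exact/measurable_EFinP/measurable_indic.
apply: ge0_le_integral => //.
- by move=> w _; rewrite lee_fin mulr_ge0// ltW.
- by apply/measurable_EFinP; apply: measurable_funM => //; exact: measurable_indic.
- exact/measurable_EFinP.
move=> w _; rewrite lee_fin indicE.
by case: (boolP (w \in _)) => [/set_mem/=|]; rewrite ?mulr1 ?mulr0.
Qed.

Let Sdev j w : R := (S j w - j%:R) ^+ 2.

Let mSdev j : measurable_fun [set: T] (Sdev j).
Proof. by apply: measurable_funX; apply: measurable_funB. Qed.

Let total_weightE j w : positive_weights weight w -> total_weight weight j w = S j w.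
Proof.
move=> hw; rewrite /total_weight /S; apply: eq_big_nat => i /andP[i0 _].
by rewrite /V ger0_norm// ltW// (positive_weightsP hw).
Qed.

Let bad k : set T := [set w | (2 ^ k)%:R ^+ 2 / 4 <= Sdev (2 ^ k) w].

Let mset_ge (f : T -> R) c : measurable_fun [set: T] f -> measurable [set w | c <= f w].
Proof.
move=> mf; rewrite (_ : [set w | _] = f @^-1` `[c, +oo[); last first.
  by apply/seteqP; split => w /=; rewrite in_itv/= andbT.
by rewrite -[X in measurable X]setTI; exact: mf.
Qed.

Let Pr_bad k : Pr P (bad k) <= 4 * sigma2 / 2 ^+ k.
Proof.
have p0 : 0 < (2 ^ k)%:R :> R by rewrite ltr0n expn_gt0.
apply: le_trans (@Pr_markov (Sdev (2 ^ k)) _ ((2 ^ k)%:R * sigma2) _ _ _ _) _ => //.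
- by move=> w; rewrite sqr_ge0.
- by rewrite variance_total_weight lee_fin ler_wpM2l// gerBl.
rewrite natrX in p0 *; rewrite le_eqVlt; apply/orP; left; apply/eqP.
by field; rewrite lt0r_neq0.
Qed.

(* Along powers of two the second moment suffices, and between them the total
   weight is monotone. *)
Let total_weight_ge k0 K w j : positive_weights weight w ->
  (forall k, (k0 <= k <= K)%N -> ~ bad k w) ->
  (2 ^ k0 <= j <= K)%N -> j%:R / 4 <= S j w.
Proof.
move=> hw hbad /andP[jk jK].
have j0 : (0 < j)%N by rewrite (leq_trans _ jk)// expn_gt0.
pose k := trunc_log 2 j.
have /andP[kj jk1] : (2 ^ k <= j < 2 ^ k.+1)%N by exact: trunc_log_bounds.
have k0k : (k0 <= k)%N by rewrite /k -(@trunc_expnK 2 k0 isT) leq_trunc_log.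
have kK : (k <= K)%N.
  by rewrite (leq_trans _ jK)// (leq_trans _ kj)// ltnW// ltn_expl.
have nb := hbad k; rewrite k0k kK in nb; move: (nb isT) => /negP.
rewrite -ltNge /Sdev => dev.
have SS : S (2 ^ k) w <= S j w.
  rewrite /S [leRHS](@big_cat_nat _ _ _ (2 ^ k).+1)//= lerDl sumr_ge0//.
have j2 : j%:R < 2 * (2 ^ k)%:R :> R by rewrite -natrM ltr_nat -expnS.
have p0 : 0 < (2 ^ k)%:R :> R by rewrite ltr0n expn_gt0.
have : (2 ^ k)%:R / 2 < S (2 ^ k) w; last by lra.
rewrite ltNge; apply/negP => Sle; move: dev; apply/negP; rewrite -leNgt.
move: (2 ^ k)%:R (S (2 ^ k) w) p0 Sle => p x *; nra.
Qed.

Let geometric_tail k0 n :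
  \sum_(k0 <= k < n) (4 * sigma2 / 2 ^+ k) <= 8 * sigma2 / 2 ^+ k0.
Proof.
have [nk|kn] := leqP n k0.
  by rewrite big_geq// mulr_ge0// ?invr_ge0 ?exprn_ge0// mulr_ge0// sigma2_ge0.
suff : \sum_(k0 <= k < n) (4 * sigma2 / 2 ^+ k) <= 8 * sigma2 / 2 ^+ k0 - 8 * sigma2 / 2 ^+ n.
  move=> h; apply: le_trans h _; rewrite gerBl.
  by rewrite mulr_ge0// ?invr_ge0 ?exprn_ge0// mulr_ge0// sigma2_ge0.
rewrite -(subnKC (ltnW kn)); elim: (n - k0)%N => [|k IH].
  by rewrite addn0 big_geq// subrr.
rewrite addnS big_nat_recr/=; last by lia.
apply: le_trans (lerD IH (lexx _)) _; rewrite exprS.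
have : 2 ^+ (k0 + k) != 0 :> R by rewrite expf_neq0.
move: (2 ^+ (k0 + k)) => x x0; rewrite le_eqVlt; apply/orP; left; apply/eqP.
by rewrite -!addrA; congr (_ + _); field.
Qed.

(** The difference [1 / S_j - 1 / j] is at most [4 |S_j - j| / j^2] once [S_j >= j / 4]. As
    [E (S_j - j)^2] is of order [j], its sum over [j >= N] is of order [N^(-1/2)] in mean;
    the weighted inequality [2 |x| <= x^2 / q + q] with [q = sqrt j] avoids square roots of
    integrals. The lower bound on [S_j] holds for all [j] at once by controlling the sums
    along powers of two. *)
Lemma good_weights (eta eps : R) : 0 < eta -> 0 < eps ->
  exists N0, (0 < N0)%N /\ forall N n, (N0 <= N <= n)%N -> exists A : set T,
    [/\ graph_history weight target 0 A, A `<=` positive_weights weight,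
        1 - eps <= Pr P A
      & forall w i, A w -> (N <= i <= n)%N ->
          `|inv_weight_sum weight i n w - ln (n%:R / i%:R)| <= eta].
Proof.
move=> eta0 eps0.
have s0 := sigma2_ge0.
(* Chosen so that the bounds [PC] and [PB] on the two exceptional events add up to at most
   [eps] as soon as [sqrt N >= K]. *)
pose K := 16 * sigma2 * (1 + eta^-1) / eps.
have K0 : 0 <= K by rewrite /K !mulr_ge0 ?invr_ge0 ?addr_ge0 ?invr_ge0 ?(ltW eps0) ?(ltW eta0).
pose N0 := (Num.truncn (K ^+ 2 + 2 / eta)).+2.
exists N0; split => // N n /andP[N0N Nn].
have N1 : (1 < N)%N by exact: leq_trans N0N.
have N_gt0 : (0 < N)%N by exact: ltnW.
have NR : 1 <= N%:R :> R by rewrite ler1n.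
have NK : K ^+ 2 + 2 / eta <= N%:R.
  apply/ltW/(lt_le_trans (truncnS_gt _)).
  by rewrite ler_nat (leq_trans _ N0N).
have KN : K <= Num.sqrt N%:R.
  rewrite -(@ger0_norm _ K)// -sqrtr_sqr ler_wsqrtr//.
  by apply: le_trans NK; rewrite lerDl divr_ge0// ltW.
pose k0 := trunc_log 2 N.
pose Dev w : R := \sum_(N <= j < n) `|(total_weight weight j w)^-1 - j%:R^-1|.
pose f w : R := \sum_(N <= j < n)
  (Sdev j w / Num.sqrt j%:R + Num.sqrt j%:R) / (2 * j%:R ^+ 2).
have f_ge0 j w : 0 <= (Sdev j w / Num.sqrt j%:R + Num.sqrt j%:R) / (2 * j%:R ^+ 2).
  by rewrite divr_ge0 ?mulr_ge0 ?exprn_ge0// addr_ge0 ?sqrtr_ge0// divr_ge0 ?sqrtr_ge0 ?sqr_ge0.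
have mterm j : measurable_fun [set: T] (fun w =>
    (Sdev j w / Num.sqrt j%:R + Num.sqrt j%:R) / (2 * j%:R ^+ 2)).
  by apply: measurable_funM => //; apply: measurable_funD => //; apply: measurable_funM.
have mf : measurable_fun [set: T] f by exact: measurable_sum.
have Ef : (\int[P]_w (f w)%:E <= (2 * sigma2 / Num.sqrt N%:R)%:E)%E.
  rewrite /f; under eq_integral do rewrite -sumEFin.
  rewrite ge0_integral_sum//; last 2 first.
  - by move=> j; exact/measurable_EFinP.
  - by move=> j w _; rewrite lee_fin.
  rewrite big_seq (eq_bigr (fun j => (sigma2 / 2 * (j%:R * Num.sqrt j%:R)^-1)%:E)).
    rewrite -big_seq sumEFin lee_fin -mulr_sumr.
    have := @sum_rsqrt3_le R N n; rewrite N_gt0 Nn => /(_ isT) h.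
    apply: le_trans (ler_wpM2l _ h) _; first by rewrite divr_ge0.
    by rewrite le_eqVlt; apply/orP; left; apply/eqP; field; rewrite gt_eqF// sqrtr_gt0; lra.
  move=> j; rewrite mem_index_iota => /andP[Nj _].
  have j1 : 1 <= j%:R :> R by rewrite ler1n (leq_trans _ Nj).
  have q0 : 0 < Num.sqrt j%:R :> R by rewrite sqrtr_gt0; lra.
  have qE : Num.sqrt j%:R ^+ 2 = j%:R :> R by rewrite sqr_sqrtr//; lra.
  have c0 : 0 <= (2 * j%:R ^+ 2 * Num.sqrt j%:R)^-1 :> R.
    by rewrite invr_ge0 !mulr_ge0.
  transitivity (\int[P]_w ((2 * j%:R ^+ 2 * Num.sqrt j%:R)^-1%:E * (Sdev j w)%:E +
      (Num.sqrt j%:R / (2 * j%:R ^+ 2))%:E))%E.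
    by apply: eq_integral => w _; rewrite -EFinM -EFinD; congr (_%:E); field;
      rewrite !gt_eqF//; lra.
  rewrite ge0_integralD//; last 2 first.
  - by move=> w _; rewrite -EFinM lee_fin; apply: mulr_ge0; [exact: c0|exact: sqr_ge0].
  - by apply/measurable_EFinP; apply: measurable_funM.
  rewrite ge0_integralZl_EFin//; last 2 first.
  - by move=> w _; rewrite lee_fin sqr_ge0.
  - exact/measurable_EFinP.
  rewrite variance_total_weight integral_cst_indic// Pr_setT mulr1 -EFinM -EFinD; congr (_%:E).
  by move: (Num.sqrt j%:R) q0 qE => q q0 <-; field; rewrite gt_eqF.
pose A := positive_weights weight `&` [set w | Dev w <= eta / 2].
have aDev : adapted weight target 0 Dev.
  apply: measurable_sum => j; apply: measurableT_comp; first exact: normr_measurable.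
  by apply: measurable_funB => //; apply: measurable_funV; exact: adapted_total_weight.
have hA : graph_history weight target 0 A.
  apply: history_setI; first exact: positive_weights_history.
  rewrite (_ : [set w | _] = Dev @^-1` `]-oo, eta / 2]).
    exact: adapted_preimage.
  by apply/seteqP; split => w /=; rewrite in_itv.
have mA := history_measurable hA.
have mpos := @measurable_positive_weights R d T P m weight target.
have mbad k : measurable (bad k) by exact: mset_ge.
exists A; split=> //; first by move=> w [].
- pose B := [set w | eta / 8 <= f w].
  have mB : measurable B by exact: mset_ge.
  pose C := [set w | exists2 k, k \in index_iota k0 n.+1 & bad k w].
  have mC : measurable C.
    rewrite (_ : C = \bigcup_(k in [set` index_iota k0 n.+1]) bad k).
      by apply: bigcup_measurable.
    by apply/seteqP; split => w [k hk bk]; exists k.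
  have AC : ~` A `<=` ~` positive_weights weight `|` (C `|` B).
    move=> w Aw; have [hw|hw] := pselect (positive_weights weight w); last by left.
    right; apply: contrapT => /not_orP[nC nB]; apply: Aw; split=> //=.
    move/negP: nB; rewrite -ltNge => nB.
    apply: (@le_trans _ _ (4 * f w)); last by lra.
    rewrite /Dev /f mulr_sumr big_seq [leRHS]big_seq ler_sum// => j.
    rewrite mem_index_iota => /andP[Nj jn].
    have j1 : 1 <= j%:R :> R by rewrite ler1n (leq_trans _ Nj).
    have Sge : j%:R / 4 <= S j w.
      apply: (@total_weight_ge k0 n) => //.
        by move=> k hk bk; apply: nC; exists k => //; rewrite mem_index_iota.
      by rewrite (ltnW jn) andbT (leq_trans _ Nj)// trunc_logP.
    rewrite total_weightE//.
    have q0 : 0 < Num.sqrt j%:R :> R by rewrite sqrtr_gt0; lra.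
    have qE : Num.sqrt j%:R ^+ 2 = j%:R :> R by rewrite sqr_sqrtr//; lra.
    have Sj0 : 0 < S j w by lra.
    have -> : (S j w)^-1 - j%:R^-1 = (j%:R - S j w) / (S j w * j%:R).
      by field; rewrite !gt_eqF//; lra.
    rewrite normrM distrC normfV (gtr0_norm (mulr_gt0 _ _))//; last by lra.
    apply: (@le_trans _ _ (`|S j w - j%:R| * (4 / j%:R ^+ 2))).
      apply: ler_wpM2l => //; rewrite -[4 / _]invrK lef_pV2 ?posrE.
      - by rewrite invf_div expr2 mulrAC ler_wpM2r//; lra.
      - by rewrite mulr_gt0//; lra.
      - by rewrite invr_gt0 divr_gt0// exprn_gt0//; lra.
    have -> : 4 * ((Sdev j w / Num.sqrt j%:R + Num.sqrt j%:R) / (2 * j%:R ^+ 2)) =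
       (Sdev j w / Num.sqrt j%:R + Num.sqrt j%:R) / 2 * (4 / j%:R ^+ 2).
      by field; rewrite !gt_eqF//; lra.
    apply: ler_wpM2r; first by rewrite divr_ge0 ?exprn_ge0.
    rewrite /Sdev -[(S j w - j%:R) ^+ 2]real_normK ?num_real//.
    move: `|_| (Num.sqrt _) q0 => x q q0.
    have -> : x ^+ 2 / q + q = (x ^+ 2 + q ^+ 2) / q by field; rewrite gt_eqF.
    rewrite mulrAC ler_pdivlMr//; have := sqr_ge0 (x - q); rewrite sqrrB; lra.
  have PC : Pr P C <= 16 * sigma2 / Num.sqrt N%:R.
    apply: (@le_trans _ _ (\sum_(k0 <= k < n.+1) Pr P (bad k))).
      by apply: Pr_bigcup => //.
    apply: (@le_trans _ _ (\sum_(k0 <= k < n.+1) (4 * sigma2 / 2 ^+ k))).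
      by apply: ler_sum => k _; exact: Pr_bad.
    apply: le_trans (geometric_tail _ _) _.
    have qN : Num.sqrt N%:R <= N%:R :> R.
      by rewrite -[leRHS](@ger0_norm _ N%:R)// -sqrtr_sqr ler_wsqrtr// expr2 ler_peMl.
    have q0 : 0 < Num.sqrt N%:R :> R by rewrite sqrtr_gt0; lra.
    have N2k : N%:R < 2 * 2 ^+ k0 :> R.
      by rewrite -exprS -natrX ltr_nat; apply: trunc_log_ltn.
    rewrite ler_pdivrMr ?exprn_gt0// mulrAC ler_pdivlMr//.
    have := sigma2_ge0; move: (2 ^+ k0) N2k => x *; nra.
  have PB : Pr P B <= 16 * sigma2 / eta / Num.sqrt N%:R.
    apply: le_trans (@Pr_markov f (eta / 8) _ mf _ _ Ef) _ => //.
    - by move=> w; rewrite /f sumr_ge0.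
    - by rewrite divr_gt0.
    rewrite le_eqVlt; apply/orP; left; apply/eqP; field.
    by rewrite !gt_eqF// sqrtr_gt0; lra.
  have : Pr P (~` A) <= Pr P C + Pr P B.
    apply: le_trans (Pr_mono P _ _ AC) _ => //.
    - exact: measurableC.
    - by apply: measurableU; [exact: measurableC|exact: measurableU].
    apply: le_trans (Pr_setU P _ _) _; [exact: measurableC|exact: measurableU|].
    rewrite Pr_setC// (positive_weights_as wrg W_gt0) subrr add0r.
    exact: Pr_setU.
  rewrite Pr_setC//.
  suff : Pr P C + Pr P B <= eps by lra.
  apply: le_trans (lerD PC PB) _.
  rewrite -mulrDl ler_pdivrMr ?sqrtr_gt0 ?ltr0n//.
  rewrite mulrC -ler_pdivrMl// mulrC; apply: le_trans KN.
  by rewrite le_eqVlt; apply/orP; left; apply/eqP; rewrite /K; ring.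
move=> w i [hw /= Aw] /andP[Ni ni].
have i0 : (0 < i)%N by exact: leq_trans Ni.
have /andP[h1 h2] := @harmonic_ln_bounds R i n (ltac:(by rewrite i0)).
have h3 : `|inv_weight_sum weight i n w - \sum_(i <= j < n) j%:R^-1| <= eta / 2.
  rewrite /inv_weight_sum -sumrB; apply: le_trans (ler_norm_sum _ _ _) _.
  apply: le_trans Aw; rewrite /Dev [leRHS](@big_cat_nat _ _ _ i)//= lerDr sumr_ge0//.
have iR : (i%:R : R)^-1 <= eta / 2.
  rewrite -[_ / 2]invrK lef_pV2 ?posrE ?invr_gt0 ?divr_gt0 ?ltr0n// invf_div.
  apply: (@le_trans _ _ N%:R); last by rewrite ler_nat.
  by apply: le_trans NK; rewrite lerDr sqr_ge0.
move: h3; rewrite !ler_norml => /andP[h3 h4]; apply/andP; split; lra.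
Qed.

End GoodWeights.

(** * Exponents at the critical level *)

Section Exponents.
Context (R : realType).
Implicit Types (x y : R).

Lemma expR_m1_le x : 0 <= x <= 1 / 2 -> expR x - 1 <= x * (1 + 2 * x).
Proof.
move=> /andP[x0 x1]; have e0 := expR_gt0 x.
have h : 1 - x <= (expR x)^-1 by rewrite -expRN; exact: expR_ge1Dx.
have h1 : (1 - x) * expR x <= 1 by rewrite -ler_pdivlMr// mul1r.
nra.
Qed.

Lemma expR_N_le x : 0 <= x -> expR (- x) - 1 <= - x * (1 - x).
Proof.
move=> x0; have e0 := expR_gt0 (- x).
have h1 : (1 + x) * expR (- x) <= 1.
  rewrite expRN ler_pdivrMr ?expR_gt0// mul1r; exact: expR_ge1Dx.
nra.
Qed.

Lemma perturbed_bounds (a b Y : R) : 0 < a -> `|Y| * a <= b ->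
  0 <= b + Y * a /\ b + Y * a <= 2 * b.
Proof. by move=> a0; rewrite -[X in _ * X]gtr0_norm// -normrM => /ler_normlP[]; lra. Qed.

(** Exponent of the exponential inequality for a vertex whose weight lies [k] spacings below
    [q] to exceed its level. The first-order terms cancel since [q] is the critical weight
    for the level [y - eps]: the difference [eps] gains [lam eps], and half of it absorbs
    the second-order terms and the error [eta] on the sum of inverse weights. *)
Lemma exponent_upper (m a b L Li K eta theta y Y lam eps omega q k c : R) :
  0 < m -> 0 < a -> 0 < b -> 0 < L -> 3 / 4 * L <= Li -> 0 < eta <= Li ->
  b <= 2 * a * L -> b <= omega * (m * a ^+ 2 * L) -> `|Y| * a <= b ->
  K = Li + eta -> q = (b + Y * a) * L / Li -> Y = y - eps ->
  theta = lam / (m * a * L) -> theta <= 1 / 2 -> 0 < lam -> 0 <= k ->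
  8 * lam * omega <= eps / 4 -> 8 * eta <= eps / 4 ->
  c <= theta * (1 + 2 * theta) -> 0 <= q - k * a ->
  m * (c * ((q - k * a) * K)) - theta * (m * ((b + y * a) * L)) <=
    - (lam * eps / 2) - lam * k / 2.
Proof.
move=> m0 a0 b0 L0 LiL /andP[eta0 etaLi] bL bo Ya KE qE YE thE th1 lam0 k0 lo etaeps cth qk.
have Li0 : 0 < Li by lra.
have mu0 : 0 < m * a * L by rewrite !mulr_gt0.
have th0 : 0 < theta by rewrite thE divr_gt0.
have thmu : theta * (m * a * L) = lam by rewrite thE divfK// gt_eqF.
have K0 : 0 < K by rewrite KE addr_gt0.
set e := eta / Li.
have e0 : 0 < e by rewrite divr_gt0.
have e1 : e <= 1 by rewrite ler_pdivrMr// mul1r.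
have Kq : q * K = (b + Y * a) * L * (1 + e).
  by rewrite qE KE /e; field; rewrite gt_eqF.
have [bY bY2] := perturbed_bounds a0 Ya.
(* replace [c] by its bound and drop the second-order part of the [k] term *)
have step1 : c * ((q - k * a) * K) <=
    theta * ((1 + 2 * theta) * ((b + Y * a) * L * (1 + e)) - k * a * K).
  apply: (@le_trans _ _ (theta * (1 + 2 * theta) * ((q - k * a) * K))).
    by apply: ler_wpM2r => //; rewrite mulr_ge0// ltW.
  rewrite -[leLHS]mulrA ler_wpM2l ?(ltW th0)// mulrBl Kq.
  have : 0 <= theta * (k * a * K) by rewrite !mulr_ge0// ltW.
  lra.
have kK : 1 / 2 * L <= K by rewrite KE; lra.
have step2 : (1 + 2 * theta) * (1 + e) * (b + Y * a) <= b + Y * a + (4 * theta + e) * (2 * b).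
  have h1 : (1 + 2 * theta) * (1 + e) <= 1 + (4 * theta + e) by nra.
  apply: le_trans (ler_wpM2r bY h1) _; rewrite mulrDl mul1r lerD2l ler_wpM2l//; lra.
have be : e * b <= 4 * eta * a.
  rewrite /e mulrAC ler_pdivrMr//.
  have : b <= 4 * a * Li by nra.
  nra.
have tb : theta * b <= lam * omega * a.
  rewrite thE mulrAC ler_pdivrMr//.
  have := ler_wpM2l (ltW lam0) bo; lra.
apply: (@le_trans _ _ (m * (theta * ((1 + 2 * theta) * ((b + Y * a) * L * (1 + e)) - k * a * K))
   - theta * (m * ((b + y * a) * L)))).
  by rewrite lerD2r ler_wpM2l// ltW.
have -> : m * (theta * ((1 + 2 * theta) * ((b + Y * a) * L * (1 + e)) - k * a * K))
   - theta * (m * ((b + y * a) * L)) =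
  theta * m * L * ((1 + 2 * theta) * (1 + e) * (b + Y * a) - (b + y * a)) - theta * m * a * k * K.
  by ring.
have tml : 0 <= theta * m * L by rewrite !mulr_ge0// ltW.
have s3 : (1 + 2 * theta) * (1 + e) * (b + Y * a) - (b + y * a) <= - (eps / 2) * a by nra.
have s4 := ler_wpM2l tml s3.
have s5 : theta * m * L * (- (eps / 2) * a) = - (lam * eps / 2).
  by rewrite -thmu; ring.
have s6 : lam * k / 2 <= theta * m * a * k * K.
  rewrite -thmu; have : 0 <= theta * m * a * k by rewrite !mulr_ge0// ltW.
  move=> /ler_wpM2l /(_ _ _ kK); lra.
lra.
Qed.

(** The analogue of [exponent_upper] for a vertex with weight at least [q], the critical
    weight for the level [y + eps], to stay below its level. *)
Lemma exponent_lower (m a b L Li eta theta y Y lam eps omega q c : R) :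
  0 < m -> 0 < a -> 0 < b -> 0 < L -> 3 / 4 * L <= Li -> 0 < eta <= Li ->
  b <= 2 * a * L -> b <= omega * (m * a ^+ 2 * L) -> `|Y| * a <= b ->
  q = (b + Y * a) * L / Li -> Y = y + eps ->
  theta = lam / (m * a * L) -> theta <= 1 / 2 -> 0 < lam ->
  8 * lam * omega <= eps / 4 -> 8 * eta <= eps / 4 ->
  c <= - theta * (1 - theta) -> 0 <= q ->
  m * (c * (q * (Li - eta))) + theta * (m * ((b + y * a) * L)) <= - (lam * eps / 2).
Proof.
move=> m0 a0 b0 L0 LiL /andP[eta0 etaLi] bL bo Ya qE YE thE th1 lam0 lo etaeps cth q0.
have Li0 : 0 < Li by lra.
have mu0 : 0 < m * a * L by rewrite !mulr_gt0.
have th0 : 0 < theta by rewrite thE divr_gt0.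
have thmu : theta * (m * a * L) = lam by rewrite thE divfK// gt_eqF.
set e := eta / Li.
have e0 : 0 < e by rewrite divr_gt0.
have e1 : e <= 1 by rewrite ler_pdivrMr// mul1r.
have Kq : q * (Li - eta) = (b + Y * a) * L * (1 - e).
  by rewrite qE /e; field; rewrite gt_eqF.
have [bY bY2] := perturbed_bounds a0 Ya.
have step1 : c * (q * (Li - eta)) <= - theta * (1 - theta) * ((b + Y * a) * L * (1 - e)).
  by rewrite -Kq; apply: ler_wpM2r => //; rewrite mulr_ge0// subr_ge0.
have step2 : b + Y * a - (theta + e) * (2 * b) <= (1 - theta) * (1 - e) * (b + Y * a).
  have h1 : 1 - (theta + e) <= (1 - theta) * (1 - e) by nra.
  apply: le_trans (ler_wpM2r bY h1); rewrite mulrBl mul1r lerD2l lerN2 ler_wpM2l//; lra.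
have be : e * b <= 4 * eta * a.
  rewrite /e mulrAC ler_pdivrMr//.
  have : b <= 4 * a * Li by nra.
  nra.
have tb : theta * b <= lam * omega * a.
  rewrite thE mulrAC ler_pdivrMr//.
  have := ler_wpM2l (ltW lam0) bo; lra.
apply: (@le_trans _ _ (m * (- theta * (1 - theta) * ((b + Y * a) * L * (1 - e)))
   + theta * (m * ((b + y * a) * L)))).
  by rewrite lerD2r ler_wpM2l// ltW.
have -> : m * (- theta * (1 - theta) * ((b + Y * a) * L * (1 - e)))
   + theta * (m * ((b + y * a) * L)) =
  theta * m * L * ((b + y * a) - (1 - theta) * (1 - e) * (b + Y * a)) by ring.
have tml : 0 <= theta * m * L by rewrite !mulr_ge0// ltW.
have s3 : (b + y * a) - (1 - theta) * (1 - e) * (b + Y * a) <= - (eps / 2) * a by nra.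
have s4 := ler_wpM2l tml s3.
have s5 : theta * m * L * (- (eps / 2) * a) = - (lam * eps / 2).
  by rewrite -thmu; ring.
lra.
Qed.

(** A vertex with weight at most [q / 2] is so far from its level that the fixed parameter
    [theta = 1 / 4] already gives an exponent of the order of the level. *)
Lemma exponent_far (m a b L Li K eta y Y q c : R) :
  1 <= m -> 0 < a -> 0 < b -> 0 < L -> 0 < Li -> 0 < eta <= Li / 16 ->
  16 * `|y| * a <= b -> 16 * `|Y| * a <= b ->
  K = Li + eta -> q = (b + Y * a) * L / Li -> 0 <= c <= 1 / 3 ->
  m * (c * (q / 2 * K)) - 1 / 4 * (m * ((b + y * a) * L)) <= - (b * L / 25).
Proof.
move=> m1 a0 b0 L0 Li0 /andP[eta0 etaLi] ya Ya KE qE /andP[c0 c1].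
set e := eta / Li.
have e0 : 0 < e by rewrite divr_gt0.
have e1 : e <= 1 / 16 by rewrite ler_pdivrMr//; lra.
have Kq : q * K = (b + Y * a) * L * (1 + e).
  by rewrite qE KE /e; field; rewrite gt_eqF.
have bY z : 16 * `|z| * a <= b -> 15 / 16 * b <= b + z * a <= 17 / 16 * b.
  move=> za; have : `|z * a| <= b / 16 by rewrite normrM (gtr0_norm a0); lra.
  by move=> /ler_normlP[]; lra.
have /andP[y1 y2] := bY _ ya; have /andP[Y1 Y2] := bY _ Ya.
have -> : m * (c * (q / 2 * K)) - 1 / 4 * (m * ((b + y * a) * L)) =
  m * L * (c / 2 * (1 + e) * (b + Y * a) - (b + y * a) / 4).
  by rewrite (_ : c * (q / 2 * K) = c / 2 * (q * K)); [rewrite Kq; ring|ring].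
have h1 : c / 2 * (1 + e) <= 17 / 96 by nra.
have h2 : c / 2 * (1 + e) * (b + Y * a) <= 17 / 96 * (17 / 16 * b).
  apply: le_trans (ler_wpM2r _ h1) _; first by lra.
  by apply: ler_wpM2l => //; lra.
have h3 : c / 2 * (1 + e) * (b + Y * a) - (b + y * a) / 4 <= - (b / 25) by lra.
have mL : L <= m * L by rewrite ler_peMl// ltW.
have bL0 : 0 <= b / 25 by lra.
apply: le_trans (ler_wpM2l _ h3) _; first by rewrite mulr_ge0//; lra.
have := ler_wpM2r bL0 mL; lra.
Qed.

(** Both inequalities are [1 + x <= exp x]; the lower one is applied to
    [1 / (1 - p)]. *)
Lemma prod_onem_bounds (I : eqType) (s : seq I) (p : I -> R) (e : R) :
  e <= 1 / 2 -> (forall i, i \in s -> 0 <= p i <= e) ->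
  expR (- ((1 + 2 * e) * \sum_(i <- s) p i)) <= \prod_(i <- s) (1 - p i)
    <= expR (- \sum_(i <- s) p i).
Proof.
move=> e12 hp.
rewrite mulr_sumr -!sumrN !expR_sum; apply/andP; split.
  rewrite big_seq [leRHS]big_seq; apply: ler_prod => i /hp /andP[p0 pe].
  rewrite expR_ge0/= expRN -[leRHS]invrK lef_pV2 ?posrE ?expR_gt0 ?invr_gt0; [|lra..].
  apply: le_trans (expR_ge1Dx _); rewrite -[leLHS]mul1r ler_pdivrMr; [nra|lra].
rewrite big_seq [leRHS]big_seq; apply: ler_prod => i /hp /andP[p0 pe].
by rewrite subr_ge0 (le_trans pe) ?expR_ge1Dx//; lra.
Qed.
End Exponents.

(** * The degree of one vertex *)

Section SingleVertex.
Context (R : realType) (d : measure_display) (T : measurableType d)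
  (P : probability T R) (m : nat) (W : {RV P >-> R})
  (weight : nat -> {RV P >-> R}) (target : nat -> 'I_m -> {RV P >-> nat})
  (wrg : weighted_recursive_graph W weight target) (m_gt0 : (0 < m)%N).

Definition tailW (x : R) : R := Pr P [set w | x <= W w].

Lemma measurable_ge (X : {RV P >-> R}) x : measurable [set w | x <= X w].
Proof.
rewrite (_ : [set w | _] = X @^-1` `[x, +oo[); first exact: measurable_funPTI.
by apply/seteqP; split => w /=; rewrite in_itv/= andbT.
Qed.

Lemma tail_weight i x : (0 < i)%N -> Pr P [set w | x <= weight i w] = tailW x.
Proof.
move=> i0; have E (X : {RV P >-> R}) : [set w | x <= X w] = X @^-1` `[x, +oo[.
  by apply/seteqP; split => w /=; rewrite in_itv/= andbT.
rewrite /tailW /Pr !E; congr fine.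
exact: (wrg_weight_copy wrg i0 (measurable_itv `[x, +oo[)).
Qed.

Lemma history_weight_itv i (I : interval R) : (0 < i)%N ->
  graph_history weight target 0 (weight i @^-1` [set` I]).
Proof. by move=> i0; apply: adapted_preimage => //; exact: adapted_weight. Qed.

Lemma measurable_degree_itv n i (D : set nat) :
  measurable (in_degree target n i @^-1` D).
Proof.
by rewrite -[_ @^-1` _]setTI; exact: (measurable_degree weight target).
Qed.

(** Sizes, at a fixed time, of the scales involved: the degrees of the vertices
    considered live around [m b L] with fluctuations [m a L], and [Li] is the
    value of the sum of the inverse total weights seen by the vertex. *)
Record scales (a b L Li eta lam omega eps : R) : Prop := Scales {
  scale_a : 0 < a ;
  scale_b : 0 < b ;
  scale_L : 0 < L ;
  scale_Li : 3 / 4 * L <= Li <= 5 / 4 * L ;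
  scale_eta : 0 < eta <= Li / 16 ;
  scale_baL : b <= 2 * a * L ;
  scale_omega : b <= omega * (m%:R * a ^+ 2 * L) ;
  scale_lam : 0 < lam ;
  scale_theta : lam / (m%:R * a * L) <= 1 / 2 ;
  scale_lo : 8 * lam * omega <= eps / 4 ;
  scale_eps : 8 * eta <= eps / 4 }.

(** Given the weights, the degree has mean at least [m (b + Y a) L] up to the error
    [eta]: [conditional_chernoff] with [theta = - lam / (m a L)]. *)
Lemma vertex_low_degree n i (A : set T) (a b L Li eta lam omega eps y Y q : R) :
  (0 < i <= n)%N ->
  graph_history weight target 0 A -> A `<=` positive_weights weight ->
  (forall w, A w -> `|inv_weight_sum weight i n w - Li| <= eta) ->
  scales a b L Li eta lam omega eps -> Y = y + eps -> `|Y| * a <= b ->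
  q = (b + Y * a) * L / Li ->
  Pr P (A `&` [set w | q <= weight i w] `&`
     [set w | (in_degree target n i w)%:R <= m%:R * ((b + y * a) * L)]) <=
  expR (- (lam * eps / 2)) * tailW q.
Proof.
move=> i_n hA Apos HA sc YE Ya qE.
have [a0 b0 L0 /andP[LiL _] /andP[eta0 etaLi] baL bo lam0 th12 lo etaeps] := sc.
have i0 : (0 < i)%N by case/andP: i_n.
have mA : measurable A := history_measurable hA.
have mR0 : 0 < m%:R :> R by rewrite ltr0n.
have Li0 : 0 < Li by lra.
have q0 : 0 <= q.
  by rewrite qE divr_ge0 ?(ltW Li0)// mulr_ge0 ?(ltW L0)//; case: (perturbed_bounds a0 Ya).
pose th := lam / (m%:R * a * L).
have th0 : 0 < th by rewrite divr_gt0 ?mulr_gt0.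
have th1 : th <= 1 / 2 by [].
pose c := expR (- th) - 1.
have cth : c <= - th * (1 - th) by apply: expR_N_le; exact: ltW.
have c_le0 : c <= 0 by move: (c) (th) cth th0 th1 => *; nra.
have hB : graph_history weight target 0 (A `&` [set w | q <= weight i w]).
  rewrite (_ : [set w | _] = weight i @^-1` `[q, +oo[).
    by apply: history_setI => //; exact: history_weight_itv.
  by apply/seteqP; split => w /=; rewrite in_itv/= andbT.
have h := @conditional_chernoff _ _ _ _ _ _ _ _ wrg n i (- th) (c * (q * (Li - eta)))
  (m%:R * ((b + y * a) * L)) _
  [set w | (in_degree target n i w)%:R <= m%:R * ((b + y * a) * L)] i_n hB.
apply: le_trans (h _ _ _ _) _.
- by move=> w [/Apos].
- exact: (measurable_degree_itv n i (fun k => k%:R <= m%:R * ((b + y * a) * L))).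
- by move=> w /= hw; rewrite !mulNr lerN2 ler_wpM2l// ltW.
- move=> w [Aw /= qw]; have := HA _ Aw => /ler_normlP[h1 h2].
  have h3 : q * (Li - eta) <= weight i w * inv_weight_sum weight i n w.
    by apply: ler_pM => //; lra.
  rewrite -/c; exact: ler_wnM2l.
apply: ler_pM; rewrite ?expR_ge0 ?Pr_ge0//.
  rewrite ler_expR mulNr opprK.
  by apply: (@exponent_lower R m%:R a b L Li eta th y Y lam eps omega q c) => //; lra.
rewrite -(tail_weight q i0); apply: Pr_mono.
- exact: history_measurable hB.
- exact: measurable_ge.
- by move=> w [].
Qed.

Lemma sum_geometric_le (x : R) N : 0 <= x <= 1 / 2 -> \sum_(k < N) x ^+ k <= 2.
Proof.
move=> /andP[x0 x1].
have h : (1 - x) * \sum_(k < N) x ^+ k <= 1.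
  by rewrite -opprB mulNr -subrX1 opprB gerBl exprn_ge0.
have : 0 <= \sum_(k < N) x ^+ k by apply: sumr_ge0 => k _; rewrite exprn_ge0.
move: (\sum_(k < N) _) h => S *; nra.
Qed.

(** The weights just below the threshold [q] are cut into slices of width [a].
    Lowering the weight by one slice costs a factor [exp (- lam / 2)] in the
    conditional probability, which beats the factor [exp Lam] by which the
    number of vertices grows. *)
Lemma vertex_high_degree n i (A : set T) (a b L Li eta lam omega eps y Y q C0 Lam : R) :
  (0 < i <= n)%N ->
  graph_history weight target 0 A -> A `<=` positive_weights weight ->
  (forall w, A w -> `|inv_weight_sum weight i n w - Li| <= eta) ->
  scales a b L Li eta lam omega eps -> Y = y - eps ->
  16 * `|y| * a <= b -> 16 * `|Y| * a <= b ->
  q = (b + Y * a) * L / Li ->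
  0 <= C0 -> 0 <= Lam -> Lam + 1 <= lam / 2 ->
  (forall x, q / 2 <= x <= q -> tailW x <= C0 * expR (Lam * (q - x) / a) * tailW q) ->
  Pr P (A `&` [set w | weight i w < q] `&`
     [set w | m%:R * ((b + y * a) * L) < (in_degree target n i w)%:R]) <=
  expR (- (b * L / 25)) + 2 * C0 * expR Lam * expR (- (lam * eps / 2)) * tailW q.
Proof.
move=> i_n hA Apos HA sc YE ya Ya qE C00 Lam0 Lamlam ratio.
have [a0 b0 L0 /andP[LiL _] /andP[eta0 etaLi] baL bo lam0 th12 lo etaeps] := sc.
have i0 : (0 < i)%N by case/andP: i_n.
have mA : measurable A := history_measurable hA.
have mR0 : 0 < m%:R :> R by rewrite ltr0n.
have mR1 : 1 <= m%:R :> R by rewrite ler1n.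
have Li0 : 0 < Li by lra.
have Yab : `|Y| * a <= b.
  by apply: le_trans Ya; rewrite -mulrA ler_peMl ?mulr_ge0 ?(ltW a0)//; lra.
have bY : 0 < b + Y * a.
  have : `|Y| * a <= b / 16 by lra.
  by rewrite -[X in _ * X]gtr0_norm// -normrM => /ler_normlP[]; lra.
have q0 : 0 < q by rewrite qE divr_gt0// mulr_gt0.
pose thr := m%:R * ((b + y * a) * L).
pose E := [set w | thr < (in_degree target n i w)%:R].
have mE : measurable E by exact: (measurable_degree_itv n i (fun k => thr < k%:R)).
pose K := Li + eta.
have K0 : 0 < K by rewrite /K addr_gt0.
(* a weight below [x] on the event [A] forces a conditional mean below [x K] *)
have mean x c w : 0 <= c -> A w -> weight i w <= x ->
    c * (weight i w * inv_weight_sum weight i n w) <= c * (x * K).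
  move=> c0 Aw wx; apply: ler_wpM2l => //.
  have W0 := positive_weightsP (Apos _ Aw) i0.
  have := HA _ Aw => /ler_normlP[_ h2].
  apply: (@le_trans _ _ (weight i w * K)).
    by apply: ler_wpM2l; [exact: ltW|rewrite /K; lra].
  by apply: ler_wpM2r => //; exact: ltW.
(* [N] slices of width [a] below [q] reach down to the weight [0]. *)
pose N := (Num.truncn (q / a)).+1.
pose x_ k := Num.max (q / 2) (q - k.+1%:R * a).
pose B_ k := A `&` weight i @^-1` `[x_ k, q - k%:R * a].
have hB_ k : graph_history weight target 0 (B_ k).
  by apply: history_setI => //; exact: history_weight_itv.
pose far := A `&` weight i @^-1` `]-oo, q / 2[.
have hfar : graph_history weight target 0 far.
  by apply: history_setI => //; exact: history_weight_itv.
have mfar := history_measurable hfar.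
have mB_ k := history_measurable (hB_ k).
have far_le : Pr P (far `&` E) <= expR (- (b * L / 25)).
  pose c := expR (1 / 4) - 1 : R.
  have c0 : 0 <= c by rewrite subr_ge0 -[leLHS]expR0 ler_expR divr_ge0.
  have c1 : c <= 1 / 3.
    have e0 := expR_gt0 (1 / 4 : R).
    have : (1 - 1 / 4) * expR (1 / 4) <= 1 :> R.
      by rewrite -ler_pdivlMr// [leRHS]mul1r -expRN; exact: expR_ge1Dx.
    rewrite /c; lra.
  have h := @conditional_chernoff _ _ _ _ _ _ _ _ wrg n i (1 / 4) (c * (q / 2 * K))
    thr far E i_n hfar.
  apply: le_trans (h _ mE _ _) _.
  - by move=> w [/Apos].
  - by move=> w /= hw; rewrite ler_wpM2l// ltW.
  - by move=> w [Aw]; rewrite /= in_itv/= => wq; apply: mean => //; exact: ltW.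
  apply: (@le_trans _ _ (expR (- (b * L / 25)) * 1)); last by rewrite mulr1.
  apply: ler_pM; rewrite ?expR_ge0 ?Pr_ge0 ?Pr_le1// ler_expR.
  apply: (@exponent_far R m%:R a b L Li K eta y Y q c) => //.
  - by rewrite eta0.
  - by rewrite c0.
pose th := lam / (m%:R * a * L).
have th0 : 0 < th by rewrite divr_gt0 ?mulr_gt0.
pose c := expR th - 1.
have cth : c <= th * (1 + 2 * th) by apply: expR_m1_le; rewrite ltW.
have c0 : 0 <= c by rewrite subr_ge0 -expR0 ler_expR ltW.
have slice_le k : Pr P (B_ k `&` E) <=
    C0 * expR Lam * expR (- (lam * eps / 2)) * tailW q * (1 / 2) ^+ k.
  have [qk|qk] := ltP (q - k%:R * a) 0.
    have -> : B_ k `&` E = set0.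
      apply/seteqP; split => // w [[Aw]]; rewrite /= in_itv/= => /andP[_ h] _.
      by have := lt_le_trans (positive_weightsP (Apos _ Aw) i0) h; rewrite ltNge (ltW qk).
    by rewrite /Pr measure0 !mulr_ge0 ?expR_ge0 ?Pr_ge0 ?exprn_ge0.
  have h := @conditional_chernoff _ _ _ _ _ _ _ _ wrg n i th
    (c * ((q - k%:R * a) * K)) thr (B_ k) E i_n (hB_ k).
  apply: le_trans (h _ mE _ _) _.
  - by move=> w [/Apos].
  - by move=> w /= hw; rewrite ler_wpM2l// ltW.
  - by move=> w [Aw]; rewrite /= in_itv/= => /andP[_ wq]; exact: mean.
  have ex : m%:R * (c * ((q - k%:R * a) * K)) - th * thr <=
      - (lam * eps / 2) - lam * k%:R / 2.
    apply: (@exponent_upper R m%:R a b L Li K eta th y Y lam eps omega q k%:R c) => //.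
    by rewrite eta0/=; lra.
  have PB : Pr P (B_ k) <= C0 * expR (Lam * k.+1%:R) * tailW q.
    apply: (@le_trans _ _ (tailW (x_ k))).
      rewrite -(tail_weight _ i0); apply: Pr_mono => //; first exact: measurable_ge.
      by move=> w [_]; rewrite /= in_itv/= => /andP[].
    have x1 : q / 2 <= x_ k by rewrite le_max lexx.
    have x2 : q - k.+1%:R * a <= x_ k by rewrite le_max lexx orbT.
    have x3 : x_ k <= q.
      rewrite ge_max; apply/andP; split; first by rewrite ler_piMr ?(ltW q0)// invf_le1// ler1n.
      by rewrite gerBl mulr_ge0// ltW.
    apply: le_trans (ratio (x_ k) _) _; first by rewrite x1.
    rewrite ler_wpM2r ?Pr_ge0// ler_wpM2l// ler_expR -mulrA ler_wpM2l//.
    by rewrite ler_pdivrMr//; lra.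
  apply: le_trans (ler_pM (expR_ge0 _) (Pr_ge0 _ _)
    (_ : _ <= expR (- (lam * eps / 2) - lam * k%:R / 2)) PB) _.
    by rewrite ler_expR.
  have -> : expR (- (lam * eps / 2) - lam * k%:R / 2) * (C0 * expR (Lam * k.+1%:R) * tailW q) =
    C0 * expR Lam * expR (- (lam * eps / 2)) * tailW q * expR ((Lam - lam / 2) * k%:R).
    rewrite (_ : Lam * k.+1%:R = Lam + Lam * k%:R); last by rewrite mulrSr; ring.
    rewrite (_ : (Lam - lam / 2) * k%:R = Lam * k%:R + - (lam * k%:R / 2)); last by ring.
    by rewrite !expRD; ring.
  apply: ler_wpM2l; first by rewrite !mulr_ge0 ?expR_ge0 ?Pr_ge0.
  rewrite expRM_natr lerXn2r ?nnegrE ?expR_ge0//.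
  have h2 : 2 <= expR (lam / 2 - Lam).
    by apply: le_trans (expR_ge1Dx _); lra.
  by rewrite -(opprB (lam / 2)) expRN div1r lef_pV2 ?posrE ?expR_gt0.
have cover : A `&` [set w | weight i w < q] `&` E `<=`
    (far `&` E) `|` [set w | exists2 k, k \in index_iota 0 N & (B_ k `&` E) w].
  move=> w [[Aw /= wq] Ew].
  have [wq2|wq2] := ltP (weight i w) (q / 2).
    by left; split => //; split => //=; rewrite in_itv.
  right; have W0 := positive_weightsP (Apos _ Aw) i0.
  pose k := Num.truncn ((q - weight i w) / a).
  have qw0 : 0 <= (q - weight i w) / a by rewrite divr_ge0// ?subr_ge0 ltW.
  have /andP[k1 k2] := truncn_itv qw0.
  exists k.
    rewrite mem_index_iota /N ltnS /k le_truncn//.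
    by rewrite ler_wpM2r ?invr_ge0 ?(ltW a0)// gerBl ltW.
  split => //; split => //=; rewrite in_itv/= ge_max wq2/=.
  move: k1 k2; rewrite -/k ler_pdivlMr// ltr_pdivrMr// => k1 k2.
  move: (k.+1%:R * a) (k%:R * a) (weight i w) k1 k2 => p p2 x k1 k2.
  by apply/andP; split; lra.
have mbad k : measurable (B_ k `&` E) by exact: measurableI.
have mC : measurable [set w | exists2 k, k \in index_iota 0 N & (B_ k `&` E) w].
  rewrite [X in measurable X](_ : _ = \bigcup_(k in [set` index_iota 0 N]) (B_ k `&` E)).
    exact: bigcup_measurable.
  by apply/seteqP; split => w [k hk bk]; exists k.
have mF : measurable (far `&` E) by exact: measurableI.
have mev : measurable (A `&` [set w | weight i w < q] `&` E).
  apply: measurableI => //; apply: measurableI => //.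
  rewrite (_ : [set w | _] = weight i @^-1` `]-oo, q[); first exact: measurable_funPTI.
  by apply/seteqP; split => w /=; rewrite in_itv.
apply: le_trans (Pr_mono P mev _ cover) _; first exact: measurableU.
apply: le_trans (Pr_setU P mF mC) _; apply: lerD => //.
apply: (@le_trans _ _ (\sum_(0 <= k < N) Pr P (B_ k `&` E))); first exact: Pr_bigcup.
apply: le_trans (ler_sum _ (fun k _ => slice_le k)) _.
rewrite -mulr_sumr big_mkord.
have g2 : \sum_(k < N) (1 / 2 : R) ^+ k <= 2.
  by apply: sum_geometric_le; lra.
have := ler_wpM2l (_ : 0 <= C0 * expR Lam * expR (- (lam * eps / 2)) * tailW q) g2.
move=> /(_ _) h; apply: le_trans (h _) _; first by rewrite !mulr_ge0 ?expR_ge0 ?Pr_ge0.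
by rewrite le_eqVlt; apply/orP; left; apply/eqP; ring.
Qed.
End SingleVertex.

(** * The common asymptotic regime *)

Lemma sum_nat_subinterval (R : realType) (F : nat -> R) (A B n : nat) :
  (A <= B)%N -> (B <= n)%N ->
  \sum_(1 <= i < n.+1 | (A < i)%N && (i <= B)%N) F i = \sum_(A.+1 <= i < B.+1) F i.
Proof.
move=> AB Bn; rewrite (@big_cat_nat _ _ _ A.+1)//=; last by rewrite ltnS (leq_trans AB).
rewrite big_nat_cond big1 ?add0r; last by move=> i /andP[/andP[_ iA] /andP[Ai _]]; lia.
rewrite (@big_cat_nat _ _ _ B.+1)//=.
rewrite [X in _ + X]big_nat_cond [X in _ + X]big1 ?addr0; last first.
  by move=> i /andP[/andP[iB _] /andP[_ Bi]]; lia.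
by rewrite big_nat_cond [RHS]big_nat; apply: eq_bigl => i; lia.
Qed.

(** Rounding the ends of the block costs at most [1 / (alpha rho)] at each end. *)
Lemma harmonic_block (R : realType) (alpha beta rho : R) (n : nat) :
  0 < alpha -> alpha < beta -> 0 < rho -> beta * rho <= n%:R ->
  `|\sum_(1 <= i < n.+1 | (alpha * rho < i%:R) && (i%:R <= beta * rho)) i%:R^-1
     - ln (beta / alpha)| <= 2 / (alpha * rho).
Proof.
move=> al0 alb rho0 brn.
have be0 : 0 < beta by exact: lt_trans alb.
have ar0 : 0 < alpha * rho by rewrite mulr_gt0.
have br0 : 0 < beta * rho by rewrite mulr_gt0.
pose A := Num.truncn (alpha * rho); pose B := Num.truncn (beta * rho).
have /andP[A1 A2] := truncn_itv (ltW ar0).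
have /andP[B1 B2] := truncn_itv (ltW br0).
have AB : (A <= B)%N by apply: le_truncn; rewrite ler_wpM2r// ltW.
have Bn : (B <= n)%N by rewrite -(ler_nat R) (le_trans B1).
have gtA i : (alpha * rho < i%:R) = (A < i)%N.
  rewrite ltNge [RHS]ltnNge; congr (~~ _); apply/idP/idP => [h|h].
    by rewrite -(natrK (R := R) i) /A le_truncn.
  by apply: le_trans A1; rewrite ler_nat.
have leB i : (i%:R <= beta * rho) = (i <= B)%N.
  apply/idP/idP => [h|h].
    by rewrite -(natrK (R := R) i) /B le_truncn.
  by apply: le_trans B1; rewrite ler_nat.
have -> : \sum_(1 <= i < n.+1 | (alpha * rho < i%:R) && (i%:R <= beta * rho)) i%:R^-1 =
    \sum_(A.+1 <= i < B.+1) i%:R^-1 :> R.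
  under eq_bigl do rewrite gtA leB.
  exact: sum_nat_subinterval.
have /andP[h1 h2] := @harmonic_ln_bounds R A.+1 B.+1 AB.
have AS0 : 0 < A.+1%:R :> R by rewrite ltr0n.
have BS0 : 0 < B.+1%:R :> R by rewrite ltr0n.
have lnE x y : 0 < x -> 0 < y -> ln (x / y) = ln x - ln y :> R.
  by move=> x0 y0; rewrite ln_div.
rewrite lnE// in h1 h2; rewrite lnE//.
have lnmul x y : 0 < x -> 0 < y -> ln (x * y) = ln x + ln y :> R.
  by move=> x0 y0; rewrite lnM.
have i1 : ln (beta * rho) <= ln (B.+1%:R : R) by rewrite ler_ln ?posrE// ltW.
have i2 : ln (alpha * rho) <= ln (A.+1%:R : R) by rewrite ler_ln ?posrE// ltW.
have up x k : 0 < x -> k%:R <= x -> ln (k.+1%:R) <= ln x + x^-1 :> R.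
  move=> x0 kx; apply: (@le_trans _ _ (ln (x * (1 + x^-1)))).
    by rewrite ler_ln ?posrE ?mulr_gt0 ?addr_gt0 ?invr_gt0// mulrDr mulr1 divff ?gt_eqF// mulrSr lerD2r.
  rewrite lnmul ?addr_gt0 ?invr_gt0// lerD2l le_ln1Dx//.
  by rewrite (lt_trans _ (_ : 0 < x^-1)) ?invr_gt0// ltrN10.
have i3 := up _ _ br0 B1; have i4 := up _ _ ar0 A1.
have i5 : (A.+1%:R : R)^-1 <= (alpha * rho)^-1 by rewrite lef_pV2 ?posrE// ltW.
have i6 : (beta * rho)^-1 <= (alpha * rho)^-1.
  by rewrite lef_pV2 ?posrE//; apply: ler_wpM2r; exact: ltW.
rewrite !lnmul// in i1 i2 i3 i4.
rewrite ler_norml; move: i1 i2 i3 i4 i5 i6 h1 h2.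
move: (alpha * rho)^-1 (beta * rho)^-1 (ln alpha) (ln beta) (ln rho) (_.+1%:R^-1) => z1 z2 z3 z4 z5 z6.
move: (\sum_(_ <= _ < _) _) (ln (A.+1%:R)) (ln (B.+1%:R)) => z7 z8 z9 *.
apply/andP; split; lra.
Qed.

(** The precision [eta = eps / 32] and [omega = eps / (32 lam)] are the values for which the
    two smallness conditions of [scales] become equalities. *)
Lemma scales_of_ratios (R : realType) (m : nat) (a b L D v V lam eps : R) :
  (0 < m)%N -> 0 < a -> 1 < L -> 8 * V < L -> eps < L -> 0 < lam -> 0 < eps ->
  7 / 8 * L < D -> D < 9 / 8 * L -> 1 / 2 * (a * L) < b -> b < 2 * (a * L) ->
  b < eps / (32 * lam) * (a ^+ 2 * L) -> b < 1 / (4 * lam) * (a ^+ 2 * L) ->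
  - V <= v <= V ->
  scales m a b L (D - v) (eps / 32) lam (eps / (32 * lam)) eps.
Proof.
move=> m0 a0 L1 LV Le lam0 eps0 r1 r2 b1 b2 c1 c2 /andP[v1 v2].
have m1 : 1 <= m%:R :> R by rewrite ler1n.
have L0 : 0 < L by exact: lt_trans L1.
have aL0 : 0 < a * L by rewrite mulr_gt0.
have aaL0 : 0 < a ^+ 2 * L by rewrite mulr_gt0// exprn_gt0.
have om0 : 0 < eps / (32 * lam) by rewrite divr_gt0// mulr_gt0.
have b0 : 0 < b by lra.
have a_lam : 2 * lam <= a.
  have : 1 / 2 * (a * L) * (4 * lam) < a ^+ 2 * L.
    have h4 : 0 < 4 * lam by rewrite mulr_gt0.
    apply: (@lt_trans _ _ (b * (4 * lam))); first by rewrite ltr_pM2r.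
    rewrite -(ltr_pM2r h4) in c2; apply: lt_le_trans c2 _.
    by rewrite le_eqVlt; apply/orP; left; apply/eqP; field; rewrite gt_eqF.
  rewrite expr2 -!mulrA => h.
  have : a * L * (2 * lam) < a * L * a by lra.
  by rewrite ltr_pM2l// => /ltW.
split => //.
- by apply/andP; split; lra.
- by apply/andP; split; lra.
- by lra.
- apply: (le_trans (ltW c1)); rewrite ler_wpM2l ?(ltW om0)// -[leRHS]mulrA ler_peMl// ltW//.
- rewrite ler_pdivrMr ?mulr_gt0 ?ltr0n// -mulrA.
  have : 2 * lam <= a * L by apply: le_trans a_lam _; rewrite ler_peMr// ltW.
  have : a * L <= m%:R * (a * L) by rewrite ler_peMl// ltW.
  lra.
- rewrite le_eqVlt; apply/orP; left; apply/eqP; field; by rewrite gt_eqF.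
- lra.
Qed.

Lemma ln_window (R : realType) (s t v : R) : 0 < s -> s <= v <= t ->
  `|ln v| <= `|ln s| + `|ln t|.
Proof.
move=> s0 /andP[sv vt]; have v0 := lt_le_trans s0 sv.
have h1 : ln s <= ln v by rewrite ler_ln// posrE.
have h2 : ln v <= ln t by rewrite ler_ln// posrE (lt_le_trans v0).
rewrite ler_norml lerNl; apply/andP; split.
  apply: (@le_trans _ _ `|ln s|); last by rewrite lerDl.
  by rewrite -[`|ln s|]normrN; apply: le_trans (ler_norm _); rewrite lerN2.
apply: (@le_trans _ _ `|ln t|); last by rewrite lerDr.
exact: le_trans h2 (ler_norm _).
Qed.

Section Regime.
Context (R : realType) (d : measure_display) (T : measurableType d)
  (P : probability T R) (W : {RV P >-> R}).

(** The weight for which the conditional mean degree of the vertex [v r] equals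
    [m (b + y a) L], as [ln n - ln r - ln v] is the logarithm of [n / (v r)]. *)
Definition weight_level (b a L ell y v : R) : R := (b + y * a) * L / (ell - ln v).

(** What the two cases have in common. Vertices of age about [r n] are
    considered; [b n] and [a n] centre and normalise the weights, and [L n] is
    the leading order of [ln (n / i)]. The weight of vertex [v * r n] has to
    exceed [weight_level] for its mean degree to exceed [m (b + y a) L]. *)
Record regime (s t kappa C0 Lam : R) (r a b L : nat -> R) : Prop := Regime {
  regime_r : r n @[n --> \oo] --> +oo ;
  regime_rn : \forall n \near \oo, t * r n <= n%:R ;
  regime_a : \forall n \near \oo, 0 < a n ;
  regime_L : L n @[n --> \oo] --> +oo ;
  regime_Lln : (ln n%:R - ln (r n)) / L n @[n --> \oo] --> (1 : R) ;
  regime_baL : b n / (a n * L n) @[n --> \oo] --> (1 : R) ;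
  regime_baaL : b n / (a n ^+ 2 * L n) @[n --> \oo] --> (0 : R) ;
  regime_ab : a n / b n @[n --> \oo] --> (0 : R) ;
  regime_bL : b n * L n / ln n%:R @[n --> \oo] --> +oo ;
  regime_tail : forall y e : R, 0 < e -> \forall n \near \oo, forall v, s <= v <= t ->
    `|r n * v * tailW W (weight_level (b n) (a n) (L n) (ln n%:R - ln (r n)) y v)
       - kappa * expR (- y)| <= e ;
  regime_ratio : \forall n \near \oo, forall q x,
    b n / 2 <= q <= 2 * b n -> q / 2 <= x <= q ->
    tailW W x <= C0 * expR (Lam * (q - x) / a n) * tailW W q }.

Lemma near_gt (u : nat -> R) (l c : R) : u n @[n --> \oo] --> l -> c < l ->
  \forall n \near \oo, c < u n.
Proof. by move=> ul cl; apply: (cvgr_gt l). Qed.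

Lemma near_lt (u : nat -> R) (l c : R) : u n @[n --> \oo] --> l -> l < c ->
  \forall n \near \oo, u n < c.
Proof. by move=> ul cl; apply: (cvgr_lt l). Qed.

Lemma near_large (u : nat -> R) (c : R) : u n @[n --> \oo] --> +oo ->
  \forall n \near \oo, c < u n.
Proof. by move=> /cvgryPgt; exact. Qed.

(** The conditions of [scales] only compare quantities whose ratios converge, uniformly over
    the window because [ln v] is bounded. *)
Lemma regime_scales (m : nat) (s t kappa C0 Lam : R) (r a b L : nat -> R)
    (lam eps : R) :
  (0 < m)%N -> 0 < s -> regime s t kappa C0 Lam r a b L -> 0 < lam -> 0 < eps ->
  \forall n \near \oo, forall v, s <= v <= t ->
    scales m (a n) (b n) (L n) (ln n%:R - ln (r n) - ln v)
      (eps / 32) lam (eps / (32 * lam)) eps.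
Proof.
move=> m0 s0 reg lam0 eps0.
have m1 : 1 <= m%:R :> R by rewrite ler1n.
pose V := `|ln s| + `|ln t|.
have [_ _ Ha HL HLr Hba Hbaa _ _ _ _] := reg.
have om0 : 0 < eps / (32 * lam) by rewrite divr_gt0// mulr_gt0.
have om1 : 0 < 1 / (4 * lam) by rewrite divr_gt0// mulr_gt0.
near=> n => v /andP[sv vt].
have an : 0 < a n by near: n.
have L1 : 1 < L n by near: n; exact: near_large.
have LV : 8 * V < L n by near: n; exact: near_large.
have Le : eps < L n by near: n; exact: near_large.
have r1 : 7 / 8 < (ln n%:R - ln (r n)) / L n by near: n; apply: near_gt HLr _; lra.
have r2 : (ln n%:R - ln (r n)) / L n < 9 / 8 by near: n; apply: near_lt HLr _; lra.
have b1 : 1 / 2 < b n / (a n * L n) by near: n; apply: near_gt Hba _; lra.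
have b2 : b n / (a n * L n) < 2 by near: n; apply: near_lt Hba _; lra.
have c1 : b n / (a n ^+ 2 * L n) < eps / (32 * lam) by near: n; exact: near_lt Hbaa _.
have c2 : b n / (a n ^+ 2 * L n) < 1 / (4 * lam) by near: n; exact: near_lt Hbaa _.
have L0 : 0 < L n by exact: lt_trans L1.
have aL0 : 0 < a n * L n by rewrite mulr_gt0.
have aaL0 : 0 < a n ^+ 2 * L n by rewrite mulr_gt0// exprn_gt0.
rewrite ltr_pdivlMr// in r1; rewrite ltr_pdivrMr// in r2.
rewrite ltr_pdivlMr// in b1; rewrite ltr_pdivrMr// in b2.
rewrite ltr_pdivrMr// in c1; rewrite ltr_pdivrMr// in c2.
have v0 : 0 < v by exact: lt_le_trans sv.
have lnv : - V <= ln v <= V by rewrite -ler_norml; apply: (ln_window s0); rewrite sv vt.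
exact: (@scales_of_ratios R m (a n) (b n) (L n) _ _ V).
Unshelve. all: by end_near. Qed.
End Regime.

(** * Exceedances of the weights *)

Definition in_window (R : realType) (s t rho : R) (n i : nat) : bool :=
  (0 < i <= n)%N && (s * rho <= i%:R <= t * rho).

(** Half-open, so that the blocks of a subdivision are disjoint. *)
Definition in_block (R : realType) (u u' rho : R) (i : nat) : bool :=
  u * rho < i%:R <= u' * rho.

Definition level (R : realType) (u u' rho y y' : R) (i : nat) : R :=
  if in_block u u' rho i then y' else y.

Section WindowSums.
Context (R : realType) (s t : R) (r : nat -> R).

Lemma block_sum_cvg u u' : 0 < s -> s <= u -> u < u' -> u' <= t ->
  r n @[n --> \oo] --> +oo -> (\forall n \near \oo, t * r n <= n%:R) ->
  \sum_(1 <= i < n.+1 | in_window s t (r n) n i && in_block u u' (r n) i) i%:R^-1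
    @[n --> \oo] --> ln (u' / u).
Proof.
move=> s0 su uu' u't rc rn; have u0 : 0 < u by exact: lt_le_trans su.
apply/cvgrPdist_le => e e0; near=> n.
have r0 : 0 < r n by near: n; exact: near_large.
have rn' : t * r n <= n%:R by near: n.
have re : 2 / (u * e) < r n by near: n; exact: near_large.
have u'n : u' * r n <= n%:R by apply: le_trans rn'; rewrite ler_wpM2r// ltW.
rewrite big_nat_cond.
rewrite (eq_bigl (fun i => (1 <= i < n.+1)%N && ((u * r n < i%:R) && (i%:R <= u' * r n)))); last first.
  move=> i; rewrite /in_window /in_block.
  case: (ltP (u * r n)) => ui; rewrite ?andbF//=.
  case: (leP i%:R (u' * r n)) => u'i; rewrite ?andbF//= !andbT.
  rewrite ltnS andbA andbb; case: (boolP (0 < i <= n)%N) => //= _.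
  rewrite (le_trans u'i) ?ler_wpM2r ?(ltW r0)// andbT.
  by rewrite (le_trans _ (ltW ui))// ler_wpM2r// ltW.
rewrite -big_nat_cond distrC.
apply: le_trans (harmonic_block u0 uu' r0 u'n) _.
have : 2 < r n * (u * e) by rewrite -ltr_pdivrMr ?mulr_gt0.
by rewrite ler_pdivrMr ?mulr_gt0//; lra.
Unshelve. all: by end_near. Qed.

Lemma window_sum_cvg : 0 < s -> s < t ->
  r n @[n --> \oo] --> +oo -> (\forall n \near \oo, t * r n <= n%:R) ->
  \sum_(1 <= i < n.+1 | in_window s t (r n) n i) i%:R^-1 @[n --> \oo] --> ln (t / s).
Proof.
move=> s0 st rc rn.
have h := @block_sum_cvg s t s0 (lexx s) st (lexx t) rc rn.
(* only a vertex sitting exactly at the left end may be missed by the block *)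
suff : (\sum_(1 <= i < n.+1 | in_window s t (r n) n i && ~~ in_block s t (r n) i) i%:R^-1
    : R) @[n --> \oo] --> (0 : R).
  move=> /(cvgD h); rewrite addr0; apply: cvg_trans; apply: near_eq_cvg.
  by near=> n; rewrite [RHS](bigID (in_block s t (r n))).
apply/cvgrPdist_le => e e0; near=> n.
have r0 : 0 < r n by near: n; exact: near_large.
have re : (s * e)^-1 < r n by near: n; exact: near_large.
rewrite sub0r normrN ger0_norm; last first.
  by apply: sumr_ge0 => i _; rewrite invr_ge0.
have sr0 : 0 < s * r n by rewrite mulr_gt0.
have only i : in_window s t (r n) n i && ~~ in_block s t (r n) i ->
    (i == Num.truncn (s * r n)) && (i%:R == s * r n).
  rewrite /in_window /in_block => /andP[/andP[_ /andP[h1 h2]]].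
  rewrite h2 andbT -leNgt => h3.
  have E : i%:R = s * r n by apply/eqP; rewrite eq_le h1 h3.
  by rewrite -E natrK !eqxx.
apply: (@le_trans _ _ (s * r n)^-1); last first.
  by rewrite invf_ple ?posrE// (le_trans _ (_ : s * (s * e)^-1 <= _)) ?ler_wpM2l ?(ltW s0) ?(ltW re)//
    invfM mulrA divff ?gt_eqF// mul1r.
apply: (@le_trans _ _ (\sum_(1 <= i < n.+1 | i == Num.truncn (s * r n)) (s * r n)^-1)).
  rewrite big_mkcond [leRHS]big_mkcond; apply: ler_sum => i _.
  case: ifPn => [/only/andP[-> /eqP ->]//|_].
  by case: ifPn => // _; rewrite invr_ge0 ltW.
rewrite big_const_seq iter_addr addr0 (count_uniq_mem _ (iota_uniq _ _)).
by case: (_ \in _) => //=; rewrite mulr0n invr_ge0 ltW.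
Unshelve. all: by end_near. Qed.

End WindowSums.

Section EngineLimit.
Context (R : realType) (d : measure_display) (T : measurableType d)
  (P : probability T R) (m : nat) (W : {RV P >-> R})
  (weight : nat -> {RV P >-> R}) (target : nat -> 'I_m -> {RV P >-> nat})
  (wrg : weighted_recursive_graph W weight target) (m_gt0 : (0 < m)%N).

Lemma Pr_weights_below (J : seq nat) (q : nat -> R) : uniq J ->
  (forall i, i \in J -> (0 < i)%N) ->
  Pr P [set w | forall i, i \in J -> weight i w < q i] =
  \prod_(i <- J) (1 - tailW W (q i)).
Proof.
move=> uJ J0.
have E i : (0 < i)%N -> P (weight i @^-1` `]-oo, q i[) = (1 - tailW W (q i))%:E.
  move=> i0; rewrite -(tail_weight wrg _ i0) -Pr_setC; last exact: measurable_ge.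
  rewrite -PrE; last by apply: measurableC; exact: measurable_ge.
  congr (P _); apply/seteqP; split => w /=; rewrite in_itv/=.
    by move=> h; apply/negP; rewrite -ltNge.
  by move=> /negP; rewrite -ltNge.
have := @wrg_weight_independent _ _ _ _ _ _ _ _ wrg J (fun i => `]-oo, q i[%classic) uJ.
move=> /(_ _ _) h; apply: EFin_inj.
rewrite -prodEFin -PrE; last first.
  rewrite (_ : [set w | _] = \bigcap_(i in [set` J]) (weight i @^-1` `]-oo, q i[)).
    by apply: bigcap_measurableType => i _; exact: measurable_funPTI.
  by apply/seteqP; split => w h1 i /= iJ; have := h1 i iJ; rewrite /= in_itv.
transitivity (\prod_(i <- J) P (weight i @^-1` `]-oo, q i[))%E; last first.
  by apply: eq_big_seq => i iJ; rewrite E// J0.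
rewrite -h//.
Qed.

(** The probability is the product of [1 - p_i], where [i p_i] converges uniformly over the
    window to [kappa] times the exponential of minus the level. The sum of the [p_i] thus
    converges, and the product is close to the exponential of minus that sum. *)
Lemma weights_below_cvg (s t kappa C0 Lam : R) (r a b L : nat -> R)
    (u u' y y' x : R) :
  0 < s -> s <= u -> u < u' -> u' <= t ->
  regime W s t kappa C0 Lam r a b L ->
  Pr P [set w | forall i, in_window s t (r n) n i ->
      weight i w < weight_level (b n) (a n) (L n) (ln n%:R - ln (r n))
        (level u u' (r n) y y' i + x) (i%:R / r n)] @[n --> \oo] -->
  expR (- (kappa * (expR (- y) * ln (t / s)
       + (expR (- y') - expR (- y)) * ln (u' / u)) * expR (- x))).
Proof.
move=> s0 su uu' u't reg.
have [rc rn _ _ _ _ _ _ _ Htail _] := reg.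
have st : s < t by apply: lt_le_trans u't; exact: le_lt_trans uu'.
pose q n i := weight_level (b n) (a n) (L n) (ln n%:R - ln (r n))
        (level u u' (r n) y y' i + x) (i%:R / r n).
pose p n i := tailW W (q n i).
pose J n := [seq i <- index_iota 1 n.+1 | in_window s t (r n) n i].
pose sig n := \sum_(i <- J n) p n i.
pose H n : R := \sum_(1 <= i < n.+1 | in_window s t (r n) n i) i%:R^-1.
pose Hb n : R := \sum_(1 <= i < n.+1 | in_window s t (r n) n i && in_block u u' (r n) i) i%:R^-1.
have HH : H n @[n --> \oo] --> ln (t / s) by exact: window_sum_cvg.
have HHb : Hb n @[n --> \oo] --> ln (u' / u) by exact: block_sum_cvg.
pose Lm n := kappa * (expR (- y) * H n + (expR (- y') - expR (- y)) * Hb n) * expR (- x).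
have HLm : Lm n @[n --> \oo] --> kappa * (expR (- y) * ln (t / s)
       + (expR (- y') - expR (- y)) * ln (u' / u)) * expR (- x).
  apply: cvgMl; apply: cvgMr; apply: cvgD; exact: cvgMr.
have tail_near e : 0 < e -> \forall n \near \oo, forall i, in_window s t (r n) n i ->
    `|i%:R * p n i - kappa * expR (- (level u u' (r n) y y' i + x))| <= e.
  move=> e0; near=> n => i win.
  have r0 : 0 < r n by near: n; exact: near_large.
  have win' := win; move: win' => /andP[_ /andP[i1 i2]].
  have hv : s <= i%:R / r n <= t by rewrite ler_pdivlMr// ler_pdivrMr// i1.
  have iE : r n * (i%:R / r n) = i%:R by rewrite mulrC divfK// gt_eqF.
  have at_y z : (forall v, s <= v <= t -> `|r n * v * tailW W (weight_level (b n) (a n)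
       (L n) (ln n%:R - ln (r n)) (z + x) v) - kappa * expR (- (z + x))| <= e) ->
     `|i%:R * tailW W (weight_level (b n) (a n) (L n) (ln n%:R - ln (r n)) (z + x)
       (i%:R / r n)) - kappa * expR (- (z + x))| <= e.
    by move=> /(_ _ hv); rewrite iE.
  rewrite /p /q /level; case: ifPn => _; apply: at_y; near: n; exact: Htail.
have LmE n : Lm n = \sum_(i <- J n) kappa * expR (- (level u u' (r n) y y' i + x)) / i%:R.
  rewrite /J big_filter.
  rewrite (eq_bigr (fun i => kappa * expR (- y) * expR (- x) * i%:R^-1 +
     (if in_block u u' (r n) i
      then kappa * (expR (- y') - expR (- y)) * expR (- x) * i%:R^-1 else 0))).
    rewrite big_split/= -big_mkcondr/= -!mulr_sumr /Lm /H /Hb; ring.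
  by move=> i _; rewrite /level opprD expRD; case: ifPn => _; ring.
have sigL : sig n - Lm n @[n --> \oo] --> (0 : R).
  apply/cvgrPdist_le => e e0.
  have K0 : 0 < ln (t / s) + 1 by rewrite ltr_wpDl// ln_ge0// ler_pdivlMr// mul1r ltW.
  near=> n.
  have Hn : H n < ln (t / s) + 1 by near: n; apply: near_lt HH _; rewrite ltrDl.
  have tn : forall i, in_window s t (r n) n i ->
    `|i%:R * p n i - kappa * expR (- (level u u' (r n) y y' i + x))| <= e / (ln (t / s) + 1).
    by near: n; apply: tail_near; rewrite divr_gt0.
  rewrite sub0r normrN /sig LmE -sumrB.
  apply: le_trans (ler_norm_sum _ _ _) _.
  apply: (@le_trans _ _ (e / (ln (t / s) + 1) * H n)); last first.
    rewrite mulrAC ler_pdivrMr// ler_wpM2l//; exact: ltW.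
  rewrite /H mulr_sumr /J big_filter; apply: ler_sum => i win.
  have i0 : 0 < i%:R :> R by case/andP: win => /andP[]; rewrite ltr0n.
  rewrite ler_pdivlMr// -[X in _ * X <= _](ger0_norm (ltW i0)) -normrM.
  by rewrite mulrBl divfK ?gt_eqF// (mulrC (p n i)); exact: tn.
have Hsig : sig n @[n --> \oo] --> kappa * (expR (- y) * ln (t / s)
       + (expR (- y') - expR (- y)) * ln (u' / u)) * expR (- x).
  rewrite -[X in _ --> X]add0r.
  under eq_cvg => n do rewrite -(subrK (Lm n) (sig n)).
  exact: cvgD.
pose C := `|kappa| * (expR (- (y + x)) + expR (- (y' + x))) + 1.
have C0' : 0 < C by rewrite ltr_wpDl// mulr_ge0 ?addr_ge0 ?expR_ge0.
pose pm n := C / (s * r n).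
have pm0 : pm n @[n --> \oo] --> (0 : R).
  apply/cvgrPdist_le => e e0; near=> n.
  have rn' : C / (s * e) < r n by near: n; exact: near_large.
  have r0 : 0 < r n by near: n; exact: near_large.
  rewrite sub0r normrN ger0_norm; last by rewrite divr_ge0 ?mulr_ge0 ?ltW.
  rewrite ltr_pdivrMr ?mulr_gt0// in rn'.
  by rewrite ler_pdivrMr ?mulr_gt0//; lra.
have p_le : \forall n \near \oo, forall i, i \in J n -> 0 <= p n i <= pm n.
  near=> n => i; rewrite mem_filter => /andP[win _].
  have r0 : 0 < r n by near: n; exact: near_large.
  have tn : forall i, in_window s t (r n) n i ->
    `|i%:R * p n i - kappa * expR (- (level u u' (r n) y y' i + x))| <= 1.
    by near: n; exact: tail_near.
  rewrite Pr_ge0/= /pm ler_pdivlMr ?mulr_gt0//.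
  apply: (@le_trans _ _ (i%:R * p n i)).
    by rewrite mulrC ler_wpM2r ?Pr_ge0//; case/andP: win => _ /andP[].
  have := tn _ win => /ler_normlP[_ h].
  rewrite /C -lerBlDr; apply: (@le_trans _ _ (kappa * expR (- (level u u' (r n) y y' i + x)))).
    by lra.
  apply: (@le_trans _ _ (`|kappa| * expR (- (level u u' (r n) y y' i + x)))).
    by rewrite ler_wpM2r ?expR_ge0 ?ler_norm.
  rewrite ler_wpM2l// /level; case: ifPn => _; rewrite ?lerDl ?lerDr expR_ge0//.
have PrE_ n : Pr P [set w | forall i, in_window s t (r n) n i -> weight i w < q n i] =
    \prod_(i <- J n) (1 - p n i).
  rewrite -Pr_weights_below ?filter_uniq ?iota_uniq//; last first.
    by move=> i; rewrite mem_filter mem_index_iota => /andP[_ /andP[]].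
  congr (Pr P _); apply/seteqP; split => w h i.
    by rewrite mem_filter => /andP[win _]; exact: h.
  move=> win; apply: h; rewrite mem_filter win mem_index_iota.
  by case/andP: win => /andP[-> ]; rewrite ltnS.
under eq_cvg do rewrite PrE_.
apply: (@squeeze_cvgr _ _ _ _ (fun n => expR (- ((1 + 2 * pm n) * sig n)))
    (fun n => expR (- sig n))).
- near=> n; apply: prod_onem_bounds.
    by near: n; apply: filterS (near_lt pm0 (_ : 0 < 1 / 2)) => [n /ltW//|]; lra.
  by near: n; exact: p_le.
- apply: continuous_cvg; first exact: continuous_expR.
  apply: cvgN; rewrite -[X in _ --> X]mul1r; apply: cvgM => //.
  rewrite -[X in _ --> X]addr0; apply: cvgD; first exact: cvg_cst.
  by rewrite -[X in _ --> X](mulr0 2); apply: cvgMr.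
- apply: continuous_cvg; first exact: continuous_expR.
  exact: cvgN.
Unshelve. all: by end_near. Qed.
End EngineLimit.

(** * Exceedances of the degrees *)

Section DegreeLimitArithmetic.
Context (R : realType).
Implicit Types (x y z : R).

(** The free parameter [lam] of the exponential inequality is chosen here, once the number
    of vertices that may be exceptional is known. *)
Lemma large_exponent (Lam eps B e : R) : 0 <= Lam -> 0 < eps -> 0 < B -> 0 < e ->
  exists lam, [/\ 0 < lam, Lam + 1 <= lam / 2 & B * expR (- (lam * eps / 2)) <= e].
Proof.
move=> Lam0 eps0 B0 e0.
pose X := B / e.
have X0 : 0 < X by rewrite divr_gt0.
have X1 : 0 < X / eps by rewrite divr_gt0.
exists (2 * (Lam + 1) + 2 * (X / eps)); split; [lra|lra|].
set lam := _ + _.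
have h1 : X <= lam * eps / 2.
  have -> : lam * eps / 2 = (Lam + 1) * eps + X by rewrite /lam; field; rewrite gt_eqF.
  by rewrite lerDr mulr_ge0 ?(ltW eps0)//; lra.
have h2 : X <= expR (lam * eps / 2).
  by apply: le_trans (expR_ge1Dx _); lra.
rewrite expRN ler_pdivrMr ?expR_gt0//.
apply: le_trans (ler_wpM2l _ h2); last exact: ltW.
by rewrite /X mulrC divfK ?gt_eqF.
Qed.

Lemma sandwich_le (f0 f1 f2 p p1 p2 e : R) :
  `|f0 - f1| <= e / 4 -> `|f0 - f2| <= e / 4 ->
  p <= p1 + (e / 8 + e / 8) -> p2 <= p + (e / 8 + (e / 8 + e / 8)) ->
  `|f1 - p1| <= e / 8 -> `|f2 - p2| <= e / 8 -> `|f0 - p| <= e.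
Proof.
rewrite !ler_norml => /andP[? ?] /andP[? ?] ? ? /andP[? ?] /andP[? ?].
by apply/andP; split; lra.
Qed.

Lemma weight_level_range (m : nat) (a b L ell eta lam omega eps Y v : R) :
  scales m a b L (ell - ln v) eta lam omega eps -> 16 * `|Y| * a <= b ->
  b / 2 <= weight_level b a L ell Y v <= 2 * b.
Proof.
move=> [a0 b0 L0 /andP[l1 l2] _ _ _ _ _ _ _] Y16.
have : `|Y * a| <= b / 16 by rewrite normrM (gtr0_norm a0); lra.
move=> /ler_normlP[h1 h2].
have Li0 : 0 < ell - ln v by lra.
rewrite /weight_level ler_pdivlMr// ler_pdivrMr//.
by apply/andP; split; nra.
Qed.

Lemma scaled_le (z Z a b : R) : 0 <= a -> `|z| <= Z -> 16 * Z * a <= b ->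
  16 * `|z| * a <= b.
Proof. by move=> a0 zZ; apply: le_trans; rewrite ler_wpM2r// ler_wpM2l. Qed.

Lemma scaled_le1 (z Z a b : R) : 0 <= a -> `|z| <= Z -> 16 * Z * a <= b ->
  `|z| * a <= b.
Proof.
move=> a0 zZ /(scaled_le a0 zZ); apply: le_trans.
have : 0 <= `|z| * a by rewrite mulr_ge0.
lra.
Qed.

End DegreeLimitArithmetic.

Section RegimeTails.
Context (R : realType) (d : measure_display) (T : measurableType d)
  (P : probability T R) (W : {RV P >-> R}).

(** Uniform in the shift [x], so that it applies on both sides of the level. *)
Lemma window_tail_le (s t kappa C0 Lam : R) (r a b L : nat -> R) (u u' y y' x : R) :
  0 < s -> regime W s t kappa C0 Lam r a b L -> `|x| <= 1 ->
  \forall n \near \oo, forall i, in_window s t (r n) n i ->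
    tailW W (weight_level (b n) (a n) (L n) (ln n%:R - ln (r n))
        (level u u' (r n) y y' i + x) (i%:R / r n)) <=
    (`|kappa| * (expR (`|y| + 1) + expR (`|y'| + 1)) + 1) / i%:R.
Proof.
move=> s0 [rc _ _ _ _ _ _ _ _ Htail _] x1; near=> n => i win.
have r0 : 0 < r n by near: n; exact: near_large.
have t1 : forall v, s <= v <= t ->
    `|r n * v * tailW W (weight_level (b n) (a n) (L n) (ln n%:R - ln (r n)) (y + x) v)
     - kappa * expR (- (y + x))| <= 1 by near: n; exact: (Htail _ _ ltr01).
have t2 : forall v, s <= v <= t ->
    `|r n * v * tailW W (weight_level (b n) (a n) (L n) (ln n%:R - ln (r n)) (y' + x) v)
     - kappa * expR (- (y' + x))| <= 1 by near: n; exact: (Htail _ _ ltr01).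
have i0 : 0 < i%:R :> R by case/andP: win => /andP[]; rewrite ltr0n.
have hv : s <= i%:R / r n <= t.
  by move: (win) => /andP[_ /andP[? ?]]; rewrite ler_pdivlMr// ler_pdivrMr//; apply/andP.
have iE : r n * (i%:R / r n) = i%:R by rewrite mulrC divfK// gt_eqF.
rewrite ler_pdivlMr// mulrC.
have fin (z tw : R) : z <= `|y| + 1 \/ z <= `|y'| + 1 ->
    `|r n * (i%:R / r n) * tw - kappa * expR z| <= 1 ->
    i%:R * tw <= `|kappa| * (expR (`|y| + 1) + expR (`|y'| + 1)) + 1.
  move=> hz; rewrite iE => /ler_normlP[_ h].
  rewrite -lerBlDr; apply: (@le_trans _ _ (kappa * expR z)); first by lra.
  apply: (@le_trans _ _ (`|kappa| * expR z)); first by rewrite ler_wpM2r ?expR_ge0 ?ler_norm.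
  apply: ler_wpM2l => //; case: hz => hz.
    by apply: ler_wpDr; rewrite ?expR_ge0// ler_expR.
  by apply: ler_wpDl; rewrite ?expR_ge0// ler_expR.
have hz (z : R) : - (z + x) <= `|z| + 1.
  rewrite opprD; apply: lerD; first by rewrite -normrN ler_norm.
  by apply: le_trans x1; rewrite -normrN ler_norm.
rewrite /level; case: ifPn => _.
  by apply: (fin (- (y' + x))); [right; exact: hz|exact: t2].
by apply: (fin (- (y + x))); [left; exact: hz|exact: t1].
Unshelve. all: by end_near. Qed.

Lemma regime_moderate (s t kappa C0 Lam : R) (r a b L : nat -> R) (Z : R) :
  0 < s -> regime W s t kappa C0 Lam r a b L -> 0 < Z ->
  \forall n \near \oo, [/\ 0 < a n, 0 < b n & 16 * Z * a n <= b n].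
Proof.
move=> s0 [_ _ Ha HL _ Hba _ Hab _ _ _] Z0; near=> n.
have a0 : 0 < a n by near: n.
have L0 : 0 < L n by near: n; exact: near_large.
have b0 : 0 < b n.
  have : 0 < b n / (a n * L n) by near: n; exact: near_gt Hba ltr01.
  by rewrite pmulr_lgt0// invr_gt0 mulr_gt0.
have Z16 : 0 < 16 * Z by rewrite mulr_gt0.
have abn : a n / b n < (16 * Z)^-1 by near: n; apply: near_lt Hab _; rewrite invr_gt0 mulr_gt0.
have : 16 * Z * a n <= b n.
  move: abn; rewrite ltr_pdivrMr// -(ltr_pM2l Z16) mulrA divff ?gt_eqF// mul1r.
  exact: ltW.
by split.
Unshelve. all: by end_near. Qed.

(** As [b L] is larger than any multiple of [ln n], the union bound over all vertices is
    affordable. *)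
Lemma far_negligible (s t kappa C0 Lam : R) (r a b L : nat -> R) (e : R) :
  regime W s t kappa C0 Lam r a b L -> 0 < e ->
  \forall n \near \oo, n%:R * expR (- (b n * L n / 25)) <= e.
Proof.
move=> [_ _ _ _ _ _ _ _ HbL _ _] e0; near=> n.
have n1 : (1 < n)%N by near: n; exists 2%N.
have ne : e^-1 < n%:R by near: n; exact: (near_large _ (@cvgr_idn R)).
have nR0 : 0 < n%:R :> R by rewrite ltr0n; exact: ltnW.
have bLn : 50 < b n * L n / ln n%:R by near: n; exact: near_large.
have ln0 : 0 < ln n%:R :> R by rewrite ln_gt0// ltr1n.
rewrite ltr_pdivlMr// in bLn.
apply: (@le_trans _ _ (n%:R * expR (- (2 * ln n%:R)))).
  by apply: ler_wpM2l => //; rewrite ler_expR lerN2; lra.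
rewrite expRN expRM_natl lnK ?posrE// expr2 invfM mulrA divff ?gt_eqF// mul1r.
by rewrite invf_ple ?posrE// ltW.
Unshelve. all: by end_near. Qed.

End RegimeTails.

Section DegreeLimit.
Context (R : realType) (d : measure_display) (T : measurableType d)
  (P : probability T R) (m : nat) (W : {RV P >-> R})
  (weight : nat -> {RV P >-> R}) (target : nat -> 'I_m -> {RV P >-> nat}).

Lemma measurable_forall (c : pred nat) (F : nat -> set T) :
  (forall i, c i -> measurable (F i)) ->
  measurable [set w | forall i, c i -> F i w].
Proof.
move=> mF; rewrite (_ : [set w | _] = \bigcap_(i in [set i | c i]) F i)//.
exact: bigcap_measurableType.
Qed.

(** The degrees are compared with the weights at the levels shifted by [eps] and [- eps]; the
    limits for the weights differ by little when [eps] is small, by continuity in the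
    shift. The errors [bad1] and [bad2] are summed over the window. *)
Lemma degrees_below_cvg (s t kappa C0 Lam : R) (r a b L : nat -> R)
    (u u' y y' sigma2 : R) :
  weighted_recursive_graph W weight target -> (0 < m)%N ->
  (forall w, 0 <= W w) -> P [set w | 0 < W w] = 1%E -> ('E_P[W] = 1)%E ->
  (\int[P]_w (W w ^+ 2)%:E = sigma2%:E)%E ->
  0 < s -> s <= u -> u < u' -> u' <= t -> 0 <= C0 -> 0 <= Lam ->
  regime W s t kappa C0 Lam r a b L ->
  Pr P [set w | forall i, in_window s t (r n) n i ->
      (in_degree target n i w)%:R <=
        m%:R * ((b n + level u u' (r n) y y' i * a n) * L n)] @[n --> \oo] -->
  expR (- (kappa * (expR (- y) * ln (t / s)
       + (expR (- y') - expR (- y)) * ln (u' / u)))).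
Proof.
move=> wrg m0 W_ge0 W_gt0 EW EW2 s0 su uu' u't C00 Lam0 reg.
have [rc rn Ha HL _ _ _ Hab HbL Htail Hratio] := reg.
have st : s < t by apply: lt_le_trans u't; exact: le_lt_trans uu'.
set Lm := kappa * _.
pose F x := expR (- (Lm * expR (- x))).
have F0 : F 0 = expR (- Lm) by rewrite /F oppr0 expR0 mulr1.
have cF : {for 0, continuous F}.
  apply: continuous_comp; last exact: continuous_expR.
  apply: continuousN; apply: continuousM; first exact: cst_continuous.
  apply: (@continuous_comp _ _ _ (fun x : R => - x) expR).
    exact: opp_continuous.
  exact: continuous_expR.
pose q n x i := weight_level (b n) (a n) (L n) (ln n%:R - ln (r n))
        (level u u' (r n) y y' i + x) (i%:R / r n).
pose EW_ n x := [set w | forall i, in_window s t (r n) n i -> weight i w < q n x i].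
pose thr n i := m%:R * ((b n + level u u' (r n) y y' i * a n) * L n).
pose EZ n := [set w | forall i, in_window s t (r n) n i -> (in_degree target n i w)%:R <= thr n i].
have HW x : Pr P (EW_ n x) @[n --> \oo] --> F x.
  exact: (@weights_below_cvg _ _ _ _ _ _ _ _ wrg s t kappa C0 Lam r a b L u u' y y' x s0 su uu' u't reg).
rewrite -F0; apply/cvgrPdist_le => e e0.
have [eps [eps0 eps1 Fp Fn]] : exists eps, [/\ 0 < eps, eps <= 1,
    `|F 0 - F eps| <= e / 4 & `|F 0 - F (- eps)| <= e / 4].
  have /cvgrPdist_le /(_ (e / 4) (ltac:(by rewrite divr_gt0))) := cF.
  move=> /nbhs_ballP[dl /= dl0 h].
  pose eps := Num.min (dl / 2) 1.
  have eps0 : 0 < eps by rewrite lt_min divr_gt0//= ltr01.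
  have epsd : eps < dl by rewrite gt_min; apply/orP; left; lra.
  exists eps; split => //; first by rewrite ge_min lexx orbT.
    by apply: h; rewrite /ball/= sub0r normrN gtr0_norm.
  by apply: h; rewrite /ball/= sub0r opprK gtr0_norm.
pose K1 := `|kappa| * (expR (`|y| + 1) + expR (`|y'| + 1)) + 1.
have K10 : 0 < K1 by rewrite ltr_wpDl// mulr_ge0 ?addr_ge0 ?expR_ge0.
pose HK := ln (t / s) + 1.
have HK0 : 0 < HK by rewrite ltr_wpDl// ln_ge0// ler_pdivlMr// mul1r ltW.
pose B := (2 * C0 * expR Lam + 1) * K1 * HK.
have B0 : 0 < B by rewrite !mulr_gt0// ltr_wpDl// !mulr_ge0 ?expR_ge0.
have e8 : 0 < e / 8 by rewrite divr_gt0.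
(* [B] times the exponential gained bounds the total probability of the vertices of
   either kind of exceptional behaviour, since [HK] bounds the sum of [1 / i]. *)
have [lam [lam0 Lamlam Bexp]] := large_exponent Lam0 eps0 B0 e8.
have [N0 [N00 gw]] := good_weights wrg W_ge0 W_gt0 EW EW2
  (divr_gt0 eps0 (ltr0n R 32)) (divr_gt0 e0 (ltr0n R 8)).
near=> n.
have r0 : 0 < r n by near: n; exact: near_large.
have rn0 : t * r n <= n%:R by near: n.
have sr0 : 0 < s * r n by rewrite mulr_gt0.
have rN0 : N0%:R / s < r n by near: n; exact: near_large.
have n1 : (1 < n)%N by near: n; exists 2%N.
have nR0 : 0 < n%:R :> R by rewrite ltr0n; exact: ltnW.
have a0 : 0 < a n by near: n.
have L0 : 0 < L n by near: n; exact: near_large.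
have scal : forall v, s <= v <= t ->
      scales m (a n) (b n) (L n) (ln n%:R - ln (r n) - ln v)
      (eps / 32) lam (eps / (32 * lam)) eps.
  by near: n; exact: (regime_scales m0 s0 reg).
have HKn : \sum_(1 <= i < n.+1 | in_window s t (r n) n i) (i%:R)^-1 <= HK.
  near: n; apply: filterS (near_lt (window_sum_cvg s0 st rc rn) (_ : _ < HK)).
    by move=> ? /ltW.
  by rewrite ltrDl.
have far_n : n%:R * expR (- (b n * L n / 25)) <= e / 8.
  by near: n; exact: (far_negligible reg).
pose Z := `|y| + `|y'| + 1.
have [_ b0 Zab] : [/\ 0 < a n, 0 < b n & 16 * Z * a n <= b n].
  by near: n; apply: (regime_moderate s0 reg); rewrite ltr_wpDl// addr_ge0.
have ratio : forall q x, b n / 2 <= q <= 2 * b n -> q / 2 <= x <= q ->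
    tailW W x <= C0 * expR (Lam * (q - x) / a n) * tailW W q.
  by near: n; exact: Hratio.
have tails1 : forall i, in_window s t (r n) n i -> tailW W (q n eps i) <= K1 / i%:R.
  by near: n; apply: (window_tail_le _ _ _ _ s0 reg); rewrite gtr0_norm.
have tails2 : forall i, in_window s t (r n) n i -> tailW W (q n (- eps) i) <= K1 / i%:R.
  by near: n; apply: (window_tail_le _ _ _ _ s0 reg); rewrite normrN gtr0_norm.
(* All vertices of the window have at least the label [N], where [good_weights] applies. *)
pose N := Num.truncn (s * r n).
have NN0 : (N0 <= N)%N.
  rewrite -(natrK (R := R) N0) /N le_truncn// mulrC -ler_pdivrMr//; exact: ltW.
have Nn : (N <= n)%N.
  rewrite -(natrK (R := R) n) /N le_truncn//; apply: le_trans rn0.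
  by rewrite ler_wpM2r// ltW.
have [A [hA Apos PA HA]] := gw N n (ltac:(by rewrite NN0)).
have mA := history_measurable hA.
have winN i : in_window s t (r n) n i -> (N <= i <= n)%N.
  move=> /andP[/andP[_ ->] /andP[h _]]; rewrite andbT.
  by rewrite -(natrK (R := R) i) /N le_truncn.
have inR i : in_window s t (r n) n i -> 0 < i%:R :> R.
  by case/andP => /andP[]; rewrite ltr0n.
have hv i : in_window s t (r n) n i -> s <= i%:R / r n <= t.
  by move=> /andP[_ /andP[? ?]]; rewrite ler_pdivlMr// ler_pdivrMr//; apply/andP.
pose Li i := ln n%:R - ln (r n) - ln (i%:R / r n).
have HA' w i : in_window s t (r n) n i -> A w ->
    `|inv_weight_sum weight i n w - Li i| <= eps / 32.
  move=> win Aw; have i0 := inR _ win.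
  rewrite (_ : Li i = ln (n%:R / i%:R)); first exact: HA Aw (winN _ win).
  by rewrite /Li !ln_div ?posrE//; ring.
have lev_le i : `|level u u' (r n) y y' i| <= `|y| + `|y'|.
  by rewrite /level; case: ifPn => _; rewrite ?lerDl ?lerDr.
have ZZ : `|y| + `|y'| <= Z by rewrite lerDl.
have lev_x i (x : R) : `|x| = eps -> `|level u u' (r n) y y' i + x| <= Z.
  move=> xe; apply: le_trans (ler_normD _ _) _; apply: lerD => //.
  by rewrite xe.
have epsE : `|eps| = eps by rewrite gtr0_norm.
have epsNE : `|- eps| = eps by rewrite normrN gtr0_norm.
pose bad1 i := A `&` [set w | q n eps i <= weight i w] `&`
     [set w | (in_degree target n i w)%:R <= thr n i].
pose bad2 i := A `&` [set w | weight i w < q n (- eps) i] `&`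
     [set w | thr n i < (in_degree target n i w)%:R].
have bad1_le i : in_window s t (r n) n i ->
    Pr P (bad1 i) <= expR (- (lam * eps / 2)) * (K1 / i%:R).
  move=> win; have sc := scal _ (hv _ win).
  have win1 : (0 < i <= n)%N by case/andP: win.
  apply: le_trans (vertex_low_degree wrg m0 win1 hA Apos (fun w => @HA' w i win) sc erefl
     (scaled_le1 (ltW a0) (lev_x i _ epsE) Zab) (erefl (q n eps i))) _.
  by apply: ler_wpM2l; [exact: expR_ge0|exact: tails1].
have bad2_le i : in_window s t (r n) n i ->
    Pr P (bad2 i) <= expR (- (b n * L n / 25)) +
      2 * C0 * expR Lam * expR (- (lam * eps / 2)) * (K1 / i%:R).
  move=> win; have sc := scal _ (hv _ win).
  have win1 : (0 < i <= n)%N by case/andP: win.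
  have Y16 := scaled_le (ltW a0) (lev_x i _ epsNE) Zab.
  have q_b : b n / 2 <= q n (- eps) i <= 2 * b n := weight_level_range sc Y16.
  have h := vertex_high_degree wrg m0 win1 hA Apos (fun w => @HA' w i win) sc erefl
    (scaled_le (ltW a0) (le_trans (lev_le i) ZZ) Zab) Y16 (erefl (q n (- eps) i)) C00 Lam0 Lamlam
    (fun x => ratio _ x q_b).
  apply: le_trans h _.
  rewrite lerD2l; apply: ler_wpM2l; first by rewrite !mulr_ge0 ?expR_ge0.
  exact: tails2.
pose J := [seq i <- index_iota 1 n.+1 | in_window s t (r n) n i].
have JP i : (i \in J) = in_window s t (r n) n i.
  rewrite mem_filter mem_index_iota ltnS; case: (boolP (in_window _ _ _ _ _)) => //.
  by case/andP.
have sumK c : 0 <= c -> \sum_(i <- J) c * (K1 / i%:R) <= c * (K1 * HK).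
  move=> c0; rewrite -mulr_sumr -mulr_sumr /J big_filter.
  by apply: ler_wpM2l => //; apply: ler_wpM2l; [exact: ltW|exact: HKn].
have sum1 : \sum_(i <- J) Pr P (bad1 i) <= e / 8.
  apply: (@le_trans _ _ (\sum_(i <- J) expR (- (lam * eps / 2)) * (K1 / i%:R))).
    by rewrite big_seq [leRHS]big_seq; apply: ler_sum => i; rewrite JP; exact: bad1_le.
  apply: le_trans (sumK _ (expR_ge0 _)) _; apply: le_trans Bexp.
  rewrite mulrC; apply: ler_wpM2r; first exact: expR_ge0.
  rewrite /B -mulrA ler_peMl ?mulr_ge0 ?(ltW K10) ?(ltW HK0)//.
  by rewrite lerDr !mulr_ge0 ?expR_ge0.
have sum2 : \sum_(i <- J) Pr P (bad2 i) <= e / 8 + e / 8.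
  apply: (@le_trans _ _ (\sum_(i <- J) (expR (- (b n * L n / 25)) +
      2 * C0 * expR Lam * expR (- (lam * eps / 2)) * (K1 / i%:R)))).
    by rewrite big_seq [leRHS]big_seq; apply: ler_sum => i; rewrite JP; exact: bad2_le.
  rewrite big_split/=; apply: lerD.
    apply: le_trans far_n.
    apply: (@le_trans _ _ (\sum_(1 <= i < n.+1) expR (- (b n * L n / 25)))).
      rewrite /J big_filter big_mkcond; apply: ler_sum => i _.
      by case: ifPn => _ //; exact: expR_ge0.
    by rewrite big_const_nat subn1/= iter_addr addr0 mulr_natl.
  apply: le_trans (sumK _ _) _; first by rewrite !mulr_ge0 ?expR_ge0.
  apply: le_trans Bexp.
  rewrite [leLHS]mulrAC; apply: ler_wpM2r; first exact: expR_ge0.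
  rewrite /B -[leRHS]mulrA; apply: ler_wpM2r; last by rewrite lerDl.
  by rewrite mulr_ge0 ?(ltW K10) ?(ltW HK0).
have mEZ : measurable (EZ n).
  apply: measurable_forall => i _.
  exact: (measurable_degree_itv weight target n i (fun k => k%:R <= thr n i)).
have mlt i c : measurable [set w | weight i w < c].
  rewrite (_ : [set w | _] = weight i @^-1` `]-oo, c[); first exact: measurable_funPTI.
  by apply/seteqP; split => w /=; rewrite in_itv.
have mEW x : measurable (EW_ n x) by apply: measurable_forall => i _; exact: mlt.
have mbad1 i : measurable (bad1 i).
  apply: measurableI.
    by apply: measurableI => //; exact: measurable_ge.
  exact: (measurable_degree_itv weight target n i (fun k => k%:R <= thr n i)).
have mbad2 i : measurable (bad2 i).
  apply: measurableI; first exact: measurableI.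
  exact: (measurable_degree_itv weight target n i (fun k => thr n i < k%:R)).
have mU (F_ : nat -> set T) : (forall i, measurable (F_ i)) ->
    measurable [set w | exists2 i, i \in J & F_ i w].
  move=> mF; rewrite (_ : [set w | _] = \bigcup_(i in [set` J]) F_ i).
    exact: bigcup_measurable.
  by apply/seteqP; split => w [k hk bk]; exists k.
have PAc : Pr P (~` A) <= e / 8 by rewrite Pr_setC// lerBlDl addrC -lerBlDl.
have mAc : measurable (~` A) by exact: measurableC.
have up : Pr P (EZ n) <= Pr P (EW_ n eps) + (e / 8 + e / 8).
  have cov : EZ n `<=` EW_ n eps `|` (~` A `|` [set w | exists2 i, i \in J & bad1 i w]).
    move=> w hZ; have [Aw|Aw] := pselect (A w); last by right; left.
    have [hW|/existsNP[i /not_implyP[win /negP]]] := pselect (EW_ n eps w); first by left.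
    rewrite -leNgt => hq; right; right; exists i; rewrite ?JP//.
    by split => //; exact: hZ.
  apply: le_trans (Pr_mono P mEZ _ cov) _.
    by apply: measurableU => //; apply: measurableU => //; exact: mU.
  apply: le_trans (Pr_setU P (mEW _) _) _; first by apply: measurableU => //; exact: mU.
  rewrite lerD2l; apply: le_trans (Pr_setU P mAc (mU _ mbad1)) _; apply: lerD => //.
  by apply: le_trans sum1; apply: Pr_bigcup => //; exact: mU.
have lo : Pr P (EW_ n (- eps)) <= Pr P (EZ n) + (e / 8 + (e / 8 + e / 8)).
  have cov : EW_ n (- eps) `<=` EZ n `|` (~` A `|` [set w | exists2 i, i \in J & bad2 i w]).
    move=> w hW; have [Aw|Aw] := pselect (A w); last by right; left.
    have [hZ|/existsNP[i /not_implyP[win /negP]]] := pselect (EZ n w); first by left.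
    rewrite -ltNge => hq; right; right; exists i; rewrite ?JP//.
    by split => //; split => //; exact: hW.
  apply: le_trans (Pr_mono P (mEW _) _ cov) _.
    by apply: measurableU => //; apply: measurableU => //; exact: mU.
  apply: le_trans (Pr_setU P mEZ _) _; first by apply: measurableU => //; exact: mU.
  rewrite lerD2l; apply: le_trans (Pr_setU P mAc (mU _ mbad2)) _; apply: lerD => //.
  by apply: le_trans sum2; apply: Pr_bigcup => //; exact: mU.
have W1 : `|F eps - Pr P (EW_ n eps)| <= e / 8.
  by near: n; move/cvgrPdist_le: (HW eps); apply; rewrite divr_gt0.
have W2 : `|F (- eps) - Pr P (EW_ n (- eps))| <= e / 8.
  by near: n; move/cvgrPdist_le: (HW (- eps)); apply; rewrite divr_gt0.
rewrite -/(EZ n).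
exact: sandwich_le Fp Fn up lo W1 W2.
Unshelve. all: by end_near. Qed.
End DegreeLimit.

(** * Limits of real sequences *)

Section Limits.
Context (R : realType).
Implicit Types (u v : nat -> R).

Lemma ger_cvgy u v : (\forall n \near \oo, u n <= v n) ->
  u n @[n --> \oo] --> +oo -> v n @[n --> \oo] --> +oo.
Proof.
move=> uv uc; apply/cvgryPge => A; near=> n.
apply: (@le_trans _ _ (u n)); last by near: n.
by near: n; move/cvgryPge: uc; exact.
Unshelve. all: by end_near. Qed.

Lemma cvgy_ln u : u n @[n --> \oo] --> +oo -> ln (u n) @[n --> \oo] --> +oo.
Proof.
move=> uc; apply/cvgryPge => A; near=> n.
have h : expR A <= u n by near: n; move/cvgryPge: uc; exact.
by rewrite -[A]expRK ler_ln// posrE ?expR_gt0// (lt_le_trans _ h)// expR_gt0.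
Unshelve. all: by end_near. Qed.

Lemma cvgy_expR u : u n @[n --> \oo] --> +oo -> expR (u n) @[n --> \oo] --> +oo.
Proof.
apply: ger_cvgy; near=> n; apply: le_trans (expR_ge1Dx _); rewrite lerDr//.
Unshelve. all: by end_near. Qed.

Lemma cvgyM u v (l : R) : 0 < l -> u n @[n --> \oo] --> l ->
  v n @[n --> \oo] --> +oo -> u n * v n @[n --> \oo] --> +oo.
Proof.
move=> l0 ul vc; apply/cvgryPge => A; near=> n.
have h1 : l / 2 < u n by near: n; apply: near_gt ul _; lra.
have h2 : (2 / l) * `|A| < v n by near: n; exact: near_large.
apply: le_trans (ler_norm A) _.
have -> : `|A| = l / 2 * (2 / l * `|A|) by field; rewrite gt_eqF.
by apply: ler_pM; rewrite ?mulr_ge0 ?invr_ge0 ?(ltW l0) ?(ltW h1) ?(ltW h2).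
Unshelve. all: by end_near. Qed.

Lemma cvgyZ u (k : R) : 0 < k -> u n @[n --> \oo] --> +oo -> k * u n @[n --> \oo] --> +oo.
Proof. by move=> k0; apply: cvgyM k0 _; exact: cvg_cst. Qed.

Lemma cvgy_powR u (p : R) : 0 < p -> u n @[n --> \oo] --> +oo ->
  u n `^ p @[n --> \oo] --> +oo.
Proof.
move=> p0 uc; have := cvgy_expR (cvgyZ p0 (cvgy_ln uc)).
apply: ger_cvgy; near=> n.
have u0 : 0 < u n by near: n; exact: near_large.
by rewrite /powR gt_eqF.
Unshelve. all: by end_near. Qed.

Lemma cvgyV u : u n @[n --> \oo] --> +oo -> (u n)^-1 @[n --> \oo] --> (0 : R).
Proof.
move=> uc; apply/(gtr0_cvgV0 _); last exact: uc.
by near=> n; near: n; exact: near_large.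
Unshelve. all: by end_near. Qed.

Lemma cvg_div_y u v (l : R) : u n @[n --> \oo] --> l -> v n @[n --> \oo] --> +oo ->
  u n / v n @[n --> \oo] --> (0 : R).
Proof. by move=> ul /cvgyV vc; rewrite -(mulr0 l); exact: cvgM. Qed.

Lemma cvg_sqr0 u : u n ^+ 2 @[n --> \oo] --> (0 : R) -> u n @[n --> \oo] --> (0 : R).
Proof.
move=> u2; apply/cvgrPdist_le => e e0; near=> n.
have h : u n ^+ 2 < e ^+ 2 by near: n; apply: near_lt u2 _; rewrite exprn_gt0.
rewrite sub0r normrN -(@ler_pXn2r _ 2)// ?nnegrE ?(ltW e0)//.
by rewrite real_normK ?num_real// ltW.
Unshelve. all: by end_near. Qed.

(** The logarithm is at most four times the fourth root. *)
Lemma sqr_ln_le (x : R) : 0 < x -> 1 <= x -> ln x ^+ 2 / x <= 16 * x `^ (- 2^-1).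
Proof.
move=> x0 x1.
have lx : ln x <= 4 * x `^ (4^-1).
  have -> : ln x = 4 * ln (x `^ (4^-1)) by rewrite ln_powR; field.
  by rewrite ler_wpM2l// ltW// ln_sublinear// powR_gt0.
have l0 : 0 <= ln x by rewrite ln_ge0.
rewrite ler_pdivrMr//.
apply: (@le_trans _ _ ((4 * x `^ (4^-1)) ^+ 2)).
  by rewrite lerXn2r// nnegrE// mulr_ge0// powR_ge0.
rewrite exprMn -natrX -mulrA.
have -> : x `^ 4^-1 ^+ 2 = x `^ (- 2^-1) * x.
  rewrite -[X in _ * X](powRr1 (ltW x0)) -powRD; last by rewrite (gt_eqF x0) implybT.
  by rewrite -powR_mulrn ?powR_ge0// -powRrM; congr (_ `^ _); field.
by [].
Qed.

Lemma cvg_sqr_ln u : u n @[n --> \oo] --> +oo ->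
  ln (u n) ^+ 2 / u n @[n --> \oo] --> (0 : R).
Proof.
move=> uc.
apply: (@squeeze_cvgr _ _ _ _ (fun=> 0) (fun n => 16 * ((u n) `^ (2^-1))^-1)).
- near=> n.
  have u1 : 1 < u n by near: n; exact: near_large.
  have u0 : 0 < u n by exact: lt_trans u1.
  rewrite divr_ge0 ?sqr_ge0 ?(ltW u0)//= -powRN.
  by apply: sqr_ln_le => //; exact: ltW.
- exact: cvg_cst.
- by rewrite -(mulr0 16); apply: cvgMr; apply: cvgyV; apply: cvgy_powR; rewrite // invr_gt0.
Unshelve. all: by end_near. Qed.

Lemma cvg_affine_ln_sqr u (A B : R) : u n @[n --> \oo] --> +oo ->
  (A * ln (u n) + B) ^+ 2 / u n @[n --> \oo] --> (0 : R).
Proof.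
move=> uc.
have h1 := cvg_sqr_ln uc; have h2 := cvgyV uc.
have h3 : ln (u n) / u n @[n --> \oo] --> (0 : R).
  apply: cvg_sqr0; rewrite -(mulr0 0).
  apply: cvg_trans (cvgM h1 h2); apply: near_eq_cvg; near=> n.
  by rewrite /= exprMn expr2 -!mulrA; congr (_ * _); rewrite expr2 !mulrA.
have h4 : A ^+ 2 * (ln (u n) ^+ 2 / u n) + (2 * A * B * (ln (u n) / u n) + B ^+ 2 * (u n)^-1)
     @[n --> \oo] --> A ^+ 2 * 0 + (2 * A * B * 0 + B ^+ 2 * 0).
  by apply: cvgD; [exact: cvgMr|apply: cvgD; exact: cvgMr].
rewrite !mulr0 !addr0 in h4; apply: cvg_trans h4; apply: near_eq_cvg; near=> n.
rewrite /=; ring.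
Unshelve. all: by end_near. Qed.

Lemma cvg_powR1 u (p : R) : u n @[n --> \oo] --> (1 : R) ->
  u n `^ p @[n --> \oo] --> (1 : R).
Proof.
move=> uc.
have h : expR (p * ln (u n)) @[n --> \oo] --> (1 : R).
  rewrite -[X in _ --> X](expR0 R) -[X in expR X](mulr0 p) -[X in p * X](@ln1 R).
  apply: continuous_cvg; first exact: continuous_expR.
  by apply: cvgMr; apply: continuous_cvg => //; exact: continuous_ln.
apply: cvg_trans h; apply: near_eq_cvg; near=> n.
have u0 : 0 < u n by near: n; exact: near_gt uc ltr01.
by rewrite /powR gt_eqF.
Unshelve. all: by end_near. Qed.

Lemma ln1D_bounds (x : R) : - (1 / 2) <= x -> x - 2 * x ^+ 2 <= ln (1 + x) <= x.
Proof.
move=> x1; have x0 : 0 < 1 + x by lra.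
rewrite le_ln1Dx ?andbT; last by lra.
have -> : 1 + x = (1 + - (x / (1 + x)))^-1.
  by field; rewrite gt_eqF//=; apply/eqP; lra.
have h : 1 + - (x / (1 + x)) = (1 + x)^-1 by field; rewrite gt_eqF.
rewrite lnV ?posrE; last by rewrite h invr_gt0.
rewrite lerNr; apply: le_trans (le_ln1Dx _) _.
  have : 0 < 1 + - (x / (1 + x)) by rewrite h invr_gt0.
  lra.
rewrite lerN2 ler_pdivlMr//; nra.
Qed.

(** A bound that holds along every sequence of points of [s, t] holds uniformly. *)
Lemma uniform_of_sequences (s t : R) (F : nat -> R -> R) : s <= t ->
  (forall v : nat -> R, (forall n, s <= v n <= t) -> F n (v n) @[n --> \oo] --> (0 : R)) ->
  forall e : R, 0 < e -> \forall n \near \oo, forall x, s <= x <= t -> `|F n x| <= e.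
Proof.
move=> st Fseq e e0.
pose bad n (x : R) := s <= x <= t /\ e < `|F n x|.
pose v n := if pselect (exists x, bad n x) is left h then projT1 (cid h) else s.
have vst n : s <= v n <= t.
  rewrite /v; case: pselect => [h|_]; last by rewrite lexx.
  by case: (cid h) => x /= [].
near=> n => x xst; rewrite leNgt; apply/negP => xbad.
have : `|F n (v n)| < e.
  near: n; have /cvgrPdist_lt/(_ _ e0) := Fseq v vst.
  by apply: filterS => n; rewrite sub0r normrN.
rewrite /v; case: pselect => [h|nb _]; last by apply: nb; exists x.
by case: (cid h) => z /= [_ h1] h2; have := lt_trans h1 h2; rewrite ltxx.
Unshelve. all: by end_near. Qed.

End Limits.

(** * Stretched exponential tails at their quantiles *)

Section PowerExpansion.
Context (R : realType).

(** Both sides of [1] are treated at once, as the expansions below are two-sided. *)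
Lemma MVT_at1 (f df : R -> R) (z : R) : 0 < z ->
  (forall x : R, 0 < x -> is_derive x 1 f (df x)) ->
  exists c, [/\ 0 < c, `|c - 1| <= `|z - 1| & f z - f 1 = df c * (z - 1)].
Proof.
move=> z0 fdf.
have cont (a b : R) : 0 < a -> {within `[a, b], continuous f}.
  move=> a0; apply: derivable_within_continuous => x; rewrite in_itv/= => /andP[ax _].
  have x0 : 0 < x by exact: lt_le_trans ax.
  by have := fdf x x0 => fx; exact: ex_derive.
have [z1|z1] := leP 1 z.
  have [x|c] := MVT_segment z1 _ (cont _ _ ltr01) (df := df).
    by rewrite in_itv/= => /andP[x1 _]; apply: fdf; exact: lt_trans x1.
  rewrite in_itv/= => /andP[c1 cz] E; exists c; split => //; first exact: lt_le_trans c1.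
  by rewrite !ger0_norm ?subr_ge0// lerD2r.
have [x|c] := MVT_segment (ltW z1) _ (cont _ _ z0) (df := df).
  by rewrite in_itv/= => /andP[x1 _]; apply: fdf; exact: lt_trans x1.
rewrite in_itv/= => /andP[c1 cz] E; exists c; split => //; first exact: lt_le_trans c1.
  by rewrite distrC (distrC z) !ger0_norm ?subr_ge0 ?(ltW z1)// lerD2l lerN2.
by rewrite -(opprB (f 1)) E -mulrN opprB.
Qed.

Lemma powR_near1 (q e : R) : 0 < e ->
  exists2 eta, 0 < eta < 1 & forall z, `|z - 1| < eta -> `|z `^ q - 1| <= e.
Proof.
move=> e0.
have : expR (q * ln z) @[z --> (1 : R)] --> (1 : R).
  rewrite -[X in _ --> X](expR0 R) -[X in expR X](mulr0 q) -[X in q * X](@ln1 R).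
  apply: continuous_cvg; first exact: continuous_expR.
  by apply: cvgMr; exact: continuous_ln.
move=> /cvgrPdist_le/(_ e e0)/nbhs_ballP[d /= d0 hd].
exists (Num.min d (1 / 2)).
  by rewrite lt_min d0/=; apply/andP; split; [lra|rewrite gt_min; apply/orP; right; lra].
move=> z; rewrite lt_min => /andP[zd z12].
have z0 : 0 < z by move: z12 => /ltr_normlP[]; lra.
rewrite /powR gt_eqF// distrC; apply: hd.
by rewrite /ball/= distrC.
Qed.

Lemma powR_first_order (q e : R) : 0 < e ->
  exists2 eta, 0 < eta < 1 & forall z, `|z - 1| < eta ->
    `|z `^ q - 1 - q * (z - 1)| <= e * `|z - 1|.
Proof.
move=> e0.
have e1 : 0 < e / (`|q| + 1) by rewrite divr_gt0// ltr_wpDl.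
have [eta /andP[eta0 eta1] h] := powR_near1 (q - 1) e1.
exists eta => [|z zeta]; first by rewrite eta0.
have z0 : 0 < z by move: zeta => /ltr_normlP[]; lra.
have [c [c0 cz E]] := @MVT_at1 (fun x => x `^ q) _ z z0 (fun x x0 => is_derive1_powR q x0).
rewrite /= powR1 in E.
rewrite E; have -> : q * c `^ (q - 1) * (z - 1) - q * (z - 1) = q * (z - 1) * (c `^ (q - 1) - 1) by ring.
have h1 := h c (le_lt_trans cz zeta).
rewrite !normrM mulrAC; apply: ler_wpM2r => //.
apply: (@le_trans _ _ (`|q| * (e / (`|q| + 1)))); first by rewrite ler_wpM2l.
rewrite mulrA ler_pdivrMr ?ltr_wpDl// mulrC ler_wpM2l ?(ltW e0)// lerDl//.
Qed.

(** The remainder is integrated by the mean value theorem from the first-order expansion of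
    the derivative; that one comes from the continuity of the powers at [1]. *)
Lemma powR_second_order (q e : R) : 0 < e ->
  exists2 eta, 0 < eta < 1 & forall z, `|z - 1| < eta ->
    `|z `^ q - 1 - q * (z - 1) - q * (q - 1) / 2 * (z - 1) ^+ 2| <= e * (z - 1) ^+ 2.
Proof.
move=> e0.
have e1 : 0 < e / (`|q| + 1) by rewrite divr_gt0// ltr_wpDl.
have [eta /andP[eta0 eta1] h] := powR_first_order (q - 1) e1.
exists eta => [|z zeta]; first by rewrite eta0.
have z0 : 0 < z by move: zeta => /ltr_normlP[]; lra.
pose f (x : R) := x `^ q - q * x - q * (q - 1) / 2 * (x - 1) ^+ 2.
pose df (x : R) := q * (x `^ (q - 1) - 1 - (q - 1) * (x - 1)).
have fdf (x : R) : 0 < x -> is_derive x 1 f (df x).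
  move=> x0; have := is_derive1_powR q x0 => dx.
  rewrite /f; apply: is_derive_eq.
  by rewrite /df /GRing.scale/=; field.
have [c [c0 cz E]] := @MVT_at1 f df z z0 fdf.
have f1 : f 1 = 1 - q by rewrite /f powR1 subrr expr0n/= mulr0 subr0 mulr1.
have -> : z `^ q - 1 - q * (z - 1) - q * (q - 1) / 2 * (z - 1) ^+ 2 = f z - f 1.
  by rewrite f1 /f; ring.
rewrite E /df; have h1 := h c (le_lt_trans cz zeta).
have z2 : (z - 1) ^+ 2 = `|z - 1| * `|z - 1| by rewrite -expr2 real_normK ?num_real.
rewrite z2 !normrM mulrA; apply: ler_wpM2r => //.
apply: (@le_trans _ _ (`|q| * (e / (`|q| + 1) * `|c - 1|))); first by rewrite ler_wpM2l.
rewrite mulrA; apply: ler_pM => //.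
  by rewrite mulr_ge0// ltW.
rewrite mulrA ler_pdivrMr ?ltr_wpDl// mulrC ler_wpM2l ?(ltW e0)// lerDl//.
Qed.
End PowerExpansion.

(** The tail of the weights in the first case, and of their logarithms in the second. *)
Definition stretched (R : realType) (a b c1 tau x : R) : R :=
  a * x `^ b * expR (- (x / c1) `^ tau).

Section StretchedAsymptotics.
Context (R : realType) (a b c1 tau beta : R) (ell y : nat -> R).

Let e n := b / tau * ln (ell n) + b * ln c1 + ln a.
Let z n := 1 + (e n + y n) / (tau * ell n).

Lemma cvg_sqrD (u v w : nat -> R) (l : R) :
  u n ^+ 2 / w n @[n --> \oo] --> (0 : R) -> v n ^+ 2 / w n @[n --> \oo] --> l ->
  (\forall n \near \oo, 0 < w n) ->
  (u n + v n) ^+ 2 / w n @[n --> \oo] --> l.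
Proof.
move=> hu hv w0.
have huv : u n * v n / w n @[n --> \oo] --> (0 : R).
  apply: cvg_sqr0; rewrite -(mul0r l); apply: cvg_trans (cvgM hu hv).
  apply: near_eq_cvg; near=> n; have wn : 0 < w n by near: n.
  by rewrite /=; field; rewrite gt_eqF.
have h : u n ^+ 2 / w n + (2 * (u n * v n / w n) + v n ^+ 2 / w n)
     @[n --> \oo] --> 0 + (2 * 0 + l).
  by apply: cvgD => //; apply: cvgD => //; exact: cvgMr.
rewrite mulr0 !add0r in h; apply: cvg_trans h; apply: near_eq_cvg; near=> n.
by rewrite /=; ring.
Unshelve. all: by end_near. Qed.

(** The threshold is [c1 ell^(1/tau) z]; the first-order term of [ell z^tau]
    cancels [y] and the logarithm of the prefactor, and the second-order term
    leaves [(tau - 1) beta / (2 tau)]. *)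
Lemma stretched_cvg : 0 < a -> 0 < c1 -> 0 < tau -> ell n @[n --> \oo] --> +oo ->
  y n ^+ 2 / ell n @[n --> \oo] --> beta ->
  let x n := c1 * ell n `^ tau^-1 + c1 / tau * ell n `^ (tau^-1 - 1) * (e n + y n) in
  (x n @[n --> \oo] --> +oo) /\
  (expR (ell n + y n) * stretched a b c1 tau (x n) @[n --> \oo] -->
    expR (- ((tau - 1) * beta / (2 * tau)))).
Proof.
move=> a0 c0 tau0 hl hy x.
have ell0 : \forall n \near \oo, 0 < ell n by exact: near_large.
have he : e n ^+ 2 / ell n @[n --> \oo] --> (0 : R).
  under eq_cvg => n do rewrite /e -addrA.
  exact: cvg_affine_ln_sqr.
have hD : (e n + y n) ^+ 2 / ell n @[n --> \oo] --> beta by exact: cvg_sqrD.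
pose D n := (e n + y n) ^+ 2 / ell n / tau ^+ 2.
have hD2 : D n @[n --> \oo] --> beta / tau ^+ 2 by exact: cvgMl.
have DE : \forall n \near \oo, ell n * (z n - 1) ^+ 2 = D n.
  near=> n; have l0 : 0 < ell n by near: n.
  by rewrite /z /D; field; rewrite !gt_eqF.
have hz1 : z n - 1 @[n --> \oo] --> (0 : R).
  apply: cvg_sqr0; apply: cvg_trans (cvg_div_y hD2 hl); apply: near_eq_cvg.
  near=> n; have l0 : 0 < ell n by near: n.
  have <- : ell n * (z n - 1) ^+ 2 = D n by near: n.
  by rewrite /= mulrC mulrA mulVf ?gt_eqF// mul1r.
have hz : z n @[n --> \oo] --> (1 : R).
  rewrite -[X in _ --> X]add0r; under eq_cvg => n do rewrite -[z n](subrK 1).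
  by apply: cvgD => //; exact: cvg_cst.
have xE : \forall n \near \oo, x n = c1 * ell n `^ tau^-1 * z n.
  near=> n; have l0 : 0 < ell n by near: n.
  have -> : x n = c1 * ell n `^ tau^-1 + c1 / tau * (ell n `^ tau^-1 / ell n) * (e n + y n).
    rewrite /x powRD; last by rewrite (gt_eqF l0) implybT.
    by rewrite powR_inv1// ltW.
  by rewrite /z; field; rewrite !gt_eqF.
have hx : x n @[n --> \oo] --> +oo.
  have h : z n * (c1 * ell n `^ tau^-1) @[n --> \oo] --> +oo.
    apply: cvgyM hz _ => //; apply: cvgyZ => //; apply: cvgy_powR => //.
    by rewrite invr_gt0.
  by apply: ger_cvgy h; apply: filterS xE => n ->; rewrite [leLHS]mulrC.
split => //.
(* [z - 1] is of order [ell^(-1/2)], so that [ell] times the quadratic term of [z^tau]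
   converges and the rest of the expansion vanishes. *)
have hQ : ell n * (z n `^ tau - 1 - tau * (z n - 1)) @[n --> \oo] -->
    (tau - 1) * beta / (2 * tau).
  have -> : (tau - 1) * beta / (2 * tau) = tau * (tau - 1) / 2 * (beta / tau ^+ 2).
    by field; rewrite gt_eqF.
  have h : ell n * (z n `^ tau - 1 - tau * (z n - 1)) - tau * (tau - 1) / 2 * D n
      @[n --> \oo] --> (0 : R).
    apply/cvgrPdist_le => eps eps0.
    have B0 : 0 < `|beta / tau ^+ 2| + 1 by rewrite ltr_wpDl.
    have e1 : 0 < eps / (`|beta / tau ^+ 2| + 1) by rewrite divr_gt0.
    have [eta /andP[eta0 _] heta] := powR_second_order tau e1.
    near=> n; have l0 : 0 < ell n by near: n.
    have Dn : ell n * (z n - 1) ^+ 2 = D n by near: n.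
    have DB : D n < `|beta / tau ^+ 2| + 1.
      near: n; apply: near_lt hD2 _; apply: le_lt_trans (ler_norm _) _.
      by rewrite ltrDl.
    have zn : `|z n - 1| < eta.
      by near: n; move/cvgrPdist_lt: hz1 => /(_ _ eta0); apply: filterS => n; rewrite sub0r normrN.
    rewrite sub0r normrN -Dn mulrCA -mulrBr normrM (gtr0_norm l0).
    apply: (@le_trans _ _ (ell n * (eps / (`|beta / tau ^+ 2| + 1) * (z n - 1) ^+ 2))).
      by rewrite ler_wpM2l ?(ltW l0)//; exact: heta.
    rewrite mulrCA Dn mulrAC ler_pdivrMr// ler_wpM2l ?(ltW eps0)//; exact: ltW.
  rewrite -[X in _ --> X]add0r.
  under eq_cvg => n do rewrite -(subrK (tau * (tau - 1) / 2 * D n) (ell n * _)).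
  by apply: cvgD => //; exact: cvgMr.
have hG : z n `^ b * expR (- (ell n * (z n `^ tau - 1 - tau * (z n - 1)))) @[n --> \oo] -->
    1 * expR (- ((tau - 1) * beta / (2 * tau))).
  apply: cvgM; first exact: cvg_powR1.
  by apply: continuous_cvg; [exact: continuous_expR|exact: cvgN].
rewrite mul1r in hG; apply: cvg_trans hG; apply: near_eq_cvg; near=> n.
have l0 : 0 < ell n by near: n.
have z0 : 0 < z n by near: n; exact: near_gt hz ltr01.
have p0 : 0 < ell n `^ tau^-1 by rewrite powR_gt0.
have xn : x n = c1 * ell n `^ tau^-1 * z n by near: n.
rewrite /stretched xn.
have -> : (c1 * ell n `^ tau^-1 * z n / c1) `^ tau = ell n * z n `^ tau.
  have -> : c1 * ell n `^ tau^-1 * z n / c1 = ell n `^ tau^-1 * z n by field; rewrite gt_eqF.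
  by rewrite powRM ?(ltW p0) ?(ltW z0)// -powRrM mulVf ?gt_eqF// powRr1// ltW.
have -> : (c1 * ell n `^ tau^-1 * z n) `^ b = expR (b * (ln c1 + tau^-1 * ln (ell n))) * z n `^ b.
  rewrite powRM ?(ltW z0) ?mulr_ge0 ?(ltW c0) ?(ltW p0)//; congr (_ * _).
  by rewrite /powR gt_eqF ?mulr_gt0// lnM ?posrE// -/(powR _ _) ln_powR.
have -> : expR (- (ell n * (z n `^ tau - 1 - tau * (z n - 1)))) =
    expR (ell n + y n) * (expR (ln a) * expR (b * (ln c1 + tau^-1 * ln (ell n)))) *
    expR (- (ell n * z n `^ tau)).
  rewrite -!expRD; congr expR.
  have -> : ell n * (z n `^ tau - 1 - tau * (z n - 1)) =
     ell n * z n `^ tau - ell n - (e n + y n) by rewrite /z; field; rewrite !gt_eqF.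
  by rewrite /e; ring.
rewrite (lnK _ : expR (ln a) = a) ?posrE//; ring.
Unshelve. all: by end_near. Qed.

End StretchedAsymptotics.

(** * Ratios of tails and second moments *)

Section StretchedRatio.
Context (R : realType).

Lemma powR_diff (tau x q : R) : 0 < x -> x <= q ->
  exists c, [/\ x <= c, c <= q & q `^ tau - x `^ tau = tau * c `^ (tau - 1) * (q - x)].
Proof.
move=> x0 xq.
have d (y : R) : 0 < y -> is_derive y (1 : R) (fun z : R => z `^ tau) (tau * y `^ (tau - 1)).
  exact: is_derive1_powR.
have cont : {within `[x, q], continuous (fun z : R => z `^ tau)}.
  apply: derivable_within_continuous => y; rewrite in_itv/= => /andP[xy _].
  have dy := d y (lt_le_trans x0 xy); exact: ex_derive.
have [y|c] := MVT_segment xq _ cont (df := fun y : R => tau * y `^ (tau - 1)).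
  by rewrite in_itv/= => /andP[xy _]; apply: d; exact: lt_trans xy.
by rewrite in_itv/= => /andP[xc cq] E; exists c.
Qed.

Lemma powR_half_le (b x q : R) : 0 < x -> x <= q -> q / 2 <= x ->
  x `^ b <= expR (`|b| * ln 2) * q `^ b.
Proof.
move=> x0 xq qx; have q0 : 0 < q by exact: lt_le_trans xq.
rewrite /powR !gt_eqF// -expRD ler_expR -lerBlDr -mulrBr.
apply: le_trans (ler_norm _) _; rewrite normrM ler_wpM2l//.
rewrite distrC ger0_norm; last by rewrite subr_ge0 ler_ln ?posrE.
rewrite lerBlDr -lnM ?posrE// ler_ln ?posrE ?mulr_gt0//.
by move: qx; rewrite ler_pdivrMr// mulrC.
Qed.

Lemma stretched_gt0 (a b c1 tau x : R) : 0 < a -> 0 < x -> 0 < stretched a b c1 tau x.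
Proof. by move=> a0 x0; rewrite /stretched !mulr_gt0 ?powR_gt0 ?expR_gt0. Qed.

(** The polynomial factor changes by a bounded factor as long as [x] is comparable to [q]. *)
Lemma stretched_ratio (a b c1 tau x q : R) : 0 < a -> 0 < x -> x <= q -> q / 2 <= x ->
  stretched a b c1 tau x <=
  expR (`|b| * ln 2) * expR ((q / c1) `^ tau - (x / c1) `^ tau) * stretched a b c1 tau q.
Proof.
move=> a0 x0 xq qx.
have -> : expR (`|b| * ln 2) * expR ((q / c1) `^ tau - (x / c1) `^ tau) * stretched a b c1 tau q =
    a * (expR (`|b| * ln 2) * q `^ b) * expR (- (x / c1) `^ tau).
  rewrite /stretched expRD; set E := expR ((q / c1) `^ tau).
  have -> : expR (- (q / c1) `^ tau) = E^-1 by rewrite expRN.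
  by field; rewrite gt_eqF// expR_gt0.
rewrite /stretched; apply: ler_wpM2r; first exact: expR_ge0.
by apply: ler_wpM2l; [exact: ltW|exact: powR_half_le].
Qed.

End StretchedRatio.

Section SecondMoment.
Context (R : realType) (d : measure_display) (T : measurableType d)
  (P : probability T R) (W : {RV P >-> R}).

(** Each term beyond [N] is at most [3 j^(-2)], compared with the telescoping sum of
    [6 / (j (j + 1))]. *)
Lemma partial_sum_bound (f : nat -> R) (N : nat) : (0 < N)%N ->
  (forall k, 0 <= f k <= 1) -> (forall k, (N <= k)%N -> f k <= (k%:R ^+ 3)^-1) ->
  forall n, \sum_(0 <= k < n) (2 * k%:R + 1) * f k <=
    \sum_(0 <= k < N) (2 * k%:R + 1) + 6.
Proof.
move=> N0 f01 fN n.
have f0 k : 0 <= (2 * k%:R + 1) * f k.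
  by rewrite mulr_ge0 ?addr_ge0 ?mulr_ge0//; case/andP: (f01 k).
have f1 k : (2 * k%:R + 1) * f k <= 2 * k%:R + 1.
  by rewrite ler_piMr ?addr_ge0 ?mulr_ge0//; case/andP: (f01 k).
have [nN|Nn] := leqP n N.
  apply: (@le_trans _ _ (\sum_(0 <= k < N) (2 * k%:R + 1))).
    rewrite (@big_cat_nat _ _ _ n 0 N)//=.
    apply: ler_wpDr; first by apply: sumr_ge0 => k _; rewrite addr_ge0 ?mulr_ge0.
    by apply: ler_sum => k _; exact: f1.
  by rewrite lerDl.
rewrite (@big_cat_nat _ _ _ N 0 n)//=; last exact: ltnW.
apply: lerD.
  by apply: ler_sum => k _; exact: f1.
suff : \sum_(N <= k < n) (2 * k%:R + 1) * f k <= 6 * ((N%:R)^-1 - (n%:R)^-1).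
  move=> h; apply: le_trans h _; rewrite -[leRHS]mulr1 ler_wpM2l// lerBlDr.
  apply: ler_wpDr; first by rewrite invr_ge0.
  by rewrite invf_le1 ?ler1n ?ltr0n.
rewrite -(subnKC (ltnW Nn)); elim: (n - N)%N => [|k IH].
  by rewrite addn0 big_geq// subrr mulr0.
rewrite addnS big_nat_recr/=; last by lia.
have Nk : (N <= N + k)%N by lia.
have := fN _ Nk; have : (0 < N + k)%N by lia.
move: (N + k)%N IH => j IH j0 fj.
have j1 : 1 <= j%:R :> R by rewrite ler1n.
have -> : 6 * ((N%:R)^-1 - (j.+1%:R)^-1) =
   6 * ((N%:R)^-1 - (j%:R)^-1) + 6 / (j%:R * (j%:R + 1)) :> R.
  rewrite mulrSr; move: (N%:R^-1) => z; field; rewrite !gt_eqF//; lra.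
apply: lerD => //.
apply: (@le_trans _ _ ((2 * j%:R + 1) * (j%:R ^+ 3)^-1)).
  by apply: ler_wpM2l => //; rewrite addr_ge0 ?mulr_ge0.
have p1 : 0 < j%:R ^+ 3 :> R by rewrite exprn_gt0//; lra.
rewrite ler_pdivrMr// mulrAC ler_pdivlMr; last by rewrite mulr_gt0//; lra.
move: (j%:R) j1 {fj IH p1} => x x1; rewrite -subr_ge0.
have -> : 6 * x ^+ 3 - (2 * x + 1) * (x * (x + 1)) = x * (x - 1) * (4 * x + 1) by ring.
rewrite !mulr_ge0//; lra.
Qed.

(** The square of [W] is at most the sum of [2 k + 1] over the integers [k <= W]. *)
Lemma second_moment_finite : (forall w, 0 <= W w) ->
  (\forall k \near \oo, tailW W k%:R <= (k%:R ^+ 3)^-1) ->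
  exists sigma2 : R, (\int[P]_w (W w ^+ 2)%:E = sigma2%:E)%E.
Proof.
move=> W0 [N _ hN].
pose g k w : R := (2 * k%:R + 1) * \1_[set w | k%:R <= W w] w.
have mg k : measurable_fun [set: T] (g k).
  by apply: measurable_funM => //; apply: measurable_indic; exact: measurable_ge.
have g0 k w : 0 <= g k w by rewrite mulr_ge0 ?addr_ge0 ?mulr_ge0// indicE.
have bnd : (\int[P]_w (W w ^+ 2)%:E <= \int[P]_w (\sum_(0 <= k <oo) (g k w)%:E))%E.
  apply: ge0_le_integral => //.
  - by move=> w _; rewrite lee_fin sqr_ge0.
  - by apply/measurable_EFinP; apply: measurable_funX.
  - apply: ge0_emeasurable_sum => [k w _ _|k _]; first by rewrite lee_fin.
    exact/measurable_EFinP.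
  move=> w _; pose K := (Num.truncn (W w)).+1.
  apply: (@le_trans _ _ (\sum_(0 <= k < K) (g k w)%:E)%E); last first.
    by apply: nneseries_lim_ge => k _ _; rewrite lee_fin.
  rewrite sumEFin lee_fin.
  have -> : \sum_(0 <= k < K) g k w = \sum_(0 <= k < K) (2 * k%:R + 1).
    rewrite big_nat [RHS]big_nat; apply: eq_bigr => k /andP[_ kK].
    rewrite /g indicE mem_set ?mulr1//=.
    have /andP[h _] := truncn_itv (W0 w); apply: le_trans h.
    by rewrite ler_nat -ltnS.
  have -> : \sum_(0 <= k < K) (2 * k%:R + 1) = K%:R ^+ 2 :> R.
    elim: K => [|k IH]; first by rewrite big_geq// expr0n.
    by rewrite big_nat_recr//= IH -natr1; ring.
  have /andP[_ h] := truncn_itv (W0 w).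
  by rewrite lerXn2r ?nnegrE ?W0// ltW.
pose Bd : R := \sum_(0 <= k < N.+1) (2 * k%:R + 1) + 6.
have fin : (\int[P]_w (W w ^+ 2)%:E <= Bd%:E)%E.
  apply: le_trans bnd _.
  rewrite integral_nneseries//; last 2 first.
  - by move=> k; exact/measurable_EFinP.
  - by move=> k w _; rewrite lee_fin.
  have Ig k : (\int[P]_w (g k w)%:E = ((2 * k%:R + 1) * tailW W k%:R)%:E)%E.
    under eq_integral do rewrite EFinM.
    rewrite ge0_integralZl_EFin ?addr_ge0 ?mulr_ge0//; last first.
      by apply/measurable_EFinP; apply: measurable_indic; exact: measurable_ge.
    by rewrite integral_indic// ?setIT ?EFinM -?PrE//; exact: measurable_ge.
  apply: lime_le.
    by apply: is_cvg_nneseries => k _ _; apply: integral_ge0 => w _; rewrite lee_fin.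
  apply: nearW => n; under eq_bigr do rewrite Ig.
  rewrite sumEFin lee_fin; apply: partial_sum_bound => //.
    by move=> k; rewrite Pr_ge0 Pr_le1//; exact: measurable_ge.
  by move=> k Nk; apply: hN; exact: ltnW.
exists (fine (\int[P]_w (W w ^+ 2)%:E)%E); rewrite fineK// ge0_fin_numE.
  exact: le_lt_trans fin (ltry _).
by apply: integral_ge0 => w _; rewrite lee_fin sqr_ge0.
Qed.

End SecondMoment.

(** * Quantiles, spacings and the construction of regimes *)

Section CommonTail.
Context (R : realType).

(** Logarithm of the prefactor [a x^b] of the tail at the leading order of the quantile,
    where [ell] is the logarithm of the number of vertices. *)
Definition correction (a b c1 tau ell : R) : R := b / tau * ln ell + b * ln c1 + ln a.

(** Inverse of the derivative of [(x / c1)^tau] at the quantile: moving by one spacing changes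
    the tail by a factor [e]. *)
Definition spacing (c1 tau ell : R) : R := c1 / tau * ell `^ (tau^-1 - 1).

(** The centring [b_RV] is this function of [ln r], and [b_RaV] is its exponential. *)
Definition quantile (a b c1 tau ell : R) : R :=
  c1 * ell `^ tau^-1 + spacing c1 tau ell * correction a b c1 tau ell.

Lemma spacing_gt0 (c1 tau ell : R) : 0 < c1 -> 0 < tau -> 0 < ell ->
  0 < spacing c1 tau ell.
Proof. by move=> c0 t0 l0; rewrite /spacing mulr_gt0 ?divr_gt0 ?powR_gt0. Qed.

Lemma spacing_main (c1 tau ell : R) : 0 < tau -> 0 < ell ->
  c1 * ell `^ tau^-1 = spacing c1 tau ell * (tau * ell).
Proof.
move=> t0 l0; rewrite /spacing powRD; last by rewrite (gt_eqF l0) implybT.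
by rewrite powR_inv1 ?(ltW l0)//; field; rewrite !gt_eqF.
Qed.

Lemma quantileE (a b c1 tau ell : R) : 0 < tau -> 0 < ell ->
  quantile a b c1 tau ell = spacing c1 tau ell * (tau * ell + correction a b c1 tau ell).
Proof. by move=> t0 l0; rewrite /quantile spacing_main// -mulrDr. Qed.

Lemma cvg_sqr_div (u w : nat -> R) (l : R) : u n ^+ 2 / w n @[n --> \oo] --> l ->
  w n @[n --> \oo] --> +oo -> u n / w n @[n --> \oo] --> (0 : R).
Proof.
move=> uw wc; apply: cvg_sqr0; apply: cvg_trans (cvg_div_y uw wc).
apply: near_eq_cvg; near=> n; rewrite /= expr_div_n [w n ^+ 2]expr2 invfM mulrA.
Unshelve. all: by end_near. Qed.

Lemma cvg_mul_sqr0 (u v w : nat -> R) (l : R) :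
  u n ^+ 2 / w n @[n --> \oo] --> (0 : R) -> v n ^+ 2 / w n @[n --> \oo] --> l ->
  (\forall n \near \oo, 0 < w n) -> u n * v n / w n @[n --> \oo] --> (0 : R).
Proof.
move=> hu hv w0; apply: cvg_sqr0; rewrite -(mul0r l); apply: cvg_trans (cvgM hu hv).
apply: near_eq_cvg; near=> n; have wn : 0 < w n by near: n.
by rewrite /=; field; rewrite gt_eqF.
Unshelve. all: by end_near. Qed.

Lemma correction_small (a b c1 tau : R) (ell : nat -> R) : ell n @[n --> \oo] --> +oo ->
  correction a b c1 tau (ell n) ^+ 2 / ell n @[n --> \oo] --> (0 : R).
Proof.
move=> hl; under eq_cvg => n do rewrite /correction -addrA.
exact: cvg_affine_ln_sqr.
Qed.

Lemma quantile_equiv (a b c1 tau : R) (ell : nat -> R) : 0 < c1 -> 0 < tau ->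
  ell n @[n --> \oo] --> +oo ->
  quantile a b c1 tau (ell n) / (spacing c1 tau (ell n) * (tau * ell n)) @[n --> \oo] --> (1 : R).
Proof.
move=> c0 t0 hl.
have h : 1 + tau^-1 * (correction a b c1 tau (ell n) / ell n) @[n --> \oo] --> 1 + tau^-1 * 0.
  apply: cvgD; first exact: cvg_cst.
  by apply: cvgMr; apply: cvg_sqr_div (correction_small _ _ _ _ hl) hl.
rewrite mulr0 addr0 in h; apply: cvg_trans h; apply: near_eq_cvg; near=> n.
have l0 : 0 < ell n by near: n; exact: near_large.
have p0 := spacing_gt0 c0 t0 l0.
by rewrite /= quantileE//; field; rewrite !gt_eqF.
Unshelve. all: by end_near. Qed.

Lemma cvg_sqr_bounded (u w : nat -> R) (l : R) : u n @[n --> \oo] --> l ->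
  w n @[n --> \oo] --> +oo -> u n ^+ 2 / w n @[n --> \oo] --> (0 : R).
Proof.
move=> ul wc; apply: (@cvg_div_y _ _ _ (l * l)) wc.
by under eq_cvg => n do rewrite expr2; apply: cvgM.
Qed.

Variables (a b c1 tau : R) (h : R -> R).
Hypotheses (a0 : 0 < a) (c0 : 0 < c1) (tau0 : 0 < tau)
  (hh : h x / stretched a b c1 tau x @[x --> +oo] --> (1 : R)).

Lemma stretched_factor2 : exists2 X0, 0 < X0 & forall x, X0 <= x ->
  stretched a b c1 tau x / 2 <= h x <= 2 * stretched a b c1 tau x.
Proof.
have : \forall x \near +oo, `|1 - h x / stretched a b c1 tau x| < 1 / 2.
  by move/cvgrPdist_lt: hh; apply; lra.
case=> M [_ hM]; exists (Num.max M 0 + 1); first by rewrite ltr_wpDl// le_max lexx orbT.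
move=> x xM.
have x0 : 0 < x by apply: lt_le_trans xM; rewrite ltr_wpDl// le_max lexx orbT.
have := hM x; have Mx : M < x by apply: lt_le_trans xM; rewrite ltr_pwDr// le_max lexx.
move=> /(_ Mx).
have s0 := stretched_gt0 b c1 tau a0 x0.
move=> /ltr_normlP[z1 z2].
have hE : h x = h x / stretched a b c1 tau x * stretched a b c1 tau x.
  by rewrite divfK// gt_eqF.
rewrite {}hE; set y := stretched a b c1 tau x in s0 z1 z2 *; set z := h x / y in z1 z2 *.
rewrite -[y / 2]mulrC !ler_pM2r//.
apply/andP; split; lra.
Qed.

(** The tail lies within a factor [2] of the stretched exponential; two such factors
    give the constant [4]. *)
Lemma tail_ratio_bound : exists2 X0, 0 < X0 & forall x q, X0 <= x -> x <= q -> q / 2 <= x ->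
  h x <= 4 * expR (`|b| * ln 2) * expR ((q / c1) `^ tau - (x / c1) `^ tau) * h q.
Proof.
have [X0 X00 hX] := stretched_factor2; exists X0 => // x q Xx xq qx.
have /andP[_ h1] := hX x Xx; have /andP[h2 _] := hX q (le_trans Xx xq).
apply: (le_trans h1).
have x0 : 0 < x by exact: lt_le_trans Xx.
have := stretched_ratio b c1 tau a0 x0 xq qx.
set E := expR (`|b| * ln 2) * _ => h3.
have E0 : 0 <= E by rewrite mulr_ge0 ?expR_ge0.
rewrite -(mulrA 4) -/E; have h4 := ler_wpM2l E0 h2.
move: h3 h4; move: (stretched _ _ _ _ x) (stretched _ _ _ _ q) (h q) {h1 h2 E0} E.
move=> z1 z2 z3 E *; lra.
Qed.

(** The displacement [y] may be unbounded, and only its difference from a reference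
    sequence [D] has to converge; in the application [D] is the logarithm of the ratio of the
    age to its leading order. *)
Lemma tail_at_quantile (ell y D : nat -> R) (beta delta : R) :
  ell n @[n --> \oo] --> +oo -> y n ^+ 2 / ell n @[n --> \oo] --> beta ->
  y n - D n @[n --> \oo] --> delta ->
  expR (ell n + D n) *
    h (quantile a b c1 tau (ell n) + spacing c1 tau (ell n) * y n) @[n --> \oo] -->
  expR (- ((tau - 1) * beta / (2 * tau)) - delta).
Proof.
move=> hl hy hD.
have [hx hs] := stretched_cvg b a0 c0 tau0 hl hy.
set x := fun n => _ in hx.
have h1 : h (x n) / stretched a b c1 tau (x n) @[n --> \oo] --> (1 : R).
  exact: (cvg_comp _ _ hx hh).
have h2 : expR (- (y n - D n)) @[n --> \oo] --> expR (- delta).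
  by apply: continuous_cvg; [exact: continuous_expR|exact: cvgN].
rewrite expRD -[X in X * _]mulr1.
apply: cvg_trans (cvgM (cvgM hs h1) h2); apply: near_eq_cvg; near=> n.
have x0 : 0 < x n by near: n; exact: near_large.
have s0 := stretched_gt0 b c1 tau a0 x0.
have xE : quantile a b c1 tau (ell n) + spacing c1 tau (ell n) * y n = x n.
  by rewrite /quantile -addrA -mulrDr.
rewrite xE /= -/(x n).
have -> : ell n + D n = (ell n + y n) + - (y n - D n) by ring.
rewrite [expR (_ + - _)]expRD; field; by rewrite gt_eqF.
Unshelve. all: by end_near. Qed.

End CommonTail.

Section RegimeIntro.
Context (R : realType) (d : measure_display) (T : measurableType d)
  (P : probability T R) (W : {RV P >-> R}).

(** Some of the conditions on a regime follow from the others, and the uniform tail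
    condition follows from its version along sequences. *)
Lemma regime_intro (s t kappa C0 Lam : R) (r a b L : nat -> R) : 0 < s ->
  r n @[n --> \oo] --> +oo -> (\forall n \near \oo, t * r n <= n%:R) ->
  a n @[n --> \oo] --> +oo -> L n @[n --> \oo] --> +oo ->
  (ln n%:R - ln (r n)) / L n @[n --> \oo] --> (1 : R) ->
  b n / (a n * L n) @[n --> \oo] --> (1 : R) ->
  b n * L n / ln n%:R @[n --> \oo] --> +oo -> s <= t ->
  (forall (y : R) (v : nat -> R), (forall n, s <= v n <= t) ->
     r n * v n * tailW W (weight_level (b n) (a n) (L n) (ln n%:R - ln (r n)) y (v n))
       @[n --> \oo] --> kappa * expR (- y)) ->
  (\forall n \near \oo, forall q x, b n / 2 <= q <= 2 * b n -> q / 2 <= x <= q ->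
    tailW W x <= C0 * expR (Lam * (q - x) / a n) * tailW W q) ->
  regime W s t kappa C0 Lam r a b L.
Proof.
move=> s0 hr hrn ha hL hLn hba hbL st htail hratio.
have a0 : \forall n \near \oo, 0 < a n by exact: near_large.
have L0 : \forall n \near \oo, 0 < L n by exact: near_large.
split => //.
- have h := cvg_div_y hba ha; apply: cvg_trans h; apply: near_eq_cvg; near=> n.
  have an : 0 < a n by near: n. have Ln : 0 < L n by near: n.
  by rewrite /=; field; rewrite !gt_eqF.
- have h : (b n / (a n * L n))^-1 / L n @[n --> \oo] --> (0 : R).
    apply: cvg_div_y hL; have := cvgV (oner_neq0 R) hba; by rewrite invr1; exact.
  apply: cvg_trans h; apply: near_eq_cvg; near=> n.
  have an : 0 < a n by near: n. have Ln : 0 < L n by near: n.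
  have bn : 0 < b n / (a n * L n) by near: n; exact: near_gt hba ltr01.
  rewrite pmulr_lgt0 ?invr_gt0 ?mulr_gt0// in bn.
  by rewrite /=; field; rewrite !gt_eqF.
- move=> y e e0.
  pose F n v := r n * v * tailW W (weight_level (b n) (a n) (L n) (ln n%:R - ln (r n)) y v)
    - kappa * expR (- y).
  apply: (uniform_of_sequences st (F := F)) e0 => v hv.
  by rewrite /F; apply/subr_cvg0; exact: htail.
Unshelve. all: by end_near. Qed.

End RegimeIntro.

(** * Stretched exponential weights *)

Section StretchedRegime.
Context (R : realType) (d : measure_display) (T : measurableType d)
  (P : probability T R) (W : {RV P >-> R}).

Lemma bounded_cvg_div (v w : nat -> R) (V : R) : (forall n, `|v n| <= V) ->
  w n @[n --> \oo] --> +oo -> v n / w n @[n --> \oo] --> (0 : R).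
Proof.
move=> vV wc; apply/cvgrPdist_le => e e0; near=> n.
have wn : V / e < w n by near: n; exact: near_large.
have w0 : 0 < w n by near: n; exact: near_large.
rewrite sub0r normrN normrM normfV (gtr0_norm w0) ler_pdivrMr//.
by apply: le_trans (vV n) _; move: wn; rewrite ltr_pdivrMr// mulrC => /ltW.
Unshelve. all: by end_near. Qed.

Lemma ln_bounded (s t : R) (v : nat -> R) : 0 < s -> (forall n, s <= v n <= t) ->
  forall n, `|ln (v n)| <= `|ln s| + `|ln t|.
Proof. by move=> s0 hv n; exact: ln_window. Qed.

(** The displacement of the weight level from the quantile, in units of spacing, minus [D].
    All terms on the right converge once divided by [N]. *)
Lemma standardized_level (sp L e y D N : R) : 0 < sp -> 0 < N -> 0 < L - D ->
  ((sp * (L + e) + y * sp) * L / (L - D) - sp * (L + e)) / sp - D =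
  (y * (L / N) + D * e / N + D ^+ 2 / N) / (L / N - D / N).
Proof.
move=> sp0 N0 LD; have h : 0 < L / N - D / N by rewrite -mulrBl divr_gt0.
by field; rewrite !gt_eqF//= -mulrBl divr_gt0.
Qed.

(** Mean value theorem; [ell^(1 / tau)] is the order of magnitude of [x / c1]. *)
Lemma power_increment (c1 tau ell x q A : R) : 0 < c1 -> 0 < tau -> 0 < ell ->
  0 < x -> x <= q ->
  (forall z, x / c1 <= z -> z <= q / c1 -> z `^ (tau - 1) <= A * (ell `^ tau^-1) `^ (tau - 1)) ->
  (q / c1) `^ tau - (x / c1) `^ tau <= A * (q - x) / spacing c1 tau ell.
Proof.
move=> c0 t0 l0 x0 xq hA.
have ci0 : 0 <= c1^-1 by rewrite invr_ge0 ltW.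
have xc : 0 < x / c1 by rewrite divr_gt0.
have [z [z1 z2 ->]] := powR_diff tau xc (ler_wpM2r ci0 xq).
have -> : A * (q - x) / spacing c1 tau ell =
    tau * (A * (ell `^ tau^-1) `^ (tau - 1)) * (q / c1 - x / c1).
  have -> : (ell `^ tau^-1) `^ (tau - 1) = ell `^ (- (tau^-1 - 1)).
    by rewrite -powRrM; congr (_ `^ _); field; rewrite gt_eqF.
  rewrite /spacing powRN.
  by field; rewrite !gt_eqF// powR_gt0.
apply: ler_wpM2r; first by rewrite -mulrBl mulr_ge0// subr_ge0.
by apply: ler_wpM2l; [exact: ltW|exact: hA].
Qed.

Variables (s t a b c1 tau zeta0 : R) (l : nat -> R).
Hypotheses (s0 : 0 < s) (st : s <= t) (a0 : 0 < a) (c0 : 0 < c1) (tau01 : 0 < tau < 1)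
  (htail : tail_RV W a b c1 tau) (l0 : forall n, (0 < n)%N -> 0 < l n)
  (hl : ln (l n) ^+ 2 / ln n%:R @[n --> \oo] --> zeta0).

Let gamma := (tau + 1)^-1.
Let N (n : nat) : R := ln n%:R.
Let ell n := gamma * N n.
Let L n := (1 - gamma) * N n.
Let rr n := l n * n%:R `^ gamma.
Let sp n := spacing c1 tau (ell n).
Let qu n := quantile a b c1 tau (ell n).
Let co n := correction a b c1 tau (ell n).

Let tau0 : 0 < tau. Proof. by case/andP: tau01. Qed.
Let gamma0 : 0 < gamma. Proof. by rewrite /gamma invr_gt0 addr_gt0. Qed.
Let gamma1 : 1 - gamma = tau * gamma.
Proof. by have := tau0; rewrite /gamma => h; field; rewrite gt_eqF// addr_gt0. Qed.
Let gamma1_gt0 : 0 < 1 - gamma. Proof. by rewrite gamma1 mulr_gt0. Qed.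
Let Noo : N n @[n --> \oo] --> +oo. Proof. by apply: cvgy_ln; exact: cvgr_idn. Qed.
Let elloo : ell n @[n --> \oo] --> +oo. Proof. exact: cvgyZ. Qed.
Let Loo : L n @[n --> \oo] --> +oo. Proof. exact: cvgyZ. Qed.
Let N0 : \forall n \near \oo, 0 < N n. Proof. exact: near_large. Qed.
Let LE n : L n = tau * ell n. Proof. by rewrite /L gamma1 /ell mulrA. Qed.

Let lN : ln (l n) / N n @[n --> \oo] --> (0 : R).
Proof. exact: cvg_sqr_div hl Noo. Qed.

Let quE n : 0 < N n -> qu n = sp n * (L n + co n).
Proof. by move=> Nn; rewrite /qu quantileE// ?mulr_gt0// -LE. Qed.

Let lnr n : (0 < n)%N -> ln (rr n) = ell n + ln (l n).
Proof.
move=> n0; rewrite /rr lnM ?posrE ?l0 ?powR_gt0 ?ltr0n//.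
by rewrite ln_powR addrC.
Qed.

Let rE n : (0 < n)%N -> rr n = expR (ell n + ln (l n)).
Proof.
by move=> n0; rewrite -lnr// lnK// posrE mulr_gt0 ?l0 ?powR_gt0 ?ltr0n.
Qed.

Let sp_oo : sp n @[n --> \oo] --> +oo.
Proof.
rewrite /sp /spacing; apply: cvgyZ; first by rewrite divr_gt0.
apply: cvgy_powR => //; rewrite subr_gt0 invf_gt1//; by case/andP: tau01.
Qed.

Let qu_equiv : qu n / (sp n * L n) @[n --> \oo] --> (1 : R).
Proof.
have h := quantile_equiv a b c0 tau0 elloo; apply: cvg_trans h.
by apply: near_eq_cvg; near=> n; rewrite /= LE.
Unshelve. all: by end_near. Qed.

Let spL_oo : sp n * L n @[n --> \oo] --> +oo.
Proof.
apply: ger_cvgy sp_oo; near=> n.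
have L1 : 1 < L n by near: n; exact: near_large.
have spn : 0 < sp n by near: n; exact: near_large.
by rewrite ler_peMr// ltW.
Unshelve. all: by end_near. Qed.

Let qu_oo : qu n @[n --> \oo] --> +oo.
Proof.
apply: cvg_trans (cvgyM ltr01 qu_equiv spL_oo); apply: near_eq_cvg; near=> n.
have L0 : 0 < L n by near: n; exact: near_large.
have spn : 0 < sp n by near: n; exact: near_large.
by rewrite /= divfK// gt_eqF// mulr_gt0.
Unshelve. all: by end_near. Qed.

Let RV_tail (y : R) (v : nat -> R) : (forall n, s <= v n <= t) ->
  rr n * v n * tailW W (weight_level (qu n) (sp n) (L n) (N n - ln (rr n)) y (v n))
    @[n --> \oo] --> expR (- (zeta0 * (tau + 1) ^+ 2 / (2 * tau))) * expR (- y).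
Proof.
move=> hv.
pose D n := ln (l n) + ln (v n).
pose yn n := (weight_level (qu n) (sp n) (L n) (N n - ln (rr n)) y (v n) - qu n) / sp n.
have vN : ln (v n) / N n @[n --> \oo] --> (0 : R).
  by apply: bounded_cvg_div Noo; exact: ln_bounded s0 hv.
have DN : D n / N n @[n --> \oo] --> (0 : R).
  rewrite -[X in _ --> X]addr0; under eq_cvg => n do rewrite /D mulrDl.
  exact: cvgD.
have v2N : ln (v n) ^+ 2 / N n @[n --> \oo] --> (0 : R).
  apply: (@bounded_cvg_div (fun n => ln (v n) ^+ 2) N ((`|ln s| + `|ln t|) ^+ 2)) => // n.
  by rewrite normrX lerXn2r ?nnegrE ?addr_ge0//; exact: ln_bounded s0 hv _.
have D2N : D n ^+ 2 / N n @[n --> \oo] --> zeta0.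
  by under eq_cvg => n do rewrite /D addrC; apply: cvg_sqrD.
have coN : co n ^+ 2 / N n @[n --> \oo] --> (0 : R).
  have h : gamma * (co n ^+ 2 / ell n) @[n --> \oo] --> gamma * 0.
    by apply: cvgMr; exact: correction_small.
  rewrite mulr0 in h.
  apply: cvg_trans h; apply: near_eq_cvg; near=> n.
  have Nn : 0 < N n by near: n.
  by rewrite /= -/(co n) /ell; field; rewrite !gt_eqF.
have Dco : D n * co n / N n @[n --> \oo] --> (0 : R).
  under eq_cvg => n do rewrite [D n * _]mulrC.
  exact: cvg_mul_sqr0 coN D2N N0.
(* [standardized_level] with all terms divided by [N]: only [y L] and [D^2] survive. *)
have yD : yn n - D n @[n --> \oo] --> y + zeta0 / (1 - gamma).
  have -> : y + zeta0 / (1 - gamma) = (y * (1 - gamma) + 0 + zeta0) / ((1 - gamma) - 0).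
    by rewrite subr0; field; rewrite gt_eqF.
  have h : (y * (1 - gamma) + D n * co n / N n + D n ^+ 2 / N n) / ((1 - gamma) - D n / N n)
      @[n --> \oo] --> (y * (1 - gamma) + 0 + zeta0) / ((1 - gamma) - 0).
    apply: cvgM; first by apply: cvgD => //; apply: cvgD => //; exact: cvg_cst.
    apply: cvgV; first by rewrite subr0 gt_eqF.
    by apply: cvgB => //; exact: cvg_cst.
  apply: cvg_trans h; apply: near_eq_cvg; near=> n.
  have n0 : (0 < n)%N by near: n; exact: nbhs_infty_gt.
  have Nn : 0 < N n by near: n.
  have spn : 0 < sp n by near: n; exact: near_large.
  have DNn : D n / N n < 1 - gamma by near: n; exact: near_lt DN _.
  have LD : 0 < L n - D n.
    by move: DNn; rewrite ltr_pdivrMr// -subr_gt0.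
  have LN : L n / N n = 1 - gamma by rewrite /L mulfK// gt_eqF.
  have := standardized_level (co n) y spn Nn LD; rewrite LN /= => <-.
  rewrite /yn /weight_level lnr// quE//; congr ((_ * _ / _ - _) / _ - _).
  by rewrite /L /ell /D; ring.
have y2 : yn n ^+ 2 / ell n @[n --> \oo] --> zeta0 / gamma.
  under eq_cvg => n do rewrite -(subrK (D n) (yn n)).
  apply: cvg_sqrD; first exact: cvg_sqr_bounded yD elloo.
    under eq_cvg => n do rewrite /ell invfM [_^-1 * _]mulrC mulrA.
    exact: cvgMl.
  exact: near_large.
have h := tail_at_quantile a0 c0 tau0 htail elloo y2 yD.
have -> : expR (- (zeta0 * (tau + 1) ^+ 2 / (2 * tau))) * expR (- y) =
    expR (- ((tau - 1) * (zeta0 / gamma) / (2 * tau)) - (y + zeta0 / (1 - gamma))).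
  have t0 := tau0.
  rewrite -expRD gamma1 /gamma; congr expR; field.
  by rewrite !gt_eqF// ?addr_gt0.
apply: cvg_trans h; apply: near_eq_cvg; near=> n.
have n0 : (0 < n)%N by near: n; exact: nbhs_infty_gt.
have spn : 0 < sp n by near: n; exact: near_large.
have v0 : 0 < v n by apply: lt_le_trans s0 _; case/andP: (hv n).
have -> : rr n * v n = expR (ell n + D n) by rewrite rE// addrA [RHS]expRD lnK ?posrE.
rewrite /=; congr (_ * tailW W _).
by rewrite -/(sp n) -/(qu n) /yn mulrC divfK ?gt_eqF// addrC subrK.
Unshelve. all: by end_near. Qed.

(** Since [tau < 1], the derivative of [(x / c1)^tau] is largest at the left end, which is at
    least an eighth of [ell^(1 / tau)]; this is where [8^(1 - tau)] comes from. *)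
Lemma regime_RV : regime W s t (expR (- (zeta0 * (tau + 1) ^+ 2 / (2 * tau))))
  (4 * expR (`|b| * ln 2)) (8 `^ (1 - tau)) rr sp qu L.
Proof.
have ellr : (ell n + ln (l n)) / N n @[n --> \oo] --> gamma.
  rewrite -[X in _ --> X]addr0; have h : gamma + ln (l n) / N n @[n --> \oo] --> gamma + 0.
    by apply: cvgD => //; exact: cvg_cst.
  apply: cvg_trans h; apply: near_eq_cvg; near=> n.
  have Nn : 0 < N n by near: n.
  by rewrite /= mulrDl /ell mulfK// gt_eqF.
apply: regime_intro => //.
- have h := cvgy_expR (cvgyM gamma0 ellr Noo); apply: cvg_trans h.
  apply: near_eq_cvg; near=> n.
  have n0 : (0 < n)%N by near: n; exact: nbhs_infty_gt.
  have Nn : 0 < N n by near: n.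
  by rewrite /= rE// divfK// gt_eqF.
- have t0 : 0 < t by exact: lt_le_trans st.
  have h : (ell n + ln (l n)) / N n + ln t / N n @[n --> \oo] --> gamma + 0.
    by apply: cvgD => //; exact: (bounded_cvg_div (fun=> lexx `|ln t|) Noo).
  rewrite addr0 in h; near=> n.
  have n0 : (0 < n)%N by near: n; exact: nbhs_infty_gt.
  have Nn : 0 < N n by near: n.
  have : (ell n + ln (l n)) / N n + ln t / N n < 1.
    by near: n; apply: near_lt h _; move: gamma1_gt0; rewrite subr_gt0.
  rewrite -mulrDl ltr_pdivrMr// mul1r => h1.
  rewrite rE// -{1}[t]lnK ?posrE// -expRD -[leRHS]lnK ?posrE ?ltr0n//.
  by rewrite ler_expR addrC ltW.
- have h : 1 - (1 - gamma)^-1 * (ln (l n) / N n) @[n --> \oo] --> 1 - (1 - gamma)^-1 * 0.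
    by apply: cvgB; [exact: cvg_cst|exact: cvgMr].
  rewrite mulr0 subr0 in h; apply: cvg_trans h; apply: near_eq_cvg; near=> n.
  have n0 : (0 < n)%N by near: n; exact: nbhs_infty_gt.
  have Nn : 0 < N n by near: n.
  have g1 := gamma1_gt0.
  by rewrite /= lnr// -/(N n) /L /ell; field; rewrite !gt_eqF.
- have h1 : qu n / (sp n * L n) * (1 - gamma) @[n --> \oo] --> 1 * (1 - gamma) by exact: cvgMl.
  rewrite mul1r in h1; apply: cvg_trans (cvgyM gamma1_gt0 h1 spL_oo).
  apply: near_eq_cvg; near=> n.
  have Nn : 0 < N n by near: n.
  have spn : 0 < sp n by near: n; exact: near_large.
  have g1 := gamma1_gt0.
  by rewrite /= -/(N n) /L; field; rewrite !gt_eqF.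
have [X0 X00 hX] := tail_ratio_bound a0 htail.
near=> n => q x /andP[q1 q2] /andP[x1 x2].
have Nn : 0 < N n by near: n.
have spn : 0 < sp n by near: n; exact: near_large.
have ln0 : 0 < ell n by rewrite mulr_gt0.
have quX : 4 * X0 < qu n by near: n; exact: near_large.
have quL : 1 / 2 < qu n / (sp n * L n) by near: n; apply: near_gt qu_equiv _; lra.
have x0 : X0 <= x by lra.
apply: le_trans (hX x q x0 x2 x1) _.
rewrite -!mulrA; apply: ler_wpM2l => //; apply: ler_wpM2l; first exact: expR_ge0.
apply: ler_wpM2r; first exact: Pr_ge0.
rewrite ler_expR.
have x00 : 0 < x by exact: lt_le_trans x0.
have p0 : 0 < ell n `^ tau^-1 by rewrite powR_gt0.
have t01 := tau01; have t0 := tau0.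
rewrite [leRHS]mulrA; apply: power_increment => // z z1 _.
have xlow : c1 * ell n `^ tau^-1 / 8 <= x.
  rewrite spacing_main// -/(sp n) -LE.
  have spL : 0 < sp n * L n by rewrite mulr_gt0// LE mulr_gt0.
  move: quL; rewrite ltr_pdivlMr// => quL.
  move: (sp n * L n) quL spL q1 x1 {quX q2 x2 x0 z1} => *; lra.
have zlow : 8^-1 * ell n `^ tau^-1 <= z.
  apply: le_trans z1; rewrite ler_pdivlMr// mulrC mulrA.
  by apply: le_trans xlow; rewrite mulrAC.
have i8 : 0 < 8^-1 :> R by rewrite invr_gt0.
have -> : 8 `^ (1 - tau) * (ell n `^ tau^-1) `^ (tau - 1) = (8^-1 * ell n `^ tau^-1) `^ (tau - 1).
  rewrite (powRM (tau - 1) (ltW i8) (ltW p0)); congr (_ * _).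
  by rewrite -powR_inv1// -powRrM mulN1r opprB.
have z0 : 0 < z by apply: lt_le_trans zlow; rewrite mulr_gt0.
rewrite -(opprB 1 tau) !powRN lef_pV2 ?posrE ?powR_gt0 ?mulr_gt0//.
apply: ge0_ler_powR => //; rewrite ?nnegrE ?(ltW z0) ?mulr_ge0 ?(ltW i8) ?(ltW p0)//.
by rewrite subr_ge0 ltW//; case/andP: t01.
Unshelve. all: by end_near. Qed.

End StretchedRegime.

(** * Log-stretched exponential weights *)

Section LogStretchedRegime.
Context (R : realType) (d : measure_display) (T : measurableType d)
  (P : probability T R) (W : {RV P >-> R}).

Lemma bounded_cvg_mul (v z : nat -> R) (V : R) : (forall n, `|v n| <= V) ->
  z n @[n --> \oo] --> (0 : R) -> v n * z n @[n --> \oo] --> (0 : R).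
Proof.
move=> vV zc; have V0 : 0 <= V := le_trans (normr_ge0 _) (vV 0).
apply/cvgrPdist_le => e e0; near=> n.
have zn : `|z n| < e / (V + 1).
  near: n; move/cvgrPdist_lt: zc => /(_ (e / (V + 1))); rewrite divr_gt0 ?ltr_wpDl// => /(_ isT).
  by apply: filterS => n; rewrite sub0r normrN.
rewrite sub0r normrN normrM; apply: (@le_trans _ _ (V * (e / (V + 1)))).
  by apply: ler_pM => //; exact: ltW.
by rewrite mulrA ler_pdivrMr ?ltr_wpDl// mulrC ler_wpM2l ?(ltW e0)// lerDl.
Unshelve. all: by end_near. Qed.

Lemma ln1D_small (z w : nat -> R) : (\forall n \near \oo, 0 < w n) ->
  z n @[n --> \oo] --> (0 : R) -> z n ^+ 2 / w n @[n --> \oo] --> (0 : R) ->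
  (ln (1 + z n) - z n) / w n @[n --> \oo] --> (0 : R).
Proof.
move=> w0 zc z2; apply/cvgrPdist_le => e e0; near=> n.
have wn : 0 < w n by near: n.
have zn : - (1 / 2) <= z n by apply: ltW; near: n; apply: near_gt zc _; lra.
have z2n : z n ^+ 2 / w n < e / 2 by near: n; apply: near_lt z2 _; lra.
rewrite sub0r normrN normrM normfV (gtr0_norm wn) ler_pdivrMr//.
rewrite ltr_pdivrMr// in z2n; have /andP[h1 h2] := ln1D_bounds zn.
rewrite ler_norml; have ew : 0 < e * w n by rewrite mulr_gt0.
apply/andP; split; lra.
Unshelve. all: by end_near. Qed.

(** In the second case [ln W] has a stretched exponential tail. *)
Lemma log_tail (a b c1 tau : R) : tail_RaV W a b c1 tau ->
  tailW W (expR x) / stretched a b c1 tau x @[x --> +oo] --> (1 : R).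
Proof.
move=> htail.
have h : (fun x : R => expR x) x @[x --> +oo] --> +oo.
  apply/cvgryPge => A; near=> x; apply: (@le_trans _ _ (1 + x)); last exact: expR_ge1Dx.
  by rewrite -lerBlDl; near: x; exact: nbhs_pinfty_ge (num_real _).
have h2 := cvg_comp _ _ h htail; apply: cvg_trans h2; apply: near_eq_cvg; near=> x.
by rewrite /= expRK.
Unshelve. all: by end_near. Qed.

Variables (s t a b c1 tau : R).
Hypotheses (s0 : 0 < s) (st : s <= t) (a0 : 0 < a) (c0 : 0 < c1) (tau1 : 1 < tau)
  (htail : tail_RaV W a b c1 tau).

Let N (n : nat) : R := ln n%:R.
Let B n := quantile a b c1 tau (N n).
Let L n := tau * N n / B n.
Let ell n := N n - L n.
Let rr n := expR (- L n) * n%:R.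
Let al n := spacing c1 tau (ell n).
Let qu n := quantile a b c1 tau (ell n).
Let bb n := expR (qu n).
Let aa n := al n * bb n.

Let tau0 : 0 < tau. Proof. exact: lt_trans tau1. Qed.
Let Noo : N n @[n --> \oo] --> +oo. Proof. by apply: cvgy_ln; exact: cvgr_idn. Qed.
Let N0 : \forall n \near \oo, 0 < N n. Proof. exact: near_large. Qed.

Let main_oo (u : nat -> R) : u n @[n --> \oo] --> +oo ->
  spacing c1 tau (u n) * (tau * u n) @[n --> \oo] --> +oo.
Proof.
move=> uoo.
have h : c1 * u n `^ tau^-1 @[n --> \oo] --> +oo.
  by apply: cvgyZ => //; apply: cvgy_powR => //; rewrite invr_gt0.
apply: cvg_trans h; apply: near_eq_cvg; near=> n.
have u0 : 0 < u n by near: n; exact: near_large.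
by rewrite /= spacing_main.
Unshelve. all: by end_near. Qed.

Let quantile_oo (u : nat -> R) : u n @[n --> \oo] --> +oo ->
  quantile a b c1 tau (u n) @[n --> \oo] --> +oo.
Proof.
move=> uoo; have h := quantile_equiv a b c0 tau0 uoo.
apply: cvg_trans (cvgyM ltr01 h (main_oo uoo)); apply: near_eq_cvg; near=> n.
have u0 : 0 < u n by near: n; exact: near_large.
by rewrite /= divfK// gt_eqF// mulr_gt0 ?spacing_gt0 ?mulr_gt0.
Unshelve. all: by end_near. Qed.

Let Boo : B n @[n --> \oo] --> +oo. Proof. exact: quantile_oo. Qed.
Let B0 : \forall n \near \oo, 0 < B n. Proof. exact: near_large. Qed.

Let LN : L n / N n @[n --> \oo] --> (0 : R).
Proof.
apply: cvg_trans (cvg_div_y (@cvg_cst _ tau _ \oo _) Boo); apply: near_eq_cvg; near=> n.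
have Nn : 0 < N n by near: n. have Bn : 0 < B n by near: n.
by rewrite /= /L; field; rewrite !gt_eqF.
Unshelve. all: by end_near. Qed.

Let ellN : ell n / N n @[n --> \oo] --> (1 : R).
Proof.
have h : 1 - L n / N n @[n --> \oo] --> (1 : R) - 0 by apply: cvgB => //; exact: cvg_cst.
rewrite subr0 in h; apply: cvg_trans h; apply: near_eq_cvg; near=> n.
have Nn : 0 < N n by near: n.
by rewrite /= /ell mulrBl divff// gt_eqF.
Unshelve. all: by end_near. Qed.

Let elloo : ell n @[n --> \oo] --> +oo.
Proof.
apply: cvg_trans (cvgyM ltr01 ellN Noo); apply: near_eq_cvg; near=> n.
have Nn : 0 < N n by near: n.
by rewrite /= divfK// gt_eqF.
Unshelve. all: by end_near. Qed.

Let ell0 : \forall n \near \oo, 0 < ell n. Proof. exact: near_large. Qed.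
Let al0 : \forall n \near \oo, 0 < al n.
Proof.
near=> n; have h : 0 < ell n by near: n.
exact: spacing_gt0.
Unshelve. all: by end_near. Qed.

Let alL : al n * L n @[n --> \oo] --> (1 : R).
Proof.
have h : (B n / (spacing c1 tau (N n) * (tau * N n)))^-1 * (ell n / N n) `^ (tau^-1 - 1)
    @[n --> \oo] --> 1^-1 * (1 : R).
  apply: cvgM; last exact: cvg_powR1.
  by apply: cvgV; [exact: oner_neq0|exact: quantile_equiv].
rewrite invr1 mulr1 in h; apply: cvg_trans h; apply: near_eq_cvg; near=> n.
have Nn : 0 < N n by near: n. have Bn : 0 < B n by near: n.
have ln0 : 0 < ell n by near: n.
have sN := spacing_gt0 c0 tau0 Nn.
have -> : al n = spacing c1 tau (N n) * (ell n / N n) `^ (tau^-1 - 1).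
  have e0 : 0 <= ell n / N n by rewrite divr_ge0 ?(ltW ln0) ?(ltW Nn).
  rewrite /al /spacing -[RHS]mulrA -(powRM _ (ltW Nn) e0); congr (_ * _ `^ _).
  by rewrite mulrCA divff ?gt_eqF// mulr1.
have t0 := tau0.
by rewrite /= /L; field; rewrite !gt_eqF.
Unshelve. all: by end_near. Qed.

Let alV : (al n)^-1 @[n --> \oo] --> +oo.
Proof.
have h : tau / c1 * ell n `^ (1 - tau^-1) @[n --> \oo] --> +oo.
  apply: cvgyZ; first by rewrite divr_gt0.
  by apply: cvgy_powR => //; rewrite subr_gt0 invf_lt1.
apply: cvg_trans h; apply: near_eq_cvg; near=> n.
have ln0 : 0 < ell n by near: n.
have t0 := tau0.
rewrite /= /al /spacing -(opprB 1 tau^-1) powRN; field.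
by rewrite !gt_eqF// powR_gt0.
Unshelve. all: by end_near. Qed.

Let al_0 : al n @[n --> \oo] --> (0 : R).
Proof. by have h := cvgyV alV; under eq_cvg => n do rewrite -[al n]invrK. Qed.

Let Loo : L n @[n --> \oo] --> +oo.
Proof.
apply: cvg_trans (cvgyM ltr01 alL alV); apply: near_eq_cvg; near=> n.
have an : 0 < al n by near: n.
by rewrite /= mulrC mulrA mulVf ?gt_eqF// mul1r.
Unshelve. all: by end_near. Qed.

Let L0 : \forall n \near \oo, 0 < L n. Proof. exact: near_large. Qed.

Let quB : qu n / B n @[n --> \oo] --> (1 : R).
Proof.
have h : qu n / (al n * (tau * ell n)) * (al n * L n * (ell n / N n)) @[n --> \oo] -->
    (1 : R) * (1 * 1).
  by apply: cvgM; [exact: quantile_equiv|exact: cvgM].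
rewrite !mulr1 in h; apply: cvg_trans h; apply: near_eq_cvg; near=> n.
have Nn : 0 < N n by near: n. have Bn : 0 < B n by near: n.
have ln0 : 0 < ell n by near: n. have an : 0 < al n by near: n.
have t0 := tau0.
by rewrite /= /L; field; rewrite !gt_eqF.
Unshelve. all: by end_near. Qed.

Let lnNB : ln (N n) / B n @[n --> \oo] --> (0 : R).
Proof.
have pt : 0 < tau^-1 by rewrite invr_gt0.
have uoo := cvgy_powR pt Noo.
have h1 : ln (N n `^ tau^-1) / N n `^ tau^-1 @[n --> \oo] --> (0 : R).
  exact: cvg_sqr_div (cvg_sqr_ln uoo) uoo.
have h : (tau / c1) * (ln (N n `^ tau^-1) / N n `^ tau^-1) *
    (B n / (spacing c1 tau (N n) * (tau * N n)))^-1 @[n --> \oo] --> tau / c1 * 0 * 1^-1.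
  apply: cvgM; first exact: cvgMr.
  by apply: cvgV; [exact: oner_neq0|exact: quantile_equiv].
rewrite mulr0 mul0r in h; apply: cvg_trans h; apply: near_eq_cvg; near=> n.
have Nn : 0 < N n by near: n. have Bn : 0 < B n by near: n.
have t0 := tau0.
rewrite /= -spacing_main// ln_powR; field.
by rewrite !gt_eqF// powR_gt0.
Unshelve. all: by end_near. Qed.

Let bbN : \forall n \near \oo, N n ^+ 2 <= bb n.
Proof.
near=> n.
have Nn : 0 < N n by near: n. have Bn : 0 < B n by near: n.
have h1 : 1 / 2 < qu n / B n by near: n; apply: near_gt quB _; lra.
have h2 : ln (N n) / B n < 1 / 4 by near: n; apply: near_lt lnNB _; lra.
rewrite ltr_pdivlMr// in h1; rewrite ltr_pdivrMr// in h2.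
rewrite -[leLHS]lnK ?posrE ?exprn_gt0// ler_expR lnXn// -mulr_natl.
lra.
Unshelve. all: by end_near. Qed.

Let quoo : qu n @[n --> \oo] --> +oo. Proof. exact: quantile_oo. Qed.
Let bboo : bb n @[n --> \oo] --> +oo. Proof. exact: cvgy_expR. Qed.

Let aaoo : aa n @[n --> \oo] --> +oo.
Proof.
have h : bb n / L n @[n --> \oo] --> +oo.
  apply: ger_cvgy Noo; near=> n.
  have Nn : 0 < N n by near: n. have Ln : 0 < L n by near: n.
  have b2 : N n ^+ 2 <= bb n by near: n.
  have h : L n / N n < 1 by near: n; apply: near_lt LN _.
  rewrite ltr_pdivrMr// mul1r in h.
  rewrite ler_pdivlMr//; apply: le_trans b2; rewrite expr2 ler_pM2l//; exact: ltW.
apply: cvg_trans (cvgyM ltr01 alL h); apply: near_eq_cvg; near=> n.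
have Ln : 0 < L n by near: n.
by rewrite /= /aa; field; rewrite gt_eqF.
Unshelve. all: by end_near. Qed.

Let lnr n : (0 < n)%N -> ln (rr n) = ell n.
Proof. by move=> n0; rewrite /rr lnM ?posrE ?expR_gt0 ?ltr0n// expRK addrC. Qed.

Let rE n : (0 < n)%N -> rr n = expR (ell n).
Proof. by move=> n0; rewrite -lnr// lnK// posrE mulr_gt0 ?expR_gt0 ?ltr0n. Qed.

Let hh := log_tail htail.

Let RaV_tail (y : R) (v : nat -> R) : (forall n, s <= v n <= t) ->
  rr n * v n * tailW W (weight_level (bb n) (aa n) (L n) (N n - ln (rr n)) y (v n))
    @[n --> \oo] --> 1 * expR (- y).
Proof.
move=> hv.
pose V := `|ln s| + `|ln t|.
have lv : forall n, `|ln (v n)| <= V by exact: ln_bounded s0 hv.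
pose x n := weight_level (bb n) (aa n) (L n) (N n - ln (rr n)) y (v n).
pose w n := ln (v n) / L n.
pose yn n := (ln (x n) - qu n) / al n.
have wc : w n @[n --> \oo] --> (0 : R) by exact: bounded_cvg_div lv Loo.
have yalc : y * al n @[n --> \oo] --> (0 : R) by rewrite -(mulr0 y); exact: cvgMr.
have e1 : (ln (1 + y * al n) - y * al n) / al n @[n --> \oo] --> (0 : R).
  apply: ln1D_small => //.
  have h : y ^+ 2 * al n @[n --> \oo] --> y ^+ 2 * 0 by exact: cvgMr.
  rewrite mulr0 in h; apply: cvg_trans h; apply: near_eq_cvg; near=> n.
  have an : 0 < al n by near: n.
  by rewrite /=; field; rewrite gt_eqF.
have iaL : (al n * L n)^-1 @[n --> \oo] --> (1 : R).
  by rewrite -invr1; apply: cvgV => //; exact: oner_neq0.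
have e2 : (ln (1 + - w n) - - w n) / al n @[n --> \oo] --> (0 : R).
  apply: ln1D_small => //; first by rewrite -oppr0; exact: cvgN.
  have h : ln (v n) * w n * (al n * L n)^-1 @[n --> \oo] --> 0 * (1 : R).
    by apply: cvgM => //; exact: bounded_cvg_mul lv wc.
  rewrite mul0r in h; apply: cvg_trans h; apply: near_eq_cvg; near=> n.
  have an : 0 < al n by near: n. have Ln : 0 < L n by near: n.
  by rewrite /= /w; field; rewrite !gt_eqF.
have e3 : ln (v n) * ((al n * L n)^-1 - 1) @[n --> \oo] --> (0 : R).
  by apply: bounded_cvg_mul lv _; rewrite -(subrr 1); apply: cvgB => //; exact: cvg_cst.
have xE : \forall n \near \oo, 0 < x n /\ ln (x n) = qu n + ln (1 + y * al n) - ln (1 + - w n).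
  near=> n.
  have n0 : (0 < n)%N by near: n; exact: nbhs_infty_gt.
  have Ln : 0 < L n by near: n.
  have p1 : 0 < 1 + y * al n.
    have : -1 < y * al n by near: n; apply: near_gt yalc _; rewrite ltrN10.
    by lra.
  have p2 : 0 < 1 + - w n.
    have : w n < 1 by near: n; apply: near_lt wc _.
    by lra.
  have -> : x n = bb n * (1 + y * al n) / (1 + - w n).
    rewrite /x /weight_level lnr// /aa.
    have -> : N n - ell n - ln (v n) = L n * (1 + - w n).
      by rewrite /ell /w; field; rewrite gt_eqF.
    by field; rewrite !gt_eqF.
  have bn : 0 < bb n by exact: expR_gt0.
  split; first by rewrite divr_gt0// mulr_gt0.
  by rewrite ln_div ?posrE ?mulr_gt0// lnM ?posrE// /bb expRK.
(* In units of [al], [yn] is the difference of the logarithms of [1 + y al] and of [1 - w],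
   of which only the first-order terms matter. *)
have yD : yn n - ln (v n) @[n --> \oo] --> y.
  have h : (ln (1 + y * al n) - y * al n) / al n - (ln (1 + - w n) - - w n) / al n
      + ln (v n) * ((al n * L n)^-1 - 1) + y @[n --> \oo] --> 0 - 0 + 0 + y.
    by apply: cvgD; [apply: cvgD => //; exact: cvgB|exact: cvg_cst].
  rewrite subr0 !add0r in h; apply: cvg_trans h; apply: near_eq_cvg; near=> n.
  have an : 0 < al n by near: n. have Ln : 0 < L n by near: n.
  have [_ lnx] : 0 < x n /\ ln (x n) = qu n + ln (1 + y * al n) - ln (1 + - w n) by near: n.
  rewrite /= /yn lnx.
  move: (ln (1 + y * al n)) (ln (1 + - w n)) => z1 z2; rewrite /w.
  by field; rewrite !gt_eqF.
have y2 : yn n ^+ 2 / ell n @[n --> \oo] --> (0 : R).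
  under eq_cvg => n do rewrite -(subrK (ln (v n)) (yn n)).
  apply: cvg_sqrD; first exact: cvg_sqr_bounded yD elloo; last exact: ell0.
  apply: (@bounded_cvg_div _ (fun n => ln (v n) ^+ 2) ell (V ^+ 2)) => // n.
  by rewrite normrX lerXn2r ?nnegrE ?addr_ge0//; exact: lv.
have h := tail_at_quantile a0 c0 tau0 hh elloo y2 yD.
rewrite mulr0 mul0r oppr0 sub0r in h; rewrite mul1r.
apply: cvg_trans h; apply: near_eq_cvg; near=> n.
have n0 : (0 < n)%N by near: n; exact: nbhs_infty_gt.
have an : 0 < al n by near: n.
have v0 : 0 < v n by apply: lt_le_trans s0 _; case/andP: (hv n).
have [xn _] : 0 < x n /\ ln (x n) = qu n + ln (1 + y * al n) - ln (1 + - w n) by near: n.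
have -> : rr n * v n = expR (ell n + ln (v n)) by rewrite rE// [RHS]expRD lnK ?posrE.
rewrite /=; congr (_ * tailW W _).
rewrite -/(al n) -/(qu n) -/(x n) /yn mulrC divfK ?gt_eqF// addrC subrK lnK// posrE//.
Unshelve. all: by end_near. Qed.

(** The ratio condition is proved for the logarithms of the weights: as [tau > 1] the
    derivative is largest at the right end, at most [2 ell^(1 / tau)], and a difference of
    logarithms is at most [4 / b] times the difference of the weights. *)
Lemma regime_RaV : regime W s t 1 (4 * expR (`|b| * ln 2)) (4 * 2 `^ (tau - 1)) rr aa bb L.
Proof.
apply: regime_intro => //.
- apply: cvg_trans (cvgy_expR elloo); apply: near_eq_cvg; near=> n.
  have n0 : (0 < n)%N by near: n; exact: nbhs_infty_gt.
  by rewrite /= rE.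
- have t0 : 0 < t by exact: lt_le_trans st.
  near=> n.
  have n0 : (0 < n)%N by near: n; exact: nbhs_infty_gt.
  have h : ln t < L n by near: n; exact: near_large.
  rewrite rE// -{1}[t]lnK ?posrE// -expRD -[leRHS]lnK ?posrE ?ltr0n//.
  by rewrite ler_expR -/(N n) /ell; lra.
- apply: cvg_trans (@cvg_cst _ (1 : R) _ \oo _); apply: near_eq_cvg; near=> n.
  have n0 : (0 < n)%N by near: n; exact: nbhs_infty_gt.
  have Ln : 0 < L n by near: n.
  by rewrite /= lnr// -/(N n) /ell opprB addrC subrK divff// gt_eqF.
- have h : (al n * L n)^-1 @[n --> \oo] --> (1 : R).
    by rewrite -invr1; apply: cvgV => //; exact: oner_neq0.
  apply: cvg_trans h; apply: near_eq_cvg; near=> n.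
  have an : 0 < al n by near: n. have Ln : 0 < L n by near: n.
  have bn : 0 < bb n by exact: expR_gt0.
  by rewrite /= /aa; field; rewrite !gt_eqF.
- apply: ger_cvgy Loo; near=> n.
  have N1 : 1 < N n by near: n; exact: near_large.
  have Nn : 0 < N n by near: n. have Ln : 0 < L n by near: n.
  have b2 : N n ^+ 2 <= bb n by near: n.
  rewrite ler_pdivlMr// -/(N n) mulrC ler_pM2r//; apply: le_trans b2.
  by rewrite expr2 ler_peMr ?ltW.
have [X0 X00 hX] := tail_ratio_bound a0 hh.
near=> n => q x /andP[q1 q2] /andP[x1 x2].
have an : 0 < al n by near: n.
have ln0 : 0 < ell n by near: n.
have bn : 0 < bb n by exact: expR_gt0.
have b8 : 8 < bb n by near: n; exact: near_large.
have bX : 4 * expR X0 < bb n by near: n; exact: near_large.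
have m1 : 4 < al n * (tau * ell n) by near: n; exact: near_large (main_oo elloo).
have m2 : qu n / (al n * (tau * ell n)) < 3 / 2.
  by near: n; apply: near_lt (quantile_equiv a b c0 tau0 elloo) _; lra.
have xlow : bb n / 4 <= x by lra.
have x0 : 0 < x by lra.
have q0 : 0 < q by lra.
have qx2 : ln q <= ln x + ln 2.
  by rewrite -lnM ?posrE// ler_ln ?posrE ?mulr_gt0//; lra.
have ln2x : ln 2 <= ln x by rewrite ler_ln ?posrE//; lra.
have xq : ln x <= ln q by rewrite ler_ln ?posrE.
have XX : X0 <= ln x by rewrite -[X0]expRK ler_ln ?posrE ?expR_gt0//; lra.
have := hX (ln x) (ln q) XX xq; rewrite !lnK ?posrE// => h.
apply: le_trans (h _) _; first by lra.
rewrite -!mulrA; apply: ler_wpM2l => //; apply: ler_wpM2l; first exact: expR_ge0.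
apply: ler_wpM2r; first exact: Pr_ge0.
rewrite ler_expR.
have lx0 : 0 < ln x by exact: lt_le_trans XX.
apply: (@le_trans _ _ (2 `^ (tau - 1) * (ln q - ln x) / al n)).
  apply: power_increment => // z z1 z2.
  have z0 : 0 < z by apply: lt_le_trans z1; rewrite divr_gt0.
  have p0 : 0 < ell n `^ tau^-1 by rewrite powR_gt0.
  rewrite -powRM ?(ltW p0)//; apply: ge0_ler_powR.
  - by rewrite subr_ge0 ltW.
  - by rewrite nnegrE ltW.
  - by rewrite nnegrE mulr_ge0 ?(ltW p0).
  apply: le_trans z2 _; rewrite ler_pdivrMr// -mulrA [_ * c1]mulrC spacing_main// -/(al n).
  have lnq : ln q <= ln 2 + qu n.
    by rewrite -[qu n]expRK -lnM ?posrE ?expR_gt0// ler_ln ?posrE ?mulr_gt0 ?expR_gt0.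
  have l2 : ln 2 <= 1 :> R.
    by apply: le_ln1Dx; exact: lt_trans (ltrN10 _) ltr01.
  have m0 : 0 < al n * (tau * ell n) by lra.
  rewrite ltr_pdivrMr// in m2; lra.
have lqx : ln q - ln x <= 4 * (q - x) / bb n.
  rewrite -ln_div ?posrE//.
  have -> : q / x = 1 + (q - x) / x by field; rewrite gt_eqF.
  have qx0 : 0 <= q - x by rewrite subr_ge0.
  apply: (@le_trans _ _ ((q - x) / x)).
    by apply: le_ln1Dx; apply: lt_le_trans (ltrN10 _) _; rewrite divr_ge0 ?(ltW x0).
  rewrite ler_pdivrMr// mulrAC ler_pdivlMr// [4 * _]mulrC -mulrA ler_wpM2l//; lra.
have -> : 4 * (2 `^ (tau - 1) * ((q - x) / aa n)) =
    2 `^ (tau - 1) * (4 * (q - x) / bb n) / al n.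
  by rewrite /aa; field; rewrite !gt_eqF.
by rewrite ler_pM2r ?invr_gt0// ler_wpM2l// powR_ge0.
Unshelve. all: by end_near. Qed.

End LogStretchedRegime.

(** * Second moments of the weights *)

Section TailMoments.
Context (R : realType) (d : measure_display) (T : measurableType d)
  (P : probability T R) (W : {RV P >-> R}).

Lemma sublinear_terms (w : nat -> R) (A B C p : R) : p < 1 -> w n @[n --> \oo] --> +oo ->
  \forall n \near \oo, A + B * ln (w n) + C * w n `^ p <= w n.
Proof.
move=> p1 wc.
have h1 : ln (w n) / w n @[n --> \oo] --> (0 : R).
  exact: cvg_sqr_div (cvg_sqr_ln wc) wc.
have h2 : (w n `^ (1 - p))^-1 @[n --> \oo] --> (0 : R).
  by apply: cvgyV; apply: cvgy_powR => //; rewrite subr_gt0.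
have h : A * (w n)^-1 + B * (ln (w n) / w n) + C * (w n `^ (1 - p))^-1 @[n --> \oo] -->
    A * 0 + B * 0 + C * 0.
  by apply: cvgD; [apply: cvgD|]; apply: cvgMr => //; exact: cvgyV.
rewrite !mulr0 !addr0 in h; near=> n.
have wn : 0 < w n by near: n; exact: near_large.
have : A * (w n)^-1 + B * (ln (w n) / w n) + C * (w n `^ (1 - p))^-1 < 1.
  by near: n; exact: near_lt h ltr01.
have -> : (w n `^ (1 - p))^-1 = w n `^ p / w n.
  rewrite -powRN opprB powRD ?(gt_eqF wn) ?implybT// powRN powRr1//; exact: ltW.
by rewrite !mulrA -!mulrDl ltr_pdivrMr// mul1r => /ltW.
Unshelve. all: by end_near. Qed.

Variables (a b c1 tau : R).
Hypotheses (a0 : 0 < a) (c0 : 0 < c1) (tau0 : 0 < tau).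

(** In terms of [w = (u / c1)^tau] the logarithm of the tail is [- w] plus lower-order
    terms, covered by [sublinear_terms]. *)
Lemma stretchedE (u : R) : 0 < u ->
  2 * stretched a b c1 tau u =
  expR (ln 2 + ln a + b * (ln c1 + tau^-1 * ln ((u / c1) `^ tau)) - (u / c1) `^ tau).
Proof.
move=> u0; have t0 := tau0; have c00 := c0.
have -> : ln c1 + tau^-1 * ln ((u / c1) `^ tau) = ln u.
  by rewrite ln_powR ln_div ?posrE//; field; rewrite gt_eqF.
rewrite !expRD !lnK ?posrE// /stretched /powR gt_eqF//; ring.
Qed.

Lemma scale_oo (u : nat -> R) : u n @[n --> \oo] --> +oo ->
  (u n / c1) `^ tau @[n --> \oo] --> +oo.
Proof.
move=> uc; apply: cvgy_powR => //; under eq_cvg => n do rewrite mulrC.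
by apply: cvgyZ => //; rewrite invr_gt0.
Qed.

Lemma second_moment_RV : (forall w, 0 <= W w) -> tail_RV W a b c1 tau ->
  exists sigma2 : R, (\int[P]_w (W w ^+ 2)%:E = sigma2%:E)%E.
Proof.
move=> W0 ht; apply: second_moment_finite => //.
have [X0 X00 hX] := stretched_factor2 a0 ht.
have koo : k%:R @[k --> \oo] --> (+oo : set_system R) by exact: cvgr_idn.
have h := @sublinear_terms _ (ln 2 + ln a + (b + 3) * ln c1) ((b + 3) / tau) 0 0 ltr01 (scale_oo koo).
near=> k.
have kX : X0 <= k%:R by apply: ltW; near: k; exact: near_large koo.
have k0 : 0 < k%:R :> R by exact: lt_le_trans kX.
have /andP[_ h1] := hX _ kX; apply: (le_trans h1).
rewrite stretchedE// -[leRHS]lnK ?posrE ?invr_gt0 ?exprn_gt0// ler_expR.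
rewrite lnV ?posrE ?exprn_gt0// lnXn// -(mulr_natl _ 3).
have h2 : ln 2 + ln a + (b + 3) * ln c1 + (b + 3) / tau * ln ((k%:R / c1) `^ tau) +
    0 * ((k%:R / c1) `^ tau) `^ 0 <= (k%:R / c1) `^ tau by near: k.
have -> : ln (k%:R) = ln c1 + tau^-1 * ln ((k%:R / c1) `^ tau) :> R.
  by rewrite ln_powR ln_div ?posrE//; field; rewrite gt_eqF.
move: h2; rewrite mul0r addr0 -(mulrA (b + 3)).
move: (_ `^ tau) => w; move: (ln w) (tau^-1) => *; lra.
Unshelve. all: by end_near. Qed.

(** Here [k^3] is the exponential of [3 ln k], of order [w^(1 / tau)], sublinear in [w] since
    [tau > 1]. *)
Lemma second_moment_RaV : 1 < tau -> (forall w, 0 <= W w) -> tail_RaV W a b c1 tau ->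
  exists sigma2 : R, (\int[P]_w (W w ^+ 2)%:E = sigma2%:E)%E.
Proof.
move=> tau1 W0 ht; apply: second_moment_finite => //.
have [X0 X00 hX] := stretched_factor2 a0 (log_tail ht).
have koo : ln k%:R @[k --> \oo] --> (+oo : set_system R) by apply: cvgy_ln; exact: cvgr_idn.
have p1 : tau^-1 < 1 by rewrite invf_lt1.
have h := @sublinear_terms _ (ln 2 + ln a + b * ln c1) (b / tau) (3 * c1) tau^-1 p1 (scale_oo koo).
near=> k.
have kX : X0 <= ln k%:R by apply: ltW; near: k; exact: near_large koo.
have k1 : 0 < ln k%:R :> R by exact: lt_le_trans kX.
have k0 : 0 < k%:R :> R.
  by rewrite ltNge; apply/negP => k0; move: k1; rewrite ln0// ltxx.
have /andP[_ h1] := hX _ kX; rewrite lnK ?posrE// in h1; apply: (le_trans h1).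
rewrite stretchedE// -[leRHS]lnK ?posrE ?invr_gt0 ?exprn_gt0// ler_expR.
rewrite lnV ?posrE ?exprn_gt0// lnXn// -(mulr_natl _ 3).
have : ln 2 + ln a + b * ln c1 + b / tau * ln ((ln k%:R / c1) `^ tau) +
    3 * c1 * ((ln k%:R / c1) `^ tau) `^ tau^-1 <= (ln k%:R / c1) `^ tau by near: k.
have -> : ((ln k%:R / c1) `^ tau) `^ tau^-1 = ln k%:R / c1.
  by rewrite -powRrM divff ?gt_eqF// powRr1// divr_ge0// ltW.
have -> : 3 * c1 * (ln k%:R / c1) = 3 * ln k%:R by field; rewrite gt_eqF.
move: (_ `^ tau) => w; rewrite -(mulrA b).
by move: (ln w) (ln k%:R) (tau^-1) => *; lra.
Unshelve. all: by end_near. Qed.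

End TailMoments.

(** * Intensity of a strip *)

Section StripIntensity.
Context (R : realType).
Local Open Scope ereal_scope.

(** The points that make the maximum exceed [x]. *)
Definition strip (s t x : R) : set (R * R) :=
  [set p | (s <= p.1 <= t)%R /\ (x < p.2 - ln p.1)%R].

Lemma measurable_strip (s t x : R) : measurable (strip s t x).
Proof.
have -> : strip s t x = (fst @^-1` `[s, t]) `&` ((fun p => p.2 - ln p.1)%R @^-1` `]x, +oo[).
  by apply/seteqP; split => p /=; rewrite !in_itv/= andbT.
apply: measurableI.
  by rewrite -[X in measurable X]setTI; exact: measurable_fst.
rewrite -[X in measurable X]setTI.
apply: (measurable_funB measurable_snd) => //.
by apply: (measurableT_comp (@measurable_ln R)); exact: measurable_fst.
Qed.

Lemma integral_exp_tail (c : R) :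
  \int[lebesgue_measure]_(y in `]c, +oo[) (expR (- y))%:E = (expR (- c))%:E.
Proof.
have dF (x : R) : is_derive x (1 : R)%R (fun y : R => - expR (- y))%R (expR (- x))%R.
  by apply: is_derive_eq; rewrite /GRing.scale/=; ring.
have cF : continuous (fun y : R => expR (- y)).
  by move=> x; apply: continuous_comp; [exact: opp_continuous|exact: continuous_expR].
rewrite integral_itv_obnd_cbnd; last first.
  apply/measurable_EFinP/measurable_funTS; exact: continuous_measurable_fun.
rewrite (@ge0_continuous_FTC2y _ _ (fun y : R => - expR (- y))%R _ 0%R).
- by rewrite sub0e -EFinN opprK.
- by move=> x _; exact: expR_ge0.
- by apply: continuous_subspaceT; exact: cF.
- by rewrite -oppr0; apply: cvgN; exact: cvgr_expR.
- by move=> x _; have := dF x => h; exact: ex_derive.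
- apply: cvg_at_right_filter; apply: cvgN; exact: cF.
- by move=> x _; rewrite derive1E; have := dF x => h; rewrite derive_val.
Qed.

Lemma integral_inv (s t k : R) : (0 < s)%R -> (s < t)%R ->
  \int[lebesgue_measure]_(v in `[s, t]) (k / v)%:E = (k * (ln t - ln s))%:E.
Proof.
move=> s0 st.
have dF (v : R) : (0 < v)%R -> is_derive v (1 : R)%R (fun y : R => k * ln y)%R (k / v)%R.
  move=> v0; have h := is_derive1_ln v0.
  by apply: is_derive_eq; rewrite /GRing.scale/=.
have cF (v : R) : (0 < v)%R -> {for v, continuous (fun y : R => k * ln y)%R}.
  by move=> v0; apply: cvgMr; exact: continuous_ln.
rewrite (@continuous_FTC2 _ _ (fun v : R => k * ln v)%R) //.
- by rewrite -EFinB mulrBr.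
- apply: continuous_in_subspaceT => v; rewrite inE/= in_itv/= => /andP[sv _].
  by apply: cvgMr; apply: cvgV => //; rewrite gt_eqF// (lt_le_trans s0).
- split.
  + move=> v; rewrite in_itv/= => /andP[sv _].
    by have h := dF v (lt_trans s0 sv); exact: ex_derive.
  + by apply: cvg_at_right_filter; exact: cF.
  + by apply: cvg_at_left_filter; apply: cF; exact: lt_trans st.
- move=> v; rewrite in_itv/= => /andP[sv _]; rewrite derive1E.
  by have h := dF v (lt_trans s0 sv); rewrite derive_val.
Qed.

(** Fubini: the inner integral is [e^(-x) / v]. *)
Lemma nu_strip (s t x : R) : (0 < s)%R -> (s < t)%R ->
  nu_intensity (strip s t x) = (ln (t / s) * expR (- x))%:E.
Proof.
move=> s0 st; rewrite /nu_intensity.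
have -> : strip s t x `&` half_plane R = strip s t x.
  apply/seteqP; split => [p []//|p [/andP[sp pt] h]]; split => //.
    by split => //; rewrite sp pt.
  by rewrite /half_plane/= (lt_le_trans s0).
have m1 : measurable_fun [set: R * R] (fun p : R * R => (expR (- p.2))%:E).
  apply/measurable_EFinP; apply: (measurableT_comp (@measurable_expR R)).
  exact: measurableT_comp.
rewrite integral_mkcond fubini_tonelli1.
- rewrite [LHS](_ : _ = \int[lebesgue_measure]_(v in `[s, t]) (expR (- x) / v)%:E); last first.
    rewrite [RHS]integral_mkcond; apply: eq_integral => v _.
    rewrite /fubini_F patchE; case: ifPn => [|] vst.
      move: vst; rewrite inE/= in_itv/= => /andP[sv vt].
      have v0 : (0 < v)%R by exact: lt_le_trans sv.
      have -> : (expR (- x) / v)%R = expR (- (x + ln v)).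
        by rewrite opprD expRD expRN [expR (- ln v)]expRN lnK.
      rewrite -integral_exp_tail [RHS]integral_mkcond; apply: eq_integral => y _.
      rewrite !patchE/=; congr (if _ then _ else _).
      apply/idP/idP; rewrite !inE /strip/= in_itv/= andbT.
        by move=> [_]; rewrite ltrBrDr.
      by rewrite -ltrBrDr => h; rewrite sv vt.
    rewrite integral0_eq// => y _; rewrite patchE; case: ifPn => //.
    by rewrite inE => -[/= h _]; move: vst; rewrite notin_setE/= in_itv/=.
  by rewrite integral_inv// mulrC ln_div// posrE (lt_trans s0).
- by apply/(measurable_restrictT _ (measurable_strip s t x)); exact: measurable_funTS.
- by move=> p; rewrite patchE; case: ifPn => // _; rewrite lee_fin expR_ge0.
Qed.

End StripIntensity.

(** * The maximum over the points of a strip *)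

Section PointProcess.
Context (R : realType) (d : measure_display) (T : measurableType d)
  (P : probability T R) (Pi : T -> set (R * R)) (s t : R).
Hypotheses (s0 : 0 < s) (st : s < t)
  (ppp : poisson_point_process P (half_plane R) (@nu_intensity R) Pi).

Let K := ln (t / s).
Let N x := count_points R Pi (strip s t x).
Let V := strip_values Pi s t.
Let S w := sup (V w).
Let void x := [set w | N x w = 0%E].

Lemma counting_eq0 (E : choiceType) (A : set E) : @counting E R A = 0%E <-> A = set0.
Proof.
split=> [|->]; last first.
  by rewrite /counting asboolT// fset_set0.
rewrite /counting; case: ifPn => // /asboolP fA [] /eqP; rewrite pnatr_eq0 => /eqP /finmap.cardfs0_eq h.
by rewrite -(fset_setK fA) h set_fset0.
Qed.

Lemma counting_finite (E : choiceType) (A : set E) : @counting E R A != +oo%E -> finite_set A.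
Proof. by rewrite /counting; case: ifPn => // /asboolP. Qed.

Let mN x : measurable_fun [set: T] (N x).
Proof. exact: (ppp_measurable ppp (measurable_strip s t x)). Qed.

Let mvoid x : measurable (void x).
Proof.
rewrite -[X in measurable X]setTI.
exact: (mN x measurableT (emeasurable_set1 0%E)).
Qed.

Let voidP x w : void x w <-> (forall y, V w y -> y <= x).
Proof.
rewrite /void /N /count_points /= counting_eq0; split=> [h y [p [pP pst] <-]|h].
  rewrite leNgt; apply/negP => xp.
  suff : (Pi w `&` strip s t x) p by rewrite h.
  by split.
apply/seteqP; split => // p [pP [pst xp]]; have := h (p.2 - ln p.1).
by rewrite leNgt xp => /(_ _)/negP; apply => //; exists p.
Qed.

Let K0 : 0 < K. Proof. by rewrite /K ln_gt0// ltr_pdivlMr// mul1r. Qed.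

Lemma void_probability x : Pr P (void x) = expR (- (K * expR (- x))).
Proof.
have h := ppp_finite ppp 0 (measurable_strip s t x).
rewrite nu_strip// ltry in h; have {}h := h isT.
have r0 : 0 < K * expR (- x) by rewrite mulr_gt0// expR_gt0.
rewrite /Pr; transitivity (fine (poisson_prob (K * expR (- x)) 0 [set 0%N])); first by rewrite -h.
rewrite /poisson_prob r0 esum_set1 ?lee_fin ?poisson_pmf_ge0//=.
by rewrite /poisson_pmf r0 expr0 fact0 invr1 !mul1r.
Qed.

Let finite_as x : Pr P [set w | N x w = +oo%E] = 0.
Proof.
pose F k := [set w | N x w = k%:R%:E].
have mF k : measurable (F k).
  by rewrite -[X in measurable X]setTI; exact: (mN x measurableT (emeasurable_set1 _)).
have tF : trivIset setT F.
  apply/trivIsetP => i j _ _ ij; apply/seteqP; split => // w [h1 h2].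
  have [/eqP] := etrans (esym h1) h2; by rewrite eqr_nat (negbTE ij).
(* The Poisson probabilities of the integers sum to [1], which leaves nothing for an
   infinite number of points. *)
have E : P (\bigcup_k F k) = 1%E.
  rewrite measure_bigcup//.
  pose rate := K * expR (- x).
  transitivity (\sum_(0 <= i <oo | i \in [set: nat]) poisson_prob rate 0 [set i])%E.
    apply: eq_eseriesr => k _; have := ppp_finite ppp k (measurable_strip s t x).
    by rewrite nu_strip// ltry => /(_ isT).
  rewrite -measure_bigcup//; last first.
    by apply/trivIsetP => i j _ _ /eqP ij; apply/seteqP; split => // k [-> /ij].
  have -> : \bigcup_(n in [set: nat]) [set n] = [set: nat].
    by apply/seteqP; split => // k _; exists k.
  exact: probability_setT.
have mI : measurable [set w | N x w = +oo%E].
  by rewrite -[X in measurable X]setTI; exact: (mN x measurableT (emeasurable_set1 _)).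
apply/eqP; rewrite eq_le Pr_ge0 andbT.
have mU : measurable (\bigcup_k F k) by exact: bigcup_measurable.
apply: (@le_trans _ _ (Pr P (~` (\bigcup_k F k)))).
  apply: Pr_mono => //; first exact: measurableC.
  by move=> w h [k _ hk]; have := etrans (esym h) hk.
by rewrite Pr_setC// /Pr E subrr.
Qed.

Let good : set T := (\bigcup_(k : nat) ~` void (- k%:R)) `&`
  (\bigcap_(k : nat) ~` [set w | N (- k%:R) w = +oo%E]).

Let mgood : measurable good.
Proof.
apply: measurableI.
  by apply: bigcup_measurable => k _; exact: measurableC.
apply: bigcap_measurable => [|k _]; first by exists 0%N.
apply: measurableC; rewrite -[X in measurable X]setTI.
exact: (mN _ measurableT (emeasurable_set1 _)).
Qed.

Lemma bigcup_null (F : nat -> set T) : (forall k, measurable (F k)) ->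
  (forall k, Pr P (F k) = 0) -> Pr P (\bigcup_k F k) = 0.
Proof.
move=> mF F0; have : P (\bigcup_k F k) = 0%E; last by rewrite /Pr => ->.
apply: measure_negligible; first exact: bigcup_measurable.
apply: negligible_bigcup => k; apply/negligibleP => //.
exact: etrans (PrE P (mF k)) (congr1 EFin (F0 k)).
Qed.

Lemma Pr_good : Pr P good = 1.
Proof.
have mC := measurableC mgood.
suff : Pr P (~` good) = 0 by rewrite Pr_setC//; lra.
rewrite /good setCI setC_bigcup setC_bigcap.
under eq_bigcapr do rewrite setCK. under eq_bigcupr do rewrite setCK.
have mI k : measurable [set w | N (- k%:R) w = +oo%E].
  by rewrite -[X in measurable X]setTI; exact: (mN _ measurableT (emeasurable_set1 _)).
have mU : measurable (\bigcup_(k : nat) [set w | N (- k%:R) w = +oo%E]).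
  by apply: bigcup_measurable => k _; exact: mI.
have mV : measurable (\bigcap_(k : nat) void (- k%:R)).
  by apply: bigcap_measurable => //; exists 0%N.
apply/eqP; rewrite eq_le Pr_ge0 andbT.
apply: le_trans (Pr_setU _ mV mU) _.
rewrite (@bigcup_null (fun k => [set w | N (- k%:R) w = +oo%E]))// addr0.
apply/ler_addgt0Pl => e e0; rewrite addr0.
have /cvgrPdist_lt/(_ e e0) : expR (- (K * expR (k%:R))) @[k --> \oo] --> (0 : R).
  under eq_cvg => k do rewrite expRN.
  by apply: cvgyV; apply: cvgy_expR; apply: cvgyZ => //; apply: cvgy_expR; exact: cvgr_idn.
case=> k _ /(_ k (leqnn k)); rewrite sub0r normrN ger0_norm ?expR_ge0// => /ltW h.
apply: le_trans h; rewrite -(opprK k%:R) -void_probability.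
by apply: Pr_mono => // w; apply.
Qed.

Lemma seq_max (E : eqType) (f : E -> R) (r : seq E) x : x \in r ->
  exists2 y, y \in r & forall z, z \in r -> f z <= f y.
Proof.
elim: r x => // a [|b r] IH x _.
  by exists a; rewrite ?inE// => z; rewrite inE => /eqP->.
have [y yr h] := IH b (mem_head _ _).
have [ay|ya] := leP (f a) (f y).
  by exists y => [|z]; rewrite inE ?yr ?orbT// => /orP[/eqP->//|/h].
exists a => [|z]; rewrite inE ?eqxx// => /orP[/eqP->//|/h zy].
exact: le_trans zy (ltW ya).
Qed.

Let good_max w : good w -> is_max (V w) (S w).
Proof.
move=> [[k _ kw] /(_ k Logic.I)/= /eqP fk].
have [y0 Vy0 ky0] : exists2 y0, V w y0 & - k%:R < y0.
  apply: contrapT => h; apply: kw; apply/voidP => y Vy; rewrite leNgt; apply/negP => ky.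
  by apply: h; exists y.
have /finite_seqP[r rE] := counting_finite fk.
have [p0 [p0P p0st] p0y] := Vy0.
have p0r : p0 \in r.
  have : [set` r] p0 by rewrite -rE; split => //; split => //; rewrite p0y.
  by [].
have [p pr hp] := seq_max (fun p => p.2 - ln p.1) p0r.
have : [set` r] p by [].
rewrite -rE => -[pP [pst kp]].
have Vp : V w (p.2 - ln p.1) by exists p.
have ubp : ubound (V w) (p.2 - ln p.1).
  move=> y [q [qP qst] <-]; have [kq|qk] := ltP (- k%:R) (q.2 - ln q.1).
    apply: hp; have : [set` r] q by rewrite -rE.
    by [].
  exact: le_trans qk (ltW kp).
have -> : S w = p.2 - ln p.1; last by split.
apply/eqP; rewrite eq_le; apply/andP; split.
  by apply: sup_le_ub => //; exists (p.2 - ln p.1).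
by apply: ub_le_sup => //; exists (p.2 - ln p.1).
Qed.

(** Almost surely every strip contains finitely many points and some strip contains one; the
    maximum is then attained among the finitely many points of that strip. *)
Lemma strip_max_ae : {ae P, forall w, is_max (strip_values Pi s t w) (sup (strip_values Pi s t w))}.
Proof.
exists (~` good); split; first exact: measurableC.
  by rewrite PrE ?Pr_setC ?Pr_good ?subrr//; exact: measurableC.
by move=> w /= h wg; apply: h; exact: good_max.
Qed.

Let supP x w : good w -> (S w <= x) <-> void x w.
Proof.
move=> wg; have [Vs ubs] := good_max wg; rewrite voidP; split => [h y /ubs ys|h].
  exact: le_trans ys h.
exact: h.
Qed.

(** For every outcome, including those where the set of values is empty or unbounded and the
    supremum takes its default value. *)
Lemma measurable_sup_strip : measurable_fun [set: T] (fun w => sup (strip_values Pi s t w)).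
Proof.
pose H := (\bigcup_(k : nat) ~` void (- k%:R)) `&` (\bigcup_(k : nat) void k%:R).
have mH : measurable H.
  apply: measurableI; first by apply: bigcup_measurable => k _; exact: measurableC.
  exact: bigcup_measurable.
have HP w : H w <-> has_sup (V w).
  split=> [[[k _ kw] [j _ /voidP jw]]|[[y Vy] [z zV]]].
    split; last by exists j%:R.
    apply: contrapT => h; apply: kw; apply/voidP => y Vy; exfalso; apply: h; by exists y.
  split.
    exists (Num.truncn `|y|).+1 => //= /voidP /(_ y Vy); apply/negP; rewrite -ltNge.
    rewrite ltrNl; apply: le_lt_trans (truncnS_gt _).
    by rewrite -normrN ler_norm.
  exists (Num.truncn `|z|).+1 => //=; apply/voidP => y' Vy'.
  by apply: le_trans (zV _ Vy') (le_trans (ler_norm _) (ltW (truncnS_gt _))).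
move=> _; apply: (measurability _ (RGenOInfty.measurableE R)) => //.
move=> /= _ [_ [x ->] <-]; rewrite setTI preimage_itvoy.
have -> : [set w | x < sup (strip_values Pi s t w)] =
    (H `&` ~` void x) `|` (~` H `&` [set _ | x < 0]).
  apply/seteqP; split => w /=.
    move=> xS; have [Hw|Hw] := pselect (H w).
      left; split=> // /voidP h; have /HP[nV _] := Hw.
      by have := sup_le_ub nV h; rewrite leNgt xS.
    by right; split => //; move: xS; rewrite sup_out// => /HP.
  case=> [[Hw nv]|[Hw x0]].
    rewrite ltNge; apply/negP => Sx; apply: nv; apply/voidP => y Vy.
    have /HP[_ ub] := Hw; apply: le_trans Sx; exact: ub_le_sup.
  by rewrite sup_out// => /HP.
apply: measurableU; apply: measurableI => //; try exact: measurableC.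
by have [x0|x0] := boolP (x < 0); [rewrite (_ : [set _ | _] = setT)|rewrite (_ : [set _ | _] = set0)] => //;
  apply/seteqP; split.
Qed.

Lemma Pr_good_eq A B : measurable A -> measurable B ->
  (forall w, good w -> A w <-> B w) -> Pr P A = Pr P B.
Proof.
move=> mA mB AB; rewrite -(Pr_setI_as1 mA mgood Pr_good) -(Pr_setI_as1 mB mgood Pr_good).
by congr Pr; apply/seteqP; split => w [h wg]; split => //; apply/(AB w wg).
Qed.

Let mS x : measurable [set w | S w <= x].
Proof.
rewrite -[X in measurable X]setTI -preimage_itvNyc.
exact: measurable_sup_strip.
Qed.

Lemma sup_strip_law x : Pr P [set w | sup (strip_values Pi s t w) <= x] =
  expR (- (K * expR (- x))).
Proof. by rewrite -void_probability; apply: Pr_good_eq => // w; exact: supP. Qed.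

Variable (U : {RV P >-> R}).
Hypotheses (U_unif : uniform_distributed U (ln s) (ln t))
  (U_indep : independent_of_points Pi U).

Let mU B : measurable B -> measurable (U @^-1` B).
Proof. by move=> mB; rewrite -[X in measurable X]setTI; exact: measurable_funP. Qed.

(** The event that the maximum is at most [x] is almost surely a void event, which belongs to
    the sigma-algebra of the points. *)
Lemma sup_strip_indep x B : measurable B ->
  Pr P ([set w | sup (strip_values Pi s t w) <= x] `&` U @^-1` B) =
  Pr P [set w | sup (strip_values Pi s t w) <= x] * Pr P (U @^-1` B).
Proof.
move=> mB; rewrite sup_strip_law -void_probability.
transitivity (Pr P (void x `&` U @^-1` B)).
  apply: Pr_good_eq; try by apply: measurableI => //; exact: mU.
  by move=> w wg; split => -[h1 h2]; split => //; apply/(supP x wg).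
have sv : sigma_points R Pi (void x).
  apply: sub_gen_smallest; exists (strip s t x), [set 0%E]; split => //.
  exact: measurable_strip.
apply: EFin_inj; rewrite EFinM -!PrE//; last 2 first.
- exact: mU.
- by apply: measurableI => //; exact: mU.
exact: U_indep.
Qed.

Lemma uniform_itv u u' : s <= u -> u < u' -> u' <= t ->
  Pr P [set w | u < expR (U w) <= u'] = ln (u' / u) / K.
Proof.
move=> su uu' u't; have u0 : 0 < u by exact: lt_le_trans su.
have u'0 : 0 < u' by exact: lt_trans uu'.
have lnst : ln s < ln t by rewrite ltr_ln ?posrE// (lt_trans s0).
have -> : [set w | u < expR (U w) <= u'] = U @^-1` `]ln u, ln u'].
  apply/seteqP; split => w /=; 
    by rewrite in_itv/= -(ltr_expR (ln u)) -(ler_expR _ (ln u')) !lnK ?posrE.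
have [ab hU] := U_unif; apply: EFin_inj; rewrite -PrE; last exact: mU.
have := hU _ (measurable_itv `]ln u, ln u']); rewrite /distribution/= /pushforward => ->.
rewrite /uniform_prob; transitivity (\int[lebesgue_measure]_(_ in `]ln u, ln u']) ((K^-1)%:E))%E.
  apply: eq_integral => x; rewrite inE/= in_itv/= => /andP[ux xu']; congr EFin.
  have t0 : 0 < t by exact: lt_trans st.
  suff h : ln s <= x <= ln t by rewrite /uniform_pdf h /K ln_div ?posrE.
  apply/andP; split; first by apply: le_trans (ltW ux); rewrite ler_ln ?posrE.
  by apply: le_trans xu' _; rewrite ler_ln ?posrE.
rewrite integral_cst//= lebesgue_measure_itv/= lte_fin ltr_ln ?posrE// uu' -EFinB -EFinM.
by rewrite mulrC ln_div ?posrE.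
Qed.

(** A rectangle is a difference of two events of the form treated in [sup_strip_indep]; the
    shift multiplies the mean number of points by its exponential. *)
Lemma limit_cell (shift x x' u u' : R) : x < x' -> s <= u -> u < u' -> u' <= t ->
  Pr P [set w | x < sup (strip_values Pi s t w) - shift <= x' /\ u < expR (U w) <= u'] =
  (expR (- (expR (- shift) * (K * expR (- x')))) - expR (- (expR (- shift) * (K * expR (- x)))))
  * (ln (u' / u) / K).
Proof.
move=> xx' su uu' u't; rewrite -(uniform_itv su uu' u't).
have mE : measurable [set w | u < expR (U w) <= u'].
  have -> : [set w | u < expR (U w) <= u'] = (expR \o U) @^-1` `]u, u'].
    by apply/seteqP; split => w /=; rewrite in_itv.
  rewrite -[X in measurable X]setTI.
  apply: (measurableT_comp (@measurable_expR R) (measurable_funPT U)) => //.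
have EU : [set w | u < expR (U w) <= u'] = U @^-1` [set z | u < expR z <= u'] by [].
have mB : measurable [set z : R | u < expR z <= u'].
  have -> : [set z : R | u < expR z <= u'] = expR @^-1` `]u, u'].
    by apply/seteqP; split => w /=; rewrite in_itv.
  by rewrite -[X in measurable X]setTI; apply: measurable_expR.
have h z : expR (- (expR (- shift) * (K * expR (- z)))) = Pr P [set w | S w <= z + shift].
  by rewrite sup_strip_law opprD expRD; congr expR; ring.
rewrite !h mulrBl EU -!sup_strip_indep// -Pr_setD.
- congr Pr; apply/seteqP; split => w /=.
    rewrite ltrBrDr lerBlDr => -[/andP[h1 h2] h3]; split => //.
    by move=> [h4 _]; move: h1; rewrite ltNge h4.
  move=> [[h1 h2] h3]; split => //; rewrite ltrBrDr lerBlDr h1 andbT ltNge.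
  by apply/negP => h4; apply: h3; split.
- by apply: measurableI => //; exact: mS.
- by apply: measurableI => //; exact: mS.
by move=> w /= [h1 h2]; split => //; apply: le_trans h1 _; rewrite lerD2r ltW.
Qed.

End PointProcess.

(** * Expectations and cells of the plane *)

Section PlaneBorel.
Context (R : realType).

Definition cell (x x' u u' : R) : set (R * R) :=
  [set z | x < z.1 <= x' /\ u < z.2 <= u'].

Lemma measurable_cell (x x' u u' : R) : measurable (cell x x' u u').
Proof.
have -> : cell x x' u u' = (fst @^-1` `]x, x']) `&` (snd @^-1` `]u, u']).
  by apply/seteqP; split => z /=; rewrite !in_itv.
by apply: measurableI; rewrite -[X in measurable X]setTI;
  [exact: measurable_fst|exact: measurable_snd].
Qed.

Lemma near_rat (x e : R) : 0 < e -> exists q : rat, `|x - ratr q| < e.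
Proof.
move=> e0; have [|q] := @rat_in_itvoo R (x - e) (x + e); first by lra.
rewrite in_itv/= => /andP[h1 h2]; exists q; apply/ltr_normlP; split; lra.
Qed.

(** An open set is the union of the rational squares that it contains. *)
Lemma open_measurable_plane (O : set (R * R)) : open O -> measurable O.
Proof.
move=> oO; pose sq (p q : rat) (k : nat) : set (R * R) :=
  [set z | `|z.1 - ratr p| < k.+1%:R^-1 /\ `|z.2 - ratr q| < k.+1%:R^-1].
have msq p q k : measurable (sq p q k).
  have mabs (f : R * R -> R) : measurable_fun setT f -> measurable [set z | `|f z| < k.+1%:R^-1].
    move=> mf; have -> : [set z | `|f z| < k.+1%:R^-1] = f @^-1` `](- k.+1%:R^-1), k.+1%:R^-1[.
      by apply/seteqP; split => z /=; rewrite in_itv/= ltr_norml.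
    by rewrite -[X in measurable X]setTI; exact: mf.
  by apply: measurableI; apply: mabs; apply: measurable_funB.
have -> : O = \bigcup_(p : rat) \bigcup_(q : rat) \bigcup_(k : nat)
    (if `[< sq p q k `<=` O >] then sq p q k else set0).
  apply/seteqP; split => [z Oz|z [p _ [q _ [k _]]]]; last first.
    by case: ifPn => // /asboolP; exact.
  have /nbhs_ballP[e /= e0 he] : nbhs z O by exact: open_nbhs_nbhs.
  have [k hk] : exists k : nat, k.+1%:R^-1 < e / 2 :> R.
    exists (Num.truncn (e / 2)^-1).
    by rewrite -[ltRHS]invrK ltf_pV2 ?posrE ?ltr0n ?invr_gt0 ?divr_gt0// truncnS_gt.
  have kk : k.+1%:R^-1 + k.+1%:R^-1 <= e by rewrite [leRHS]splitr lerD// ltW.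
  have k0 : 0 < k.+1%:R^-1 :> R by rewrite invr_gt0 ltr0n.
  have [p hp] := near_rat z.1 k0; have [q hq] := near_rat z.2 k0.
  exists p => //; exists q => //; exists k => //.
  rewrite asboolT//= => z' [h1 h2]; apply: he; split; rewrite /ball/=.
    rewrite -(subrKA (ratr p)); apply: le_lt_trans (ler_normD _ _) _.
    rewrite [`|ratr p - _|]distrC; apply: lt_le_trans (ltrD hp h1) kk.
  rewrite -(subrKA (ratr q)); apply: le_lt_trans (ler_normD _ _) _.
  rewrite [`|ratr q - _|]distrC; apply: lt_le_trans (ltrD hq h2) kk.
apply: bigcupT_measurable_rat => p; apply: bigcupT_measurable_rat => q.
by apply: bigcup_measurable => k _; case: ifPn.
Qed.

Lemma continuous_measurable_plane (g : R * R -> R) : continuous g ->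
  measurable_fun [set: R * R] g.
Proof.
move=> cg _; apply: (measurability _ (RGenOInfty.measurableE R)) => //.
move=> /= _ [_ [x ->] <-]; rewrite setTI; apply: open_measurable_plane.
by move/continuousP: cg; apply; exact: interval_open.
Qed.

End PlaneBorel.

Section SimpleExpectation.
Context (R : realType).

Lemma integral_step (d : measure_display) (T : measurableType d) (P : probability T R)
    (X : T -> R * R) (I : finType) (a : I -> R) (A : I -> set (R * R)) :
  measurable_fun [set: T] X -> (forall k, 0 <= a k) -> (forall k, measurable (A k)) ->
  (\int[P]_w (\sum_k a k * \1_(A k) (X w))%:E = (\sum_k a k * Pr P (X @^-1` A k))%:E)%E.
Proof.
move=> mX a0 mA.
have mXA k : measurable (X @^-1` A k) by rewrite -[X in measurable X]setTI; exact: mX.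
under eq_integral do rewrite -sumEFin.
rewrite ge0_integral_sum//.
- rewrite -sumEFin; apply: eq_bigr => k _.
  under eq_integral do rewrite EFinM.
  rewrite ge0_integralZl_EFin//.
  + rewrite EFinM; congr (_ * _)%E.
    transitivity (\int[P]_w (\1_(X @^-1` A k) w)%:E)%E.
      by apply: eq_integral => w _; rewrite !indicE; congr (_%:R%:E); apply/idP/idP; rewrite !inE.
    by rewrite integral_indic// setIT -PrE.
  + apply/measurable_EFinP; apply: (measurableT_comp _ mX).
    exact: measurable_indic.
- move=> k; apply/measurable_EFinP; apply: measurable_funM => //.
  by apply: (measurableT_comp _ mX); exact: measurable_indic.
- by move=> k w _; rewrite lee_fin mulr_ge0.
Qed.

(** Linear in finitely many probabilities, so that lower bounds on each of them suffice. *)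
Lemma liminf_expectation (d : measure_display) (T : measurableType d) (P : probability T R)
    (X : nat -> T -> R * R) (g : R * R -> R) (I : finType) (a q : I -> R)
    (A : I -> set (R * R)) :
  (forall n, measurable_fun [set: T] (X n)) -> measurable_fun [set: R * R] g ->
  (forall k, 0 <= a k) -> (forall k, measurable (A k)) ->
  (forall z, \sum_k a k * \1_(A k) z <= g z) ->
  (forall k (e : R), 0 < e -> \forall n \near \oo, q k - e <= Pr P (X n @^-1` A k)) ->
  forall e : R, 0 < e -> \forall n \near \oo,
    ((\sum_k a k * q k - e)%:E <= \int[P]_w (g (X n w))%:E)%E.
Proof.
move=> mX mg a0 mA ag hq e e0.
have Sa0 : 0 <= \sum_k a k by apply: sumr_ge0.
pose e1 := e / (\sum_k a k + 1).
have e10 : 0 < e1 by rewrite divr_gt0// ltr_wpDl.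
have : \forall n \near \oo, forall k, q k - e1 <= Pr P (X n @^-1` A k).
  by apply: filter_forall => k; exact: hq.
apply: filterS => n hn.
apply: (@le_trans _ _ (\int[P]_w (\sum_k a k * \1_(A k) (X n w))%:E)%E); last first.
  apply: ge0_le_integral => //.
  - by move=> w _; rewrite lee_fin; apply: sumr_ge0 => k _; rewrite mulr_ge0.
  - apply/measurable_EFinP; apply: measurable_sum => k; apply: measurable_funM => //.
    by apply: (measurableT_comp _ (mX n)); exact: measurable_indic.
  - by apply/measurable_EFinP; exact: (measurableT_comp mg (mX n)).
  - by move=> w _; rewrite lee_fin.
rewrite (integral_step P (mX n) a0 mA) lee_fin.
apply: (@le_trans _ _ (\sum_k a k * (q k - e1))); last first.
  by apply: ler_sum => k _; apply: ler_wpM2l.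
under [leRHS]eq_bigr do rewrite mulrBr.
rewrite sumrB -mulr_suml lerD2l lerN2 /e1 mulrA ler_pdivrMr ?ltr_wpDl//.
by rewrite mulrC ler_wpM2l ?(ltW e0)// lerDl.
Qed.

End SimpleExpectation.

Section Grid.
Context (R : realType) (s t : R) (st : s < t).

(** The cells of the grid of order [N] have sides [1 / N] and [(t - s) / N], and cover the
    points with first coordinate in [- N, N] and second coordinate in [s, t]. *)
Definition grid_x (N i : nat) : R := - N%:R + i%:R / N%:R.
Definition grid_u (N j : nat) : R := s + (t - s) * (j%:R / N%:R).

Lemma unit_interval_index (M : nat) (r : R) : 0 < r <= M%:R ->
  exists i : 'I_M, i%:R < r <= i.+1%:R.
Proof.
elim: M => [|M IH] /andP[r0 rM]; first by move: (lt_le_trans r0 rM); rewrite ltxx.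
have [rM'|Mr] := leP r M%:R.
  have [|i hi] := IH; first by rewrite r0.
  by exists (widen_ord (leqnSn M) i).
by exists ord_max; rewrite Mr.
Qed.

Lemma unit_interval_inj (i j : nat) (r : R) : i%:R < r <= i.+1%:R -> j%:R < r <= j.+1%:R -> i = j.
Proof.
move=> /andP[h1 h2] /andP[h3 h4]; apply/eqP; rewrite eqn_leq -[(i <= j)%N]ltnS -[(j <= i)%N]ltnS.
rewrite -(ltr_nat R i) -(ltr_nat R j).
by rewrite (lt_le_trans h1 h4) (lt_le_trans h3 h2).
Qed.

Variable (N : nat).
Hypothesis N0 : (0 < N)%N.

Let N0' : 0 < N%:R :> R. Proof. by rewrite ltr0n. Qed.

Lemma grid_xP i x : (grid_x N i < x <= grid_x N i.+1) = (i%:R < (x + N%:R) * N%:R <= i.+1%:R).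
Proof.
rewrite /grid_x -!ltrBrDl -!lerBlDl opprK ltr_pdivrMr// ler_pdivlMr//.
Qed.

Lemma grid_uP j u : (grid_u N j < u <= grid_u N j.+1) =
  (j%:R < (u - s) / (t - s) * N%:R <= j.+1%:R).
Proof.
have ts : 0 < t - s by rewrite subr_gt0.
rewrite /grid_u -!ltrBrDl -!lerBlDl -!(mulrC (_ / _)).
by rewrite -ltr_pdivlMr// -ler_pdivrMr// ltr_pdivrMr// ler_pdivlMr//.
Qed.

Definition grid_cell (k : 'I_(2 * N * N) * 'I_N) : set (R * R) :=
  cell (grid_x N k.1) (grid_x N k.1.+1) (grid_u N k.2) (grid_u N k.2.+1).

Lemma grid_cell_inj k k' z : grid_cell k z -> grid_cell k' z -> k = k'.
Proof.
move=> [h1 h2] [h3 h4]; case: k k' h1 h2 h3 h4 => [i j] [i' j'] /=.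
rewrite !grid_xP !grid_uP => h1 h2 h3 h4.
by congr (_, _); apply: val_inj; [exact: unit_interval_inj h1 h3|exact: unit_interval_inj h2 h4].
Qed.

Lemma grid_cell_ex z : - N%:R < z.1 <= N%:R -> s < z.2 <= t -> exists k, grid_cell k z.
Proof.
move=> /andP[h1 h2] /andP[h3 h4]; have ts : 0 < t - s by rewrite subr_gt0.
have [|i hi] := @unit_interval_index (2 * N * N) ((z.1 + N%:R) * N%:R).
  rewrite mulr_gt0 ?ltr0n//=; last by lra.
  by rewrite natrM ler_pM2r// natrM; lra.
have [|j hj] := @unit_interval_index N ((z.2 - s) / (t - s) * N%:R).
  rewrite mulr_gt0 ?divr_gt0 ?subr_gt0//= ler_piMl ?(ltW N0')//.
  by rewrite ler_pdivrMr// mul1r lerD2r.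
by exists (i, j); split; rewrite /= ?grid_xP ?grid_uP.
Qed.

Lemma grid_xS i : grid_x N i.+1 = grid_x N i + N%:R^-1.
Proof. by rewrite /grid_x -[i.+1%:R]natr1 mulrDl mul1r addrA. Qed.

Lemma grid_uS j : grid_u N j.+1 = grid_u N j + (t - s) / N%:R.
Proof. rewrite /grid_u -[j.+1%:R]natr1; ring. Qed.

Lemma grid_u_bounds (j : 'I_N) : s <= grid_u N j /\ grid_u N j.+1 <= t.
Proof.
have ts : 0 < t - s by rewrite subr_gt0.
rewrite /grid_u; split.
  by rewrite lerDl mulr_ge0 ?(ltW ts)// divr_ge0.
rewrite -lerBrDl ler_piMr ?(ltW ts)// ler_pdivrMr// mul1r ler_nat; exact: ltn_ord.
Qed.

Lemma disjoint_sum_le (I : finType) (a : I -> R) (A : I -> set (R * R)) (z : R * R) (c : R) :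
  (forall k k', A k z -> A k' z -> k = k') -> 0 <= c -> (forall k, A k z -> a k <= c) ->
  \sum_k a k * \1_(A k) z <= c.
Proof.
move=> inj c0 ac; have [[k Ak]|nA] := pselect (exists k, A k z).
  rewrite (bigD1 k)//= big1 ?addr0.
    by rewrite indicE mem_set// mulr1 ac.
  move=> k' kk'; rewrite indicE memNset ?mulr0// => Ak'.
  by move: kk'; rewrite (inj _ _ Ak' Ak) eqxx.
rewrite big1// => k _; rewrite indicE memNset ?mulr0// => Ak; by apply: nA; exists k.
Qed.

End Grid.

(** * Convergence in distribution from lower bounds on cells *)

Section Criterion.
Context (R : realType) (d d' : measure_display) (T : measurableType d)
  (T' : measurableType d') (P : probability T R) (P' : probability T' R)
  (X : nat -> T -> R * R) (Y : T' -> R * R) (s t : R) (rho : R -> R -> R).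
Hypotheses (st : s < t) (mX : forall n, measurable_fun [set: T] (X n))
  (mY : measurable_fun [set: T'] Y)
  (Yst : Pr P' [set w | s < (Y w).2 <= t] = 1)
  (rho01 : forall x x', x < x' -> 0 <= rho x x' <= 1)
  (rho1 : forall z e : R, 0 < e -> exists2 delta : R, 0 < delta &
     forall x x', x < z <= x' -> x' - x < delta -> 1 - e <= rho x x')
  (Xcell : forall x x' u u' : R, x < x' -> s <= u -> u < u' -> u' <= t ->
     forall e : R, 0 < e -> \forall n \near \oo,
       rho x x' * Pr P' (Y @^-1` cell x x' u u') - e <= Pr P (X n @^-1` cell x x' u u')).

Section LowerBound.
Variables (g : R * R -> R) (B : R).
Hypotheses (cg : continuous g) (gB : forall z, 0 <= g z <= B).

Let low N (k : 'I_(2 * N.+1 * N.+1) * 'I_N.+1) : R := inf (g @` grid_cell s t k).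
Let wt N (k : 'I_(2 * N.+1 * N.+1) * 'I_N.+1) : R :=
  rho (grid_x R N.+1 k.1) (grid_x R N.+1 k.1.+1).
Let phi N z : R := \sum_(k : 'I_(2 * N.+1 * N.+1) * 'I_N.+1)
  low k * wt k * \1_(grid_cell s t k) z.

Let mg : measurable_fun [set: R * R] g.
Proof. exact: continuous_measurable_plane. Qed.

Let xS N i : grid_x R N.+1 i < grid_x R N.+1 i.+1.
Proof. by rewrite grid_xS ltrDl invr_gt0 ltr0n. Qed.

Let uS N j : grid_u s t N.+1 j < grid_u s t N.+1 j.+1.
Proof. by rewrite grid_uS ltrDl divr_gt0 ?subr_gt0 ?ltr0n. Qed.

Let lbg N (k : 'I_(2 * N.+1 * N.+1) * 'I_N.+1) : has_lbound (g @` grid_cell s t k).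
Proof. by exists 0 => _ [z _ <-]; case/andP: (gB z). Qed.

Let negrid N (k : 'I_(2 * N.+1 * N.+1) * 'I_N.+1) : g @` grid_cell s t k !=set0.
Proof.
exists (g (grid_x R N.+1 k.1.+1, grid_u s t N.+1 k.2.+1)),
  (grid_x R N.+1 k.1.+1, grid_u s t N.+1 k.2.+1) => //.
by split; rewrite /= lexx ?xS ?uS.
Qed.

Let low_ge0 N (k : 'I_(2 * N.+1 * N.+1) * 'I_N.+1) : 0 <= low k.
Proof. by apply: lb_le_inf => // _ [z _ <-]; case/andP: (gB z). Qed.

Let low_le N (k : 'I_(2 * N.+1 * N.+1) * 'I_N.+1) z : grid_cell s t k z -> low k <= g z.
Proof. by move=> kz; apply: ge_inf => //; exists z. Qed.

Let wt01 N (k : 'I_(2 * N.+1 * N.+1) * 'I_N.+1) : 0 <= wt k <= 1.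
Proof. exact: rho01. Qed.

Let lw_ge0 N (k : 'I_(2 * N.+1 * N.+1) * 'I_N.+1) : 0 <= low k * wt k.
Proof. by rewrite mulr_ge0//; case/andP: (wt01 k). Qed.

Let phi_le N z : phi N z <= g z.
Proof.
apply: disjoint_sum_le.
- by move=> k k'; exact: grid_cell_inj.
- by case/andP: (gB z).
move=> k kz; apply: le_trans (low_le kz).
by rewrite ler_piMr//; case/andP: (wt01 k).
Qed.

Let phi_ge0 N z : 0 <= phi N z.
Proof. by apply: sumr_ge0 => k _; rewrite mulr_ge0. Qed.

Let B0 : 0 <= B.
Proof. by have /andP[h1 h2] := gB (0, 0); exact: le_trans h2. Qed.

Let phi_cvg z : s < z.2 <= t -> phi N z @[N --> \oo] --> g z.
Proof.
move=> zst; apply/cvgrPdist_le => e e0.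
pose e1 := e / (B + 1); have e10 : 0 < e1 by rewrite divr_gt0// ltr_wpDl.
have [dl dl0 hrho] := rho1 z.1 e10.
have /cvgrPdist_lt/(_ _ e10)/nbhs_ballP[de /= de0 hde] := @cg z.
have Noo : N.+1%:R @[N --> \oo] --> (+oo : set_system R).
  by apply: ger_cvgy cvgr_idn; apply: nearW => n; rewrite ler_nat.
have iNoo := cvgyV Noo.
near=> N.
have i1 : N.+1%:R^-1 < dl by near: N; exact: near_lt iNoo _.
have i2 : N.+1%:R^-1 < de by near: N; exact: near_lt iNoo _.
have i3 : (t - s) / N.+1%:R < de.
  near: N; apply: near_lt (_ : (t - s) / N.+1%:R @[N --> \oo] --> 0) de0.
  by rewrite -(mulr0 (t - s)); exact: cvgMr.
have i4 : `|z.1| < N.+1%:R by near: N; exact: near_large.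
have [k kz] : exists k, grid_cell s t (k : 'I_(2 * N.+1 * N.+1) * 'I_N.+1) z.
  apply: grid_cell_ex => //; move: i4 => /ltr_normlP[h1 h2].
  by rewrite ltrNl h1 ltW.
have glow : g z - e1 <= low k.
  apply: lb_le_inf => // _ [z' kz' <-].
  have /hde : ball z de z'.
    case: kz kz' => [/andP[a1 a2] /andP[a3 a4]] [/andP[b1 b2] /andP[b3 b4]].
    rewrite grid_xS in a2 b2; rewrite grid_uS in a4 b4.
    split; rewrite /ball/=; apply/ltr_normlP; split.
    - move: (grid_x _ _ _) (N.+1%:R^-1) a1 a2 b1 b2 i2 => *; lra.
    - move: (grid_x _ _ _) (N.+1%:R^-1) a1 a2 b1 b2 i2 => *; lra.
    - move: (grid_u _ _ _ _) ((t - s) / _) a3 a4 b3 b4 i3 => *; lra.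
    - move: (grid_u _ _ _ _) ((t - s) / _) a3 a4 b3 b4 i3 => *; lra.
  by move=> /ltr_normlP[_ h]; move: h; rewrite ltrBlDr -ltrBlDl => /ltW.
have wk : 1 - e1 <= wt k.
  apply: hrho; first by case: kz.
  by rewrite grid_xS addrAC subrr add0r.
have plow : low k * wt k <= phi N z.
  rewrite /phi (bigD1 k)//= indicE mem_set// mulr1 lerDl.
  by apply: sumr_ge0 => k' _; rewrite mulr_ge0.
have lB : low k <= B by apply: le_trans (low_le kz) _; case/andP: (gB z).
have h1 : low k * (1 - e1) <= low k * wt k by rewrite ler_wpM2l.
have h2 : low k * e1 <= B * e1 by rewrite ler_wpM2r// ltW.
have eE : e = B * e1 + e1.
  have B1 : B + 1 != 0 by rewrite gt_eqF// ltr_wpDl.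
  by rewrite /e1; field.
have := phi_le N z; rewrite ger0_norm ?subr_ge0// => _.
rewrite mulrBr mulr1 in h1.
rewrite eE lerBlDr; apply: le_trans (_ : low k + e1 <= _); first by rewrite -lerBlDr.
move: (low k * e1) (B * e1) (low k * wt k) (phi N z) (low k) h1 h2 plow => *; lra.
Unshelve. all: by end_near. Qed.

(** The step functions [phi N], with the infimum of [g] over each cell of a grid weighted by
    [rho], converge to [g] as the mesh vanishes, so that their expectations approximate that
    of [g] by dominated convergence; each of them is handled by [liminf_expectation]. *)
Lemma expectation_liminf (e : R) : 0 < e ->
  \forall n \near \oo, (\int[P']_w (g (Y w))%:E - e%:E <= \int[P]_w (g (X n w))%:E)%E.
Proof.
move=> e0.
have mgY : measurable_fun setT (fun w => g (Y w)) by exact: (measurableT_comp mg mY).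
have mphi N : measurable_fun setT (fun w => phi N (Y w)).
  apply: measurable_sum => k; apply: measurable_funM => //.
  by apply: (measurableT_comp _ mY); apply: measurable_indic; exact: measurable_cell.
have ae1 : {ae P', forall w, [set: T'] w -> (phi N (Y w))%:E @[N --> \oo] --> (g (Y w))%:E}.
  have mst : measurable [set w | s < (Y w).2 <= t].
    have -> : [set w | s < (Y w).2 <= t] = (snd \o Y) @^-1` `]s, t].
      by apply/seteqP; split => w /=; rewrite in_itv.
    rewrite -[X in measurable X]setTI.
    by apply: (measurableT_comp measurable_snd mY).
  exists (~` [set w | s < (Y w).2 <= t]); split; first exact: measurableC.
    by rewrite PrE ?Pr_setC ?Yst ?subrr//; exact: measurableC.
  move=> w /= h wst; apply: h => _; apply: cvg_EFin; first exact: nearW.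
  exact: phi_cvg.
have ib : P'.-integrable [set: T'] (cst B%:E).
  by apply/integrableP; split => //; rewrite integral_cst//= probability_setT mule1 ltry.
have ae2 : {ae P', forall w N, [set: T'] w -> (`|(phi N (Y w))%:E| <= cst B%:E w)%E}.
  apply: aeW => w N _; rewrite /= lee_fin ger0_norm//.
  by apply: le_trans (phi_le _ _) _; case/andP: (gB (Y w)).
have mphi' N : measurable_fun setT (fun w => (phi N (Y w))%:E) by exact/measurable_EFinP.
have mgY' : measurable_fun setT (fun w => (g (Y w))%:E) by exact/measurable_EFinP.
have [/integrable_fin_num fin _ hc] :=
  @dominated_convergence _ _ _ P' setT measurableT
  (fun N w => (phi N (Y w))%:E) (fun w => (g (Y w))%:E) (cst B%:E) mphi' mgY' ae1 ib ae2.
have {}fin := fin measurableT.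
have phiE N : (\int[P']_w (phi N (Y w))%:E =
    (\sum_(k : 'I_(2 * N.+1 * N.+1) * 'I_N.+1)
      low k * (wt k * Pr P' (Y @^-1` grid_cell s t k)))%:E)%E.
  rewrite (integral_step P' mY (@lw_ge0 N)); last by move=> k; exact: measurable_cell.
  by congr EFin; apply: eq_bigr => k _; rewrite mulrA.
have e2 : 0 < e / 2 by rewrite divr_gt0.
have [N hN] : exists N, (\int[P']_w (g (Y w))%:E - e%:E <=
    (\sum_(k : 'I_(2 * N.+1 * N.+1) * 'I_N.+1)
      low k * (wt k * Pr P' (Y @^-1` grid_cell s t k)) - e / 2)%:E)%E.
  move: hc; rewrite -(fineK fin) => /fine_cvgP[_ /cvgrPdist_lt/(_ _ e2)[N _ /(_ N (leqnn N))]].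
  rewrite /= phiE /= => /ltr_normlP[_ h]; exists N.
  by rewrite -EFinB lee_fin; move: h; set S1 := \sum_(_ | _) _; lra.
have h := @liminf_expectation _ _ _ P X g _ (@low N)
   (fun k => wt k * Pr P' (Y @^-1` grid_cell s t k)) (@grid_cell R s t N.+1) mX mg
   (@low_ge0 N) (fun k => measurable_cell _ _ _ _) _ _ (e / 2) e2.
apply: filterS (h _ _) => [n hn| |].
- exact: le_trans hN hn.
- move=> z; apply: disjoint_sum_le; first by move=> k k'; exact: grid_cell_inj.
    by case/andP: (gB z).
  by move=> k; exact: low_le.
move=> k e' e'0; have [h1 h2] := grid_u_bounds st (ltn0Sn N) k.2.
exact: Xcell.
Unshelve. all: by end_near. Qed.
End LowerBound.

Lemma bounded_integrable (d0 : measure_display) (T0 : measurableType d0)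
    (Q : probability T0 R) (f : T0 -> R) (M : R) :
  measurable_fun setT f -> (forall w, `|f w| <= M) ->
  Q.-integrable [set: T0] (fun w => (f w)%:E).
Proof.
move=> mf fM; apply: (@le_integrable _ _ _ _ _ measurableT _ (cst M%:E)).
- exact/measurable_EFinP.
- by move=> w _; rewrite /= lee_fin (le_trans (fM w))// ler_norm.
by apply/integrableP; split => //; rewrite integral_cst//= probability_setT mule1 ltry.
Qed.

Lemma expectation_affine (d0 : measure_display) (T0 : measurableType d0)
    (Q : probability T0 R) (f : T0 -> R) (M c k : R) :
  measurable_fun setT f -> (forall w, `|f w| <= M) ->
  (\int[Q]_w (c + k * f w)%:E = (c + k * fine (\int[Q]_w (f w)%:E))%:E)%E.
Proof.
move=> mf fM; have If := bounded_integrable Q mf fM.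
have fin := integrable_fin_num measurableT If.
under eq_integral do rewrite EFinD EFinM.
rewrite integralD//; last 2 first.
- by apply/integrableP; split => //; rewrite integral_cst//= probability_setT mule1 ltry.
- exact: integrableZl.
rewrite integral_cst//= probability_setT mule1 integralZl// EFinD EFinM fineK//.
Qed.

(** Applying [expectation_liminf] to [M + g] and to [M - g] turns the two lower bounds into a
    limit. The factor [rho] leaves room for a loss on each cell that vanishes with the
    size of the cell. *)
Lemma cvg_in_distribution_cells : cvg_in_distribution P P' X Y.
Proof.
split => // g cg [M gM].
have mg := continuous_measurable_plane cg.
have mgX n : measurable_fun setT (fun w => g (X n w)) by exact: (measurableT_comp mg (mX n)).
have mgY : measurable_fun setT (fun w => g (Y w)) by exact: (measurableT_comp mg mY).
have finX n := integrable_fin_num measurableT (bounded_integrable P (mgX n) (fun w => gM (X n w))).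
have finY := integrable_fin_num measurableT (bounded_integrable P' mgY (fun w => gM (Y w))).
pose Ex n := fine (\int[P]_w (g (X n w))%:E)%E.
pose Ey := fine (\int[P']_w (g (Y w))%:E)%E.
have side (k : R) : `|k| = 1 -> forall e, 0 < e -> \forall n \near \oo, k * Ey - e <= k * Ex n.
  move=> k1 e e0.
  have cgk : continuous (fun z => M + k * g z).
    by move=> z; apply: cvgD; [exact: cvg_cst|apply: cvgMr; exact: cg].
  have bk z : 0 <= M + k * g z <= 2 * M.
    have : `|k * g z| <= M by rewrite normrM k1 mul1r.
    by move=> /ler_normlP[]; move: (k * g z) => *; apply/andP; split; lra.
  apply: filterS (expectation_liminf cgk bk e0) => n.
  rewrite (expectation_affine P' M k mgY (fun w => gM (Y w))).
  rewrite (expectation_affine P M k (mgX n) (fun w => gM (X n w))).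
  by rewrite -EFinB lee_fin -addrA lerD2l.
rewrite unlock; have : Ex n @[n --> \oo] --> Ey.
  apply/cvgrPdist_le => e e0; near=> n.
  have h1 : 1 * Ey - e <= 1 * Ex n by near: n; apply: side => //; rewrite normr1.
  have h2 : -1 * Ey - e <= -1 * Ex n by near: n; apply: side => //; rewrite normrN normr1.
  by apply/ler_normlP; split; lra.
move=> h; have {}h : (Ex n)%:E @[n --> \oo] --> Ey%:E by apply: cvg_EFin; [exact: nearW|exact: h].
rewrite /Ey fineK// in h; apply: cvg_trans h; apply: near_eq_cvg; near=> n.
by rewrite /= /Ex fineK// unlock.
Unshelve. all: by end_near. Qed.
End Criterion.

(** * The cell of the maximal degree and of its age *)

Section CountableCode.
Context (R : realType) (d : measure_display) (T : measurableType d).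

Lemma measurable_of_code (C : countType) (q : T -> C) (d2 : measure_display)
    (T2 : measurableType d2) (f : C -> T2) :
  (forall c, measurable [set w | q w = c]) -> measurable_fun [set: T] (fun w => f (q w)).
Proof.
move=> mq _ B mB; rewrite setTI.
rewrite (_ : _ @^-1` B = \bigcup_k (if unpickle k is Some c then
    if `[< B (f c) >] then [set w | q w = c] else set0 else set0)).
  apply: bigcup_measurable => k _; case: unpickle => // c; case: ifPn => // _; exact: mq.
apply/seteqP; split => [w Bw|w [k _]].
  by exists (pickle (q w)) => //; rewrite pickleK asboolT.
by case: unpickle => // c; case: ifPn => // /asboolP Bc /= qc; rewrite /= qc.
Qed.

Context (P : probability T R) (m : nat) (weight : nat -> {RV P >-> R})
  (target : nat -> 'I_m -> {RV P >-> nat}).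

(** The degrees at a given time take countably many values, so that no
    condition has to be checked on the functionals applied to them. *)
Lemma measurable_of_degrees (d2 : measure_display) (T2 : measurableType d2)
    (n : nat) (G : (nat -> nat) -> T2) :
  (forall z z', (forall i, (i <= n)%N -> z i = z' i) -> G z = G z') ->
  measurable_fun [set: T] (fun w => G (fun i => in_degree target n i w)).
Proof.
move=> GE; pose code w := [seq in_degree target n i w | i <- iota 0 n.+1].
have nthE w i : (i <= n)%N -> nth 0%N (code w) i = in_degree target n i w.
  by move=> ile; rewrite (nth_map 0%N) ?size_iota ?nth_iota ?add0n.
have -> : (fun w => G (fun i => in_degree target n i w)) = (fun w => G (nth 0%N (code w))).
  by apply/funext => w; apply: GE => i ile; rewrite nthE.
apply: (@measurable_of_code _ code _ T2 (fun c => G (nth 0%N c))) => c.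
have [sz|sz] := eqVneq (size c) n.+1; last first.
  rewrite (_ : [set w | _] = set0)//; apply/seteqP; split => // w /= cw.
  by move: sz; rewrite -cw size_map size_iota eqxx.
rewrite (_ : [set w | _] = \bigcap_(i in [set i | (i <= n)%N])
    (in_degree target n i @^-1` [set nth 0%N c i])).
  by apply: bigcap_measurableType => i _; exact: (measurable_degree_itv weight).
apply/seteqP; split => [w /= <- i /= ile|w h]; first by rewrite nthE.
apply: (@eq_from_nth _ 0%N); first by rewrite size_map size_iota sz.
by move=> i; rewrite size_map size_iota => ile; rewrite nthE//; exact: h.
Qed.

Lemma measurable_max_degree (n : nat) (gamma s t : R) (f : nat -> R) (x y : R) :
  measurable_fun [set: T] (max_degree target n gamma s t f x y).
Proof.
apply: (@measurable_of_degrees _ _ n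
  (fun z => sup [set ((z i)%:R - x) / y | i in C_ n gamma s t f])) => z z' zz'.
congr sup; apply: eq_imagel => i [/andP[_ ile] _]; by rewrite zz'.
Qed.

Lemma measurable_I_ (n : nat) (gamma s t : R) (f : nat -> R) :
  measurable_fun [set: T] (I_ target n gamma s t f).
Proof.
apply: (@measurable_of_degrees _ _ n
  (fun z => inf [set (i%:R : R) | i in [set i | C_ n gamma s t f i /\
         forall j, C_ n gamma s t f j -> (z j <= z i)%N]])) => z z' zz'.
congr (inf (image _ _)); apply/seteqP; split => i [Ci h]; split => // j Cj; move: (h j Cj);
  by case: Ci Cj => [/andP[_ i1] _] [/andP[_ j1] _]; rewrite !zz'.
Qed.

End CountableCode.

Section CellEvent.
Context (R : realType) (T : Type) (m : nat) (target : nat -> 'I_m -> T -> nat).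

Lemma C_in_window (n : nat) (gamma s t : R) (f : nat -> R) i :
  C_ n gamma s t f i <-> in_window s t (f n * n%:R `^ gamma) n i.
Proof.
rewrite /C_ /in_window !mulrA; split => [[h1 h2]|/andP[h1 h2]]; last by split.
by rewrite h1 h2.
Qed.

(** When some degree exceeds the level [x], and no degree exceeds it outside of
    the block of ages [u, u'], the maximal degree is attained in that block only. *)
Lemma cell_event (n : nat) (gamma s t : R) (f : nat -> R) (c y0 x x' u u' : R) (w : T) :
  let rho := f n * n%:R `^ gamma in
  0 < rho -> 0 < y0 -> x < x' ->
  (forall i, in_window s t rho n i ->
     (in_degree target n i w)%:R <= c + level u u' rho x x' i * y0) ->
  ~ (forall i, in_window s t rho n i -> (in_degree target n i w)%:R <= c + x * y0) ->
  cell x x' u u' (max_degree target n gamma s t f c y0 w, I_ target n gamma s t f w / rho).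
Proof.
move=> rho rho0 y00 xx' hle hgt.
have [i0 [Ci0 i0x]] : exists i, in_window s t rho n i /\ c + x * y0 < (in_degree target n i w)%:R.
  apply: contrapT => h; apply: hgt => i wi; rewrite leNgt; apply/negP => hi.
  by apply: h; exists i.
pose V := [set ((in_degree target n i w)%:R - c) / y0 | i in C_ n gamma s t f].
have Vub : ubound V x'.
  move=> _ [i /C_in_window wi <-]; rewrite ler_pdivrMr// lerBlDl.
  apply: le_trans (hle _ wi) _; rewrite lerD2l ler_pM2r//.
  by rewrite /level; case: ifPn => // _; exact: ltW.
have Vi0 : V (((in_degree target n i0 w)%:R - c) / y0) by exists i0 => //; exact/C_in_window.
pose A := [set i | C_ n gamma s t f i /\
  forall j, C_ n gamma s t f j -> (in_degree target n j w <= in_degree target n i w)%N].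
have inw i : in_window s t rho n i -> i \in [seq i <- iota 0 n.+1 | in_window s t rho n i].
  move=> wi; rewrite mem_filter wi mem_iota /= add0n ltnS.
  by case/andP: wi => /andP[].
have [i1 Ai1] : exists i, A i.
  have [|i1] := seq_max (fun i => (in_degree target n i w)%:R : R)
    (r := [seq i <- iota 0 n.+1 | in_window s t rho n i]) (x := i0).
    exact: inw.
  rewrite mem_filter => /andP[wi1 _] h; exists i1; split; first exact/C_in_window.
  move=> j /C_in_window wj; rewrite -(ler_nat R); apply: h; exact: inw.
have exA : exists i, `[< A i >] by exists i1; exact/asboolP.
(* The infimum in [I_] ranges over a nonempty set of integers and is attained. *)
have [I /asboolP AI Imin] := ex_minnP exA.
have infE : inf [set (i%:R : R) | i in A] = I%:R.
  apply/eqP; rewrite eq_le; apply/andP; split.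
    by apply: ge_inf; [exists I%:R => _ [i /asboolP/Imin Ii <-]; rewrite ler_nat|exists I].
  apply: lb_le_inf; first by exists I%:R, I.
  by move=> _ [i /asboolP/Imin Ii <-]; rewrite ler_nat.
split => /=.
  apply/andP; split.
    apply: (@lt_le_trans _ _ (((in_degree target n i0 w)%:R - c) / y0)).
      by rewrite ltr_pdivlMr// ltrBrDl.
    by apply: ub_le_sup => //; exists x'.
  by apply: sup_le_ub => //; eexists; exact: Vi0.
rewrite /I_ -/A infE ltr_pdivlMr// ler_pdivrMr//.
have [/C_in_window wI /(_ i0)] := AI; have := hle _ wI.
rewrite /level /in_block; case: ifPn => // _ h1.
have /C_in_window Ci0' := Ci0; move=> /(_ Ci0'); rewrite -(ler_nat R) => h2.
by have := lt_le_trans i0x (le_trans h2 h1); rewrite ltxx.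
Qed.

End CellEvent.

Section WeightFunction.
Context (R : realType) (C : R).
Hypothesis C0 : 0 <= C.

(** The loss incurred on a cell of height [x' - x], with [C] the mean number of exceedances of
    the level [0]. *)
Definition cell_factor (x x' : R) : R := expR (- (C * (expR (- x) - expR (- x')))).

Lemma cell_factor01 (x x' : R) : x < x' -> 0 <= cell_factor x x' <= 1.
Proof.
move=> xx'; rewrite /cell_factor expR_ge0 /= -(expR0 R) ler_expR oppr_le0 mulr_ge0//.
by rewrite subr_ge0 ler_expR lerN2 ltW.
Qed.

(** With [delta <= 1 / 2], the exponentials of [- x] and [- x'] differ by at most [3 delta]
    times that of [- z]. *)
Lemma cell_factor_near1 (z e : R) : 0 < e -> exists2 delta : R, 0 < delta &
  forall x x', x < z <= x' -> x' - x < delta -> 1 - e <= cell_factor x x'.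
Proof.
move=> e0; pose D := C * expR (- z) + 1.
have D0 : 0 < D by rewrite ltr_wpDl// mulr_ge0// expR_ge0.
exists (Num.min (1 / 2) (e / (3 * D))); first by rewrite lt_min !divr_gt0// mulr_gt0.
move=> x x' /andP[xz zx']; rewrite lt_min => /andP[d1 d2].
apply: le_trans (expR_ge1Dx _); rewrite lerD2l lerN2.
have -> : expR (- x) - expR (- x') = expR (- z) * (expR (z - x) - expR (z - x')).
  by rewrite mulrBr -!expRD; congr (expR _ - expR _); ring.
set p := z - x; set q := x' - z.
have p0 : 0 < p by rewrite subr_gt0.
have q0 : 0 <= q by rewrite subr_ge0.
have pq : p + q = x' - x by rewrite /p /q; ring.
have h1 : expR p <= 1 + 2 * (p + q).
  rewrite -[p]opprK expRN; have h : 1 - p <= expR (- p) by exact: expR_ge1Dx.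
  have p1 : 0 < 1 - p by rewrite -pq in d1; lra.
  apply: (@le_trans _ _ (1 - p)^-1); first by rewrite lef_pV2// posrE// expR_gt0.
  by rewrite -[leLHS]mul1r ler_pdivrMr// ?opprK; rewrite -pq in d1; nra.
have h2 : 1 - (p + q) <= expR (- q).
  apply: le_trans (expR_ge1Dx _); lra.
have -> : z - x' = - q by rewrite /q opprB.
apply: (@le_trans _ _ (D * (3 * (p + q)))); last first.
  move: d2; rewrite -pq ltr_pdivlMr ?mulr_gt0// => /ltW; apply: le_trans.
  by rewrite le_eqVlt; apply/orP; left; apply/eqP; ring.
rewrite mulrA; apply: ler_pM.
- by rewrite mulr_ge0// expR_ge0.
- by rewrite subr_ge0 ler_expR; lra.
- by rewrite /D lerDl.
- lra.
Qed.

End WeightFunction.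

(** The conditional law of the age given that the maximum lies in a small cell
    [x, x'] is nearly uniform on the logarithmic scale. *)
Lemma cell_gap (R : realType) (kappa K x x' q : R) : 0 <= kappa -> 0 <= K -> x < x' -> 0 <= q ->
  cell_factor (kappa * K) x x' *
    ((expR (- (kappa * (K * expR (- x')))) - expR (- (kappa * (K * expR (- x))))) * q) <=
  expR (- (kappa * (expR (- x) * K + (expR (- x') - expR (- x)) * (q * K)))) -
  expR (- (kappa * (K * expR (- x)))).
Proof.
move=> k0 K0 xx' q0; rewrite /cell_factor.
set dl := kappa * K * _; set c := kappa * (K * expR (- x)).
have dl0 : 0 <= dl by rewrite !mulr_ge0// subr_ge0 ler_expR lerN2 ltW.
have -> : kappa * (K * expR (- x')) = c - dl by rewrite /c /dl; ring.
have -> : kappa * (expR (- x) * K + (expR (- x') - expR (- x)) * (q * K)) = c - dl * q.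
  by rewrite /c /dl; ring.
have -> : expR (- dl) * ((expR (- (c - dl)) - expR (- c)) * q) =
    expR (- c) * ((1 - expR (- dl)) * q).
  have -> : - (c - dl) = - c + dl by ring.
  by rewrite expRD [expR (- dl)]expRN; field; rewrite gt_eqF// expR_gt0.
have -> : expR (- (c - dl * q)) - expR (- c) = expR (- c) * (expR (dl * q) - 1).
  have -> : - (c - dl * q) = - c + dl * q by ring.
  by rewrite expRD; ring.
rewrite ler_wpM2l ?expR_ge0//; apply: (@le_trans _ _ (dl * q)).
  by rewrite ler_wpM2r// lerBlDr -lerBlDl; exact: expR_ge1Dx.
by rewrite lerBrDl; exact: expR_ge1Dx.
Qed.

(** * Convergence of the maximal degree *)

Section Convergence.
Context (R : realType) (d d' : measure_display) (T : measurableType d)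
  (P : probability T R) (T' : measurableType d') (P' : probability T' R)
  (m : nat) (W : {RV P >-> R}) (weight : nat -> {RV P >-> R})
  (target : nat -> 'I_m -> {RV P >-> nat})
  (Pi : T' -> set (R * R)) (U : {RV P' >-> R}) (s t : R).
Hypotheses (m_gt0 : (0 < m)%N) (W_ge0 : forall w, 0 <= W w)
  (W_gt0 : P [set w | 0 < W w] = 1%E) (EW : ('E_P[W] = 1)%E)
  (wrg : weighted_recursive_graph W weight target)
  (ppp : poisson_point_process P' (half_plane R) (@nu_intensity R) Pi)
  (s_gt0 : 0 < s) (st : s < t)
  (U_unif : uniform_distributed U (ln s) (ln t))
  (U_indep : independent_of_points Pi U).

Lemma gumbel_sup_strip (shift : R) :
  gumbel_distributed P' (fun w => sup (strip_values Pi s t w) - shift)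
    (ln (ln (t / s)) - shift).
Proof.
move=> x.
have K0 : 0 < ln (t / s) by rewrite ln_gt0// ltr_pdivlMr// mul1r.
have -> : [set w | sup (strip_values Pi s t w) - shift <= x] =
    [set w | sup (strip_values Pi s t w) <= x + shift].
  by apply/seteqP; split => w /=; rewrite lerBlDr.
have mS : measurable [set w | sup (strip_values Pi s t w) <= x + shift].
  rewrite -[X in measurable X]setTI -preimage_itvNyc.
  by apply: (measurable_sup_strip s t ppp).
rewrite (PrE P' mS) (sup_strip_law s_gt0 st ppp); congr (expR (- _))%:E.
rewrite -[X in X * _]lnK// -expRD; congr expR; ring.
Qed.

(** The event in [cell_event] is a difference of two nested events, whose limits are given by
    [degrees_below_cvg]. *)
Lemma max_degree_cvg (gamma shift C0 Lam sigma2 : R) (f r a b L x y : nat -> R) :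
  (\int[P]_w (W w ^+ 2)%:E = sigma2%:E)%E -> 0 <= C0 -> 0 <= Lam ->
  regime W s t (expR (- shift)) C0 Lam r a b L ->
  (\forall n \near \oo, f n * n%:R `^ gamma = r n) ->
  (\forall n \near \oo, x n = m%:R * b n * L n) ->
  (\forall n \near \oo, y n = m%:R * a n * L n) ->
  cvg_in_distribution P P'
    (fun n w => (max_degree target n gamma s t f (x n) (y n) w,
                 I_ target n gamma s t f w / (f n * n%:R `^ gamma)))
    (fun w => (sup (strip_values Pi s t w) - shift, expR (U w))).
Proof.
move=> EW2 C00 Lam0 reg fr xE yE.
pose K := ln (t / s).
have K0 : 0 < K by rewrite /K ln_gt0// ltr_pdivlMr// mul1r.
have kK0 : 0 <= expR (- shift) * K by rewrite mulr_ge0 ?expR_ge0 ?(ltW K0).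
apply: (@cvg_in_distribution_cells _ _ _ _ _ _ _ _ _ s t (cell_factor (expR (- shift) * K)) st).
- move=> n; apply: measurable_fun_pair; first exact: measurable_max_degree.
  by apply: measurable_funM => //; exact: measurable_I_.
- apply: measurable_fun_pair; last exact: (measurableT_comp (@measurable_expR R)).
  by apply: measurable_funB => //; exact: (measurable_sup_strip s t ppp).
- by rewrite (uniform_itv s_gt0 st U_unif (lexx s) st (lexx t)) divff// gt_eqF.
- by move=> z z' zz'; exact: cell_factor01.
- by move=> z e e0; exact: cell_factor_near1.
move=> z z' u u' zz' su uu' u't e e0.
have u0 : 0 < u by exact: lt_le_trans su.
have q0 : 0 <= ln (u' / u) / K.
  by rewrite divr_ge0 ?(ltW K0)// ln_ge0// ler_pdivlMr// mul1r ltW.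
have -> : Pr P' ((fun w => (sup (strip_values Pi s t w) - shift, expR (U w))) @^-1`
    cell z z' u u') = (expR (- (expR (- shift) * (K * expR (- z')))) -
      expR (- (expR (- shift) * (K * expR (- z))))) * (ln (u' / u) / K).
  by rewrite -(limit_cell s_gt0 st ppp U_unif U_indep).
have gap := cell_gap (expR_ge0 (- shift)) (ltW K0) zz' q0.
rewrite divfK ?gt_eqF// in gap.
have c1 := degrees_below_cvg (y := z) (y' := z') wrg m_gt0 W_ge0 W_gt0 EW EW2 s_gt0 su uu' u't C00 Lam0 reg.
have c0 := degrees_below_cvg (y := z) (y' := z) wrg m_gt0 W_ge0 W_gt0 EW EW2 s_gt0 su uu' u't C00 Lam0 reg.
rewrite subrr mul0r addr0 [expR (- z) * _]mulrC in c0.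
have e2 : 0 < e / 2 by rewrite divr_gt0.
pose E v n := [set w | forall i, in_window s t (r n) n i -> (in_degree target n i w)%:R <=
  m%:R * ((b n + level u u' (r n) z v i * a n) * L n)].
near=> n.
have rn0 : 0 < r n by near: n; exact: near_large (regime_r reg).
have Ln0 : 0 < L n by near: n; exact: near_large (regime_L reg).
have an0 : 0 < a n by near: n; exact: (regime_a reg).
have frn : f n * n%:R `^ gamma = r n by near: n.
have xn : x n = m%:R * b n * L n by near: n.
have yn : y n = m%:R * a n * L n by near: n.
have yn0 : 0 < y n by rewrite yn !mulr_gt0 ?ltr0n.
have h1 : expR (- (expR (- shift) * (expR (- z) * K + (expR (- z') - expR (- z)) * ln (u' / u))))
    - e / 2 <= Pr P (E z' n).
  near: n; move/cvgrPdist_le: c1 => /(_ _ e2); apply: filterS => n /ler_normlP[_].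
  by rewrite lerBlDr -lerBlDl.
have h0 : Pr P (E z n) <= expR (- (expR (- shift) * (K * expR (- z)))) + e / 2.
  near: n; move/cvgrPdist_le: c0 => /(_ _ e2); apply: filterS => n /ler_normlP[+ _].
  by rewrite opprB lerBlDr addrC.
have mE v : measurable (E v n).
  apply: measurable_forall => i _.
  exact: (measurable_degree_itv weight target n i (fun k => k%:R <= _)).
have sub : E z n `<=` E z' n.
  move=> w h i wi; apply: le_trans (h i wi) _.
  rewrite ler_pM2l ?ltr0n// ler_pM2r// lerD2l ler_pM2r// /level.
  by case: ifPn => // _; exact: ltW.
have : Pr P (E z' n `\` E z n) <= Pr P ((fun w => (max_degree target n gamma s t f (x n) (y n) w,
    I_ target n gamma s t f w / (f n * n%:R `^ gamma))) @^-1` cell z z' u u').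
  apply: Pr_mono; first by apply: measurableD; exact: mE.
    rewrite -[X in measurable X]setTI.
    apply: (measurable_fun_pair (measurable_max_degree weight target n gamma s t f (x n) (y n))) => //.
      by apply: measurable_funM => //; exact: (measurable_I_ weight).
    exact: measurable_cell.
  move=> w [h h']; have thr i v : m%:R * ((b n + level u u' (r n) z v i * a n) * L n) =
      x n + level u u' (r n) z v i * y n by rewrite xn yn; ring.
  apply: cell_event => //; rewrite frn//.
    by move=> i wi; have := h i wi; rewrite thr.
  move=> h2; apply: h' => i wi; rewrite thr; have := h2 i wi.
  by rewrite /level if_same.
apply: le_trans; rewrite Pr_setD//; try exact: mE.
apply: le_trans (lerB h1 h0).
by rewrite opprD addrACA -opprD -splitr lerD2r.
Unshelve. all: by end_near. Qed.

End Convergence.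

Theorem theorem2p15 (R : realType) (d d' : measure_display)
    (T : measurableType d) (P : probability T R)
    (T' : measurableType d') (P' : probability T' R)
    (m : nat) (W : {RV P >-> R}) (weight : nat -> {RV P >-> R})
    (target : nat -> 'I_m -> {RV P >-> nat})
    (Pi : T' -> set (R * R)) (U : {RV P' >-> R}) (s t : R)
    (m_gt0 : (0 < m)%N)
    (W_ge0 : forall w, 0 <= W w)
    (W_gt0 : P [set w | 0 < W w] = 1%E)
    (EW : ('E_P[W] = 1)%E)
    (wrg : weighted_recursive_graph W weight target)
    (ppp : poisson_point_process P' (half_plane R) (@nu_intensity R) Pi)
    (s_gt0 : 0 < s) (st : s < t)
    (U_unif : uniform_distributed U (ln s) (ln t))
    (U_indep : independent_of_points Pi U) :
  (* the maxima over points of Pi exist almost surely *)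
  {ae P', forall w, is_max (strip_values Pi s t w) (sup (strip_values Pi s t w))}
  /\
  (forall (a b c1 tau : R) (l : nat -> R) (zeta0 : R),
     let gamma := (tau + 1)^-1 in
     let shift := zeta0 * (tau + 1) ^+ 2 / (2 * tau) in
     let M := fun w => sup (strip_values Pi s t w) - shift in
     0 < a -> 0 < c1 -> 0 < tau < 1 -> tail_RV W a b c1 tau ->
     (forall n, (0 < n)%N -> 0 < l n) -> 0 <= zeta0 ->
     (ln (l n)) ^+ 2 / ln n%:R @[n --> \oo] --> zeta0 ->
     cvg_in_distribution P P'
       (fun n w =>
          (max_degree target n gamma s t l
             (m%:R * (1 - gamma) * b_RV a b c1 tau (n%:R `^ gamma) * ln n%:R)
             (m%:R * (1 - gamma) * a_RV c1 tau (n%:R `^ gamma) * ln n%:R) w,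
           I_ target n gamma s t l w / (l n * n%:R `^ gamma)))
       (fun w => (M w, expR (U w)))
     /\ gumbel_distributed P' M (ln (ln (t / s)) - shift))
  /\
  (forall (a b c1 tau : R),
     let t_ := fun n : nat =>
       expR (- (tau * ln n%:R / ln (b_RaV a b c1 tau n%:R))) in
     let M := fun w => sup (strip_values Pi s t w) in
     0 < a -> 0 < c1 -> 1 < tau -> tail_RaV W a b c1 tau ->
     cvg_in_distribution P P'
       (fun n w =>
          (max_degree target n 1 s t t_
             (m%:R * b_RaV a b c1 tau (t_ n * n%:R) * ln (t_ n)^-1)
             (m%:R * a_RaV a b c1 tau (t_ n * n%:R) * ln (t_ n)^-1) w,
           I_ target n 1 s t t_ w / (t_ n * n%:R)))
       (fun w => (M w, expR (U w)))
     /\ gumbel_distributed P' M (ln (ln (t / s)))).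
Proof.
have t_gt0 : 0 < t by exact: lt_trans st.
split; first exact: strip_max_ae.
split.
  move=> a b c1 tau l zeta0 gamma shift M a0 c10 tau01 htail l0 _ hl.
  have tau0 : 0 < tau by case/andP: tau01.
  split; last exact: gumbel_sup_strip.
  have [sigma2 EW2] := second_moment_RV a0 c10 tau0 W_ge0 htail.
  have lnE n : ln (n%:R `^ gamma) = gamma * ln n%:R :> R by rewrite ln_powR.
  apply: (max_degree_cvg m_gt0 W_ge0 W_gt0 EW wrg ppp s_gt0 st U_unif U_indep EW2 _ _
    (regime_RV s_gt0 (ltW st) a0 c10 tau01 htail l0 hl)).
  - by rewrite mulr_ge0// expR_ge0.
  - exact: powR_ge0.
  - exact: nearW.
  - apply: nearW => n; rewrite -/gamma -lnE.
    by rewrite -[quantile _ _ _ _ _]/(b_RV a b c1 tau (n%:R `^ gamma)); ring.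
  - apply: nearW => n; rewrite -/gamma -lnE.
    by rewrite -[spacing _ _ _]/(a_RV c1 tau (n%:R `^ gamma)); ring.
move=> a b c1 tau t_ M a0 c10 tau1 htail.
have tau0 : 0 < tau by exact: lt_trans tau1.
have gum := gumbel_sup_strip ppp s_gt0 st 0.
rewrite subr0 in gum.
have ME : M = (fun w => sup (strip_values Pi s t w) - 0).
  by apply/funext => w; rewrite subr0.
split; last by rewrite ME.
have [sigma2 EW2] := second_moment_RaV a0 c10 tau0 tau1 W_ge0 htail.
have reg := regime_RaV s_gt0 (ltW st) a0 c10 tau1 htail.
pose L (n : nat) : R := tau * ln n%:R / quantile a b c1 tau (ln n%:R).
have tE n : t_ n = expR (- L n) by rewrite /t_ /b_RaV expRK.
have lntV n : ln (t_ n)^-1 = L n.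
  by rewrite tE -expRN opprK expRK.
have lnr n : (0 < n)%N -> ln (t_ n * n%:R) = ln n%:R - L n.
  by move=> n0; rewrite tE lnM ?posrE ?expR_gt0 ?ltr0n// expRK addrC.
have -> : (fun n w =>
    (max_degree target n 1 s t t_ (m%:R * b_RaV a b c1 tau (t_ n * n%:R) * ln (t_ n)^-1)
       (m%:R * a_RaV a b c1 tau (t_ n * n%:R) * ln (t_ n)^-1) w,
     I_ target n 1 s t t_ w / (t_ n * n%:R))) = (fun n w =>
    (max_degree target n 1 s t t_ (m%:R * b_RaV a b c1 tau (t_ n * n%:R) * ln (t_ n)^-1)
       (m%:R * a_RaV a b c1 tau (t_ n * n%:R) * ln (t_ n)^-1) w,
     I_ target n 1 s t t_ w / (t_ n * n%:R `^ 1))).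
  by apply/funext => n; apply/funext => w; rewrite powRr1.
have k1 : expR (- (0 : R)) = 1 by rewrite oppr0 expR0.
rewrite ME; rewrite -{1}k1 in reg.
apply: (max_degree_cvg m_gt0 W_ge0 W_gt0 EW wrg ppp s_gt0 st U_unif U_indep EW2 _ _ reg).
- by rewrite mulr_ge0// expR_ge0.
- by rewrite mulr_ge0// powR_ge0.
- by apply: nearW => n; rewrite powRr1// tE.
- near=> n; have n0 : (0 < n)%N by near: n; exact: nbhs_infty_gt.
  by rewrite lntV -[b_RaV _ _ _ _ _]/(expR (quantile a b c1 tau (ln (t_ n * n%:R)))) lnr.
- near=> n; have n0 : (0 < n)%N by near: n; exact: nbhs_infty_gt.
  rewrite lntV -[a_RaV _ _ _ _ _]/(spacing c1 tau (ln (t_ n * n%:R)) *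
    expR (quantile a b c1 tau (ln (t_ n * n%:R)))) lnr//.
Unshelve. all: by end_near. Qed.
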